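(* Let $\mathbb{B}$ be a separable Banach space with dual $\mathbb{B}^*$ and duality pairing $\langle\cdot,\cdot\rangle$. Let $X=\{X_{\mathbf t},\ \mathbf t\in\mathbb{Z}^m\}$ be a centered Gaussian process with values in $\mathbb{B}$ such that $X_{\mathbf t}$ has the same distribution $\mathcal P$ for every $\mathbf t$, and let $\mathcal E$ be the concentration ellipsoid of $\mathcal P$. Let $(T_n)$ be an increasing sequence ($T_n\subset T_{n+1}$) of finite subsets of $\mathbb{Z}^m$ with $\nu_n=\operatorname{card}(T_n)\to\infty$, and put $W_n=\operatorname{conv}\{X_{\mathbf t},\ \mathbf t\in T_n\}$. Suppose that for every $x^*\in\mathbb{B}^*$, $$E\langle X_{\mathbf t},x^*\rangle\langle X_{\mathbf s},x^*\rangle\to 0\quad\text{as } |\mathbf t-\mathbf s|\to\infty.$$ Then, almost surely, $\frac{1}{b(\nu_n)}W_n\to\mathcal E$ as $n\to\infty$ in the Hausdorff distance.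
   Context: For $\mathbf t=(t_1,\dots,t_m),\mathbf s=(s_1,\dots,s_m)$, $|\mathbf t-\mathbf s|=\max_{1\le k\le m}|t_k-s_k|$. $\operatorname{conv}\{A\}$ denotes the closed convex hull of $A\subset\mathbb{B}$. $b(t)=\sqrt{2\ln(t\vee 2)}$. The concentration ellipsoid $\mathcal E$ of the centered Gaussian measure $\mathcal P$ on $\mathbb{B}$ is the closed unit ball of the reproducing kernel Hilbert space $\mathrm H\subset\mathbb{B}$ of $\mathcal P$ (a compact subset of $\mathbb{B}$). The Hausdorff distance between nonempty compact sets $A,B\subset\mathbb{B}$ is $\rho_{\mathbb{B}}(A,B)=\max\{\inf\{\epsilon: A\subset B^\epsilon\},\inf\{\epsilon: B\subset A^\epsilon\}\}$, where $A^\epsilon$ is the open $\epsilon$-neighbourhood of $A$. *)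

(* Defs.v *)
From HB Require Import structures.
From mathcomp Require Import all_boot all_order all_algebra finmap.
From mathcomp Require Import all_classical all_reals all_analysis.
Unset Printing Implicit Defensive.
Import Order.TTheory GRing.Theory Num.Theory.
Import numFieldNormedType.Exports.
Local Open Scope classical_set_scope.
Local Open Scope ring_scope.

Section Defs.
Context {R : realType}.

Definition dual (B : normedModType R) : set (B -> R) :=
  [set f | (forall (a : R) (x y : B), f (a *: x + y) = a * f x + f y)
           /\ continuous f].

Definition separable (B : normedModType R) : Prop :=
  exists D : set B, countable D /\ closure D = setT.

(** The cylinder sigma-algebra of B, generated by the continuous linear
    functionals (it coincides with the Borel sigma-algebra when B is a
    separable Banach space). *)
Definition cylinder_gen (B : normedModType R) : set (set B) :=
  [set C | exists f, exists A : set R,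
      dual B f /\ measurable A /\ C = f @^-1` A].
Definition cylinder_sigma (B : normedModType R) : set (set B) :=
  <<s cylinder_gen B >>.

Definition centered_gaussian d (Om : measurableType d) (P : probability Om R)
  (Y : Om -> R) : Prop :=
  (forall A : set R, measurable A -> measurable (Y @^-1` A)) /\
  ((exists s : R, 0 < s /\ forall A : set R, measurable A ->
       P (Y @^-1` A) = normal_prob 0 s A) \/
   (forall A : set R, measurable A -> P (Y @^-1` A) = \d_(0:R) A)).

Definition Zm (m : nat) := {ffun 'I_m -> int}.
Definition dist_inf (m : nat) (t s : Zm m) : nat :=
  \max_(k < m) `|t k - s k|%N.

(** Concentration ellipsoid of the (centered Gaussian) law of Y : Om -> B:
    the closed unit ball of the RKHS H. H consists of the (Pettis)
    integrals h = E[ g Y ] where g ranges over the closure in L^2(P) of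
    {<Y, x^*> : x^* in B^*}, with ||h||_H = ||g||_{L^2}. *)
Definition concentration_ellipsoid (B : normedModType R)
  d (Om : measurableType d) (P : probability Om R) (Y : Om -> B) : set B :=
  [set h | exists g : Om -> R,
      measurable_fun setT g /\
      (exists fs : nat -> (B -> R), (forall n, dual B (fs n)) /\
         (('E_P[fun w => ((g w - fs n (Y w)) ^+ 2)%R])%E @[n --> \oo] --> 0%E)) /\
      ('E_P[fun w => (g w ^+ 2)%R] <= 1)%E /\
      (forall f, dual B f -> ('E_P[fun w => (g w * f (Y w))%R])%E = (f h)%:E)].

Definition conv_hull (B : normedModType R) (A : set B) : set B :=
  [set y | exists n (w : 'I_n -> R) (p : 'I_n -> B),
      (forall i, 0 <= w i) /\ \sum_(i < n) w i = 1 /\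
      (forall i, A (p i)) /\ y = \sum_(i < n) w i *: p i].
Definition closed_conv_hull (B : normedModType R) (A : set B) : set B :=
  closure (conv_hull B A).

Definition eps_nbhd (B : normedModType R) (A : set B) (e : R) : set B :=
  [set y | exists2 a, A a & `|y - a| < e].
Definition hausdorff_dist (B : normedModType R) (A C : set B) : R :=
  Num.max (inf [set e | A `<=` eps_nbhd B C e])
          (inf [set e | C `<=` eps_nbhd B A e]).

Definition bfun (t : R) : R := Num.sqrt (2 * ln (Num.max t 2)).

End Defs.

Arguments centered_gaussian {R d Om} P Y.
Arguments concentration_ellipsoid {R} B {d Om} P Y.
Arguments dist_inf {m} t s.

(* Main.v *)
(** The proof compares support functions. Write s(f) for the standard deviation
    of f(X_t). By Cauchy-Schwarz and the Pettis integral E[f(X) X] / s(f), the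
    support function of the ellipsoid E is s, while that of W_n is the maximum of
    f(X_t) over T_n.

    For one functional f, max_{T_n} f(X_t) / b(nu_n) tends to s(f) almost surely.
    Both bounds are checked along the times at which nu_n passes a power of two,
    with Borel-Cantelli. The upper one is the Gaussian tail bound. For the lower
    one, discard all but a fixed proportion of T_n so that the remaining points
    are far apart and hence nearly uncorrelated; the second moment method gives a
    small but not negligible probability of a large maximum, and the
    Maurey-Pisier concentration inequality boosts it.

    To pass to all f at once, concentration also yields a compact K with
    W_n / b(nu_n) eventually inside a small neighbourhood of K: countably many
    functionals g_i cut out a neighbourhood of a cube spanned by finitely many
    points of a dense sequence, and sup_i g_i(X_t) has Gaussian tails. On a
    neighbourhood of a finite set, finitely many functionals approximate the dual
    unit ball uniformly, and Hahn-Banach separation turns the inequalities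
    between support functions into inclusions of convex sets. *)
Require Import Defs.
From HB Require Import structures.
From mathcomp Require Import all_boot all_order all_algebra finmap.
From mathcomp Require Import all_classical all_reals all_analysis.
From mathcomp Require Import measurable_realfun.
From mathcomp Require Import ring lra.
Import Order.TTheory GRing.Theory Num.Theory.
Import numFieldNormedType.Exports.
Local Open Scope classical_set_scope.
Local Open Scope ring_scope.
Set Implicit Arguments.
Unset Strict Implicit.
Unset Printing Implicit Defensive.

(** * Integrals of real functions and Laplace transforms *)

(** Gaussianity is available only as the one-dimensional law of each finite combination of
    functionals, so independence has to come from Laplace transforms. The rotation argument needs
    the argmax of the rotated family to be independent of the orthogonal companion of that family.
    To this end [expR (l * rot')] minus its mean is shown to integrate to 0 against every
    exponential of the differences of the rotated family; this orthogonality then passes from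
    exponentials to powers, sines, signs and finally products of half-line indicators, among them
    the indicator of the argmax event. Concentration bounds a product P(max >= r) P(max <= m), so
    either factor may be the one known not to be small. For the lower bound the known factor is only
    of order exp(-dl^2 b^2 / 16), but the product is at most exp(-dl^2 b^2 / 8), and the quotient is
    still summable; for tightness the known factor is at least 1/2. Powers of two suit
    Borel-Cantelli because exp(-c b(2^k)^2) is geometric in k while b(2^(k+1)) / b(2^k) tends to
    1. *)

Section RealIntegral.
Context d (T : measurableType d) (R : realType) (mu : {measure set T -> \bar R}).
Implicit Types f g : T -> R.

Lemma L1_measurable f : mu.-integrable setT (EFin \o f) -> measurable_fun setT f.
Proof. by move=> /measurable_int/measurable_EFinP. Qed.

Lemma L1_le f g : measurable_fun setT f -> (forall x, `|f x| <= g x) ->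
  mu.-integrable setT (EFin \o g) -> mu.-integrable setT (EFin \o f).
Proof.
move=> mf fg; apply: (le_integrable measurableT); first exact/measurable_EFinP.
by move=> x _ /=; rewrite lee_fin (le_trans (fg x))// ler_norm.
Qed.

Lemma L1D f g : mu.-integrable setT (EFin \o f) ->
  mu.-integrable setT (EFin \o g) ->
  mu.-integrable setT (EFin \o (fun x => f x + g x)).
Proof. by move=> /(integrableD measurableT) /[apply]; exact. Qed.

Lemma L1Z k f : mu.-integrable setT (EFin \o f) ->
  mu.-integrable setT (EFin \o (fun x => k * f x)).
Proof. by move=> /(integrableZl measurableT k); exact. Qed.

Lemma L1_norm f : mu.-integrable setT (EFin \o f) ->
  mu.-integrable setT (EFin \o (fun x => `|f x|)).
Proof. by move=> /integrable_norm; exact. Qed.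

Lemma L1_sum I (s : seq I) (f : I -> T -> R) :
  (forall i, mu.-integrable setT (EFin \o f i)) ->
  mu.-integrable setT (EFin \o (fun x => \sum_(i <- s) f i x)).
Proof.
move=> if_; elim: s => [|i s ih].
  apply: eq_integrable (integrable0 mu setT) => // x _.
  by rewrite /= big_nil.
apply: eq_integrable (L1D (if_ i) ih) => // x _.
by rewrite /= big_cons.
Qed.

Lemma RintegralT_sum I (s : seq I) (f : I -> T -> R) :
  (forall i, mu.-integrable setT (EFin \o f i)) ->
  \int[mu]_x (\sum_(i <- s) f i x) = \sum_(i <- s) \int[mu]_x f i x.
Proof.
move=> if_; elim: s => [|i s ih].
  rewrite big_nil /Rintegral.
  by under eq_integral do rewrite big_nil; rewrite integral0.
rewrite big_cons -ih.
under eq_Rintegral do rewrite big_cons.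
by rewrite RintegralD//; exact: L1_sum.
Qed.

Lemma Rintegral_dominated_cvg (f_ : nat -> T -> R) f g :
  (forall n, measurable_fun setT (f_ n)) ->
  (forall x, f_ ^~ x @ \oo --> f x) ->
  mu.-integrable setT (EFin \o g) -> (forall n x, `|f_ n x| <= g x) ->
  mu.-integrable setT (EFin \o f) /\
  \int[mu]_x f_ n x @[n --> \oo] --> \int[mu]_x f x.
Proof.
move=> mf_ f_f ig fg.
have mf : measurable_fun setT f.
  by apply: (measurable_fun_cvg mf_) => x _; exact: f_f.
have [] := @dominated_convergence _ T R mu setT measurableT
  (fun n => EFin \o f_ n) (EFin \o f) (EFin \o g).
- by move=> n; exact/measurable_EFinP.
- exact/measurable_EFinP.
- by apply: aeW => x _; apply/cvg_EFin; [exact: nearW|exact: f_f].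
- exact: ig.
- by apply: aeW => x n _; rewrite lee_fin.
move=> if_ _ cvf; split => //.
by apply: fine_cvg; rewrite fineK//; exact: integrable_fin_num if_.
Qed.

Lemma Rintegral_eq0_lim (f_ : nat -> T -> R) f g :
  (forall n, measurable_fun setT (f_ n)) ->
  (forall x, f_ ^~ x @ \oo --> f x) ->
  mu.-integrable setT (EFin \o g) -> (forall n x, `|f_ n x| <= g x) ->
  (forall n, \int[mu]_x f_ n x = 0) -> \int[mu]_x f x = 0.
Proof.
move=> mf_ f_f ig fg f0.
have [_] := Rintegral_dominated_cvg mf_ f_f ig fg.
under eq_fun do rewrite f0.
move=> /(cvg_lim (@Rhausdorff R)) <-.
by apply: cvg_lim; [exact: Rhausdorff|exact: cvg_cst].
Qed.

End RealIntegral.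

(** * Elementary approximations: exponential quotients, the sine series, polynomial iterates for the
    sign *)

Section RealLemmas.
Context (R : realType).
Implicit Types x y : R.

Lemma expR_norm_le x : expR `|x| <= expR x + expR (- x).
Proof.
have [x0|x0] := leP 0 x.
  by rewrite ger0_norm// lerDl expR_ge0.
by rewrite ltr0_norm// lerDr expR_ge0.
Qed.

Lemma norm_le_expR x : `|x| <= expR x + expR (- x).
Proof.
apply: le_trans (expR_norm_le x); apply: le_trans (expR_ge1Dx _).
by rewrite lerDr.
Qed.

Lemma expR_sub1_le x : expR x - 1 <= x * expR x.
Proof.
have := expR_ge1Dx (- x); rewrite -(ler_pM2r (expR_gt0 x)) -expRD addNr expR0.
by rewrite mulrDl mul1r mulNr; lra.
Qed.

Lemma expR_sub1_norm_le x : `|expR x - 1| <= `|x| * expR `|x|.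
Proof.
have e2 := expR_ge1Dx x.
have [x0|x0] := leP 0 x.
  by rewrite (ger0_norm x0) ger0_norm; [exact: expR_sub1_le|lra].
have e8 : expR x < 1 by rewrite expR_lt1.
rewrite (ler0_norm (ltW x0)) ler0_norm; last by lra.
apply: (@le_trans _ _ (- x)); first by lra.
rewrite ler_peMr ?oppr_ge0 ?(ltW x0)//.
by rewrite -expR0 ler_expR oppr_ge0 ltW.
Qed.

(** Squeezed between [x] and [x * expR (x / n.+1%:R)]. All differentiation in the exponent below
    goes through this quotient. *)
Lemma cvg_expR_sub1 x :
  (n.+1%:R * (expR (x / n.+1%:R) - 1) : R) @[n --> \oo] --> x.
Proof.
have c0 : (x / n.+1%:R : R) @[n --> \oo] --> (0 : R).
  rewrite -(mulr0 x); apply: cvgM; first exact: cvg_cst.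
  exact: cvg_harmonic.
apply: (@squeeze_cvgr _ _ _ _ (cst x) (fun n => x * expR (x / n.+1%:R))).
- apply: nearW => n; have n0 : (0 : R) < n.+1%:R by [].
  have e1 := expR_ge1Dx (x / n.+1%:R); have e2 := expR_sub1_le (x / n.+1%:R).
  apply/andP; split.
    by rewrite /= -ler_pdivrMl// [X in X <= _]mulrC lerBrDl.
  by rewrite -ler_pdivlMl// mulrA [_^-1 * x]mulrC.
- exact: cvg_cst.
- suff: (x * expR (x / n.+1%:R)) @[n --> \oo] --> x * expR 0 by rewrite expR0 mulr1.
  apply: cvgM; first exact: cvg_cst.
  have h := @continuous_expR R 0;
  exact: (@cvg_comp _ _ _ (fun n => x / n.+1%:R) (@expR R) _ _ _ c0 h).
Qed.

(** The domination that allows the sine series to be integrated term by term: in absolute value its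
    terms are bounded by those of the exponential series at [|x|]. *)
Lemma norm_series_sin_coeff_le x n : `|series (sin_coeff x) n| <= expR `|x|.
Proof.
apply: (@le_trans _ _ (series (exp_coeff `|x|) n)).
  rewrite /series/=; apply: le_trans (ler_norm_sum _ _ _) _.
  apply: ler_sum => i _; rewrite /sin_coeff /exp_coeff/= !normrM normrX.
  rewrite normfV (ger0_norm (ler0n _ _)) normrX normrN1 expr1n mulr1.
  rewrite normr_nat ler_pM2r ?invr_gt0 ?ltr0n ?fact_gt0//.
  by rewrite ler_piMl ?exprn_ge0//; case: odd.
rewrite /expR; apply: nondecreasing_cvgn_le; last exact: is_cvg_series_exp_coeff.
move=> m p mp; rewrite /series/= (@big_cat_nat _ _ _ m 0%N p)//= lerDl sumr_ge0// => i _.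
by rewrite /exp_coeff/= divr_ge0 ?exprn_ge0.
Qed.

(** The Newton-Schulz iteration for the sign: an odd polynomial with fixed points -1, 0, 1, of slope
    3/2 at 0 and slope 0 at -1 and 1. Being polynomial, its iterates stay inside any algebra of
    functions, such as the multipliers below. *)
Definition smoothstep x : R := (3 * x - x ^+ 3) / 2.

Lemma smoothstep_norm_le1 x : `|x| <= 1 -> `|smoothstep x| <= 1.
Proof.
rewrite !ler_norml /smoothstep => /andP[x1 x2]; apply/andP; split; rewrite -subr_ge0.
  have -> : (3 * x - x ^+ 3) / 2 - -1 = (1 + x) ^+ 2 * ((2 - x) / 2) by field.
  by rewrite mulr_ge0 ?sqr_ge0//; lra.
have -> : 1 - (3 * x - x ^+ 3) / 2 = (1 - x) ^+ 2 * ((2 + x) / 2) by field.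
by rewrite mulr_ge0 ?sqr_ge0//; lra.
Qed.

Lemma iter_smoothstep_norm_le1 n x : `|x| <= 1 -> `|iter n smoothstep x| <= 1.
Proof. by move=> x1; elim: n => //= n; exact: smoothstep_norm_le1. Qed.

Lemma iter_smoothstepN n x : iter n smoothstep (- x) = - iter n smoothstep x.
Proof. by elim: n => //= n ->; rewrite /smoothstep; field. Qed.

Lemma cvg_iter_smoothstep x : `|x| <= 1 ->
  iter n smoothstep x @[n --> \oo] --> Num.sg x.
Proof.
have main y : 0 < y -> y <= 1 -> iter n smoothstep y @[n --> \oo] --> (1 : R).
  move=> y0 y1.
  (* For the current iterate v, 1 - smoothstep v = (1 - v)^2 (1 + v/2), and (1 - v)(1 + v/2) <= 1 -
     v/2 <= 1 - y/2 because the iterates never drop below y. The gap to 1 thus shrinks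
     geometrically. *)
  have b n : y <= iter n smoothstep y <= 1 /\
      1 - iter n smoothstep y <= (1 - y / 2) ^+ n.
    elim: n => [|n [/andP[h1 h2] h3]]; first by rewrite /= lexx y1 expr0; split => //; lra.
    rewrite iterS exprS; move: (iter n smoothstep y) h1 h2 h3 => v h1 h2 h3.
    have v3 : 0 <= v * (1 - v ^+ 2).
      by rewrite mulr_ge0 ?subr_ge0 ?expr_le1//; lra.
    have v4 : 0 <= (1 - v) ^+ 2 * (2 + v) by rewrite mulr_ge0 ?sqr_ge0//; lra.
    rewrite /smoothstep; split; first by apply/andP; split; nra.
    apply: (@le_trans _ _ ((1 - y / 2) * (1 - v))); last first.
      by rewrite ler_wpM2l//; lra.
    have -> : 1 - (3 * v - v ^+ 3) / 2 = ((1 - v) * (1 + v / 2)) * (1 - v) by field.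
    by rewrite ler_wpM2r; nra.
  apply: (@squeeze_cvgr _ _ _ _ (fun n => 1 - (1 - y / 2) ^+ n) (cst 1)).
  - by apply: nearW => n; have [/andP[_ ->]] := b n; rewrite andbT; lra.
  - rewrite -[X in _ --> X]subr0; apply: cvgB; first exact: cvg_cst.
    by apply: cvg_expr; rewrite ger0_norm; lra.
  - exact: cvg_cst.
rewrite ler_norml => /andP[x1 x2]; case: (ltrgt0P x) => x0.
- by rewrite gtr0_sg//; exact: main.
- rewrite ltr0_sg// -[x]opprK.
  under eq_fun do rewrite iter_smoothstepN.
  by apply: cvgN; apply: main; lra.
- rewrite x0 sgr0; under eq_fun => n.
    have -> : iter n smoothstep 0 = 0.
      by elim: n => //= n ->; rewrite /smoothstep expr0n/= mulr0 subr0 mul0r.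
    over.
  exact: cvg_cst.
Qed.

Lemma cvg_sg_sin x : Num.sg (sin (x / n.+1%:R)) @[n --> \oo] --> Num.sg x.
Proof.
have main y : 0 < y -> \forall n \near \oo, 0 < sin (y / n.+1%:R).
  move=> y0.
  have : (y / n.+1%:R : R) @[n --> \oo] --> (0 : R).
    rewrite -(mulr0 y); apply: cvgM; first exact: cvg_cst.
    exact: cvg_harmonic.
  move=> /cvgrPdist_lt /(_ _ (pi_gt0 R)); apply: filterS => n.
  rewrite sub0r normrN => h; apply: sin_gt0_pi.
  by rewrite divr_gt0//= (le_lt_trans (ler_norm _) h).
case: (ltrgt0P x) => x0.
- apply: cvg_near_cst; have := main _ x0; apply: filterS => n h.
  by rewrite !gtr0_sg.
- apply: cvg_near_cst; have := main (- x); rewrite oppr_gt0 => /(_ x0).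
  by apply: filterS => n; rewrite mulNr sinN oppr_gt0 => h; rewrite !ltr0_sg.
- by rewrite x0; under eq_fun do rewrite mul0r sin0; exact: cvg_cst.
Qed.

End RealLemmas.

(* A signed weight all of whose exponential integrals against [zeta] vanish. *)
Section LaplaceNull.
Context d (T : measurableType d) (R : realType) (mu : {measure set T -> \bar R}).
Variable zeta : T -> R.
Hypothesis mzeta : measurable_fun setT zeta.
Implicit Types V u : T -> R.

Definition laplace_null V := forall a : R,
  mu.-integrable setT (EFin \o (fun x => V x * expR (a * zeta x))) /\
  \int[mu]_x (V x * expR (a * zeta x)) = 0.

Lemma laplace_null_measurable V : laplace_null V -> measurable_fun setT V.
Proof.
move=> /(_ 0)[/L1_measurable + _].
by under eq_fun do rewrite mul0r expR0 mulr1.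
Qed.

Lemma measurable_expRZ a : measurable_fun setT (fun x => expR (a * zeta x)).
Proof. by apply: measurableT_comp => //; exact: measurable_funM. Qed.

Lemma laplace_null_expR V b : laplace_null V ->
  laplace_null (fun x => V x * expR (b * zeta x)).
Proof.
move=> V0 a; have [] := V0 (b + a).
have -> // : (fun x => V x * expR ((b + a) * zeta x)) =
  (fun x => V x * expR (b * zeta x) * expR (a * zeta x)).
by apply/funext => x; rewrite mulrDl expRD mulrA.
Qed.

Lemma L1_laplace_dominated V (M : T -> R) : laplace_null V -> measurable_fun setT M ->
  (forall x, `|M x| <= expR (zeta x) + expR (- zeta x)) ->
  mu.-integrable setT (EFin \o (fun x => V x * M x)).
Proof.
move=> V0 mM hM.
apply: (@L1_le _ _ _ _ _ (fun x => `|V x * expR (1 * zeta x)| +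
                           `|V x * expR (- 1 * zeta x)|)).
- apply: measurable_funM => //; exact: laplace_null_measurable.
- move=> x; rewrite !normrM -mulrDr ler_wpM2l//.
  by rewrite !(ger0_norm (expR_ge0 _)) mul1r mulN1r.
- by apply: L1D; apply: L1_norm; exact: (V0 _).1.
Qed.

(** Differentiation in [a]: the difference quotients of step 1/(n+1) have integral 0 by hypothesis
    and converge to [zeta] times the integrand, dominated by |zeta| (exp zeta + exp(-zeta)) times
    it. *)
Lemma laplace_null_mul V : laplace_null V ->
  laplace_null (fun x => V x * zeta x).
Proof.
move=> V0 a; have Va := laplace_null_expR a V0.
have E x : V x * zeta x * expR (a * zeta x) = V x * expR (a * zeta x) * zeta x.
  by rewrite mulrAC.
split.
  apply: eq_integrable (L1_laplace_dominated Va mzeta (fun x => norm_le_expR _)) => //.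
  by move=> x _; rewrite /= E.
under eq_Rintegral do rewrite E.
pose g x := `|V x * expR (a * zeta x) * expR (1 * zeta x) * zeta x| +
  `|V x * expR (a * zeta x) * expR (- 1 * zeta x) * zeta x|.
apply: (@Rintegral_eq0_lim _ _ _ _ (fun n x => V x * expR (a * zeta x) *
   (n.+1%:R * (expR (zeta x / n.+1%:R) - 1))) _ g).
- move=> n; apply: measurable_funM; first exact: laplace_null_measurable.
  apply: measurable_funM => //; apply: measurable_funB => //.
  under eq_fun do rewrite mulrC; exact: measurable_expRZ.
- move=> x; apply: cvgM; first exact: cvg_cst.
  exact: cvg_expR_sub1.
- apply: L1D; apply: L1_norm => //.
    by apply: L1_laplace_dominated => //; [exact: laplace_null_expR|
      move=> x; exact: norm_le_expR].
  by apply: L1_laplace_dominated => //; [exact: laplace_null_expR|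
    move=> x; exact: norm_le_expR].
- move=> n x; rewrite /g !(normrM, mul1r, mulN1r) -!mulrA -!mulrDr.
  rewrite !ler_wpM2l//.
  rewrite -mulrDl [leRHS]mulrC (ger0_norm (expR_ge0 _)) (ger0_norm (expR_ge0 _)).
  have n0 : (0 : R) < n.+1%:R by [].
  rewrite gtr0_norm// -ler_pdivlMl//.
  apply: (le_trans (expR_sub1_norm_le _)).
  rewrite normrM normfV (gtr0_norm n0) [leRHS]mulrA [_^-1 * _]mulrC.
  rewrite ler_wpM2l ?divr_ge0// -[X in expR X + _]opprK addrC.
  rewrite ?opprK addrC; apply: le_trans (expR_norm_le _).
  by rewrite ler_expR ler_pdivrMr// ler_peMr// ler1n.
- move=> n.
  have E2 x : V x * expR (a * zeta x) * (n.+1%:R * (expR (zeta x / n.+1%:R) - 1)) =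
    n.+1%:R * (V x * expR ((a + n.+1%:R^-1) * zeta x) - V x * expR (a * zeta x)).
    by rewrite mulrDl expRD [_^-1 * _]mulrC; ring.
  under eq_Rintegral do rewrite E2.
  have [i1 e1] := V0 (a + n.+1%:R^-1); have [i2 e2] := V0 a.
  rewrite RintegralZl//; last exact: integrableB i1 i2.
  by rewrite RintegralB// e1 e2 subrr mulr0.
Qed.

Lemma laplace_null_exp V n : laplace_null V ->
  laplace_null (fun x => V x * zeta x ^+ n).
Proof.
move=> V0; elim: n => [|n ih].
  by under eq_fun do rewrite expr0 mulr1.
under eq_fun do rewrite exprSr mulrA.
exact: laplace_null_mul.
Qed.

Lemma laplace_null_L1 V : laplace_null V ->
  mu.-integrable setT (EFin \o V) /\ \int[mu]_x V x = 0.
Proof.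
move=> /(_ 0); have -> // : (fun x => V x * expR (0 * zeta x)) = V.
by apply/funext => x; rewrite mul0r expR0 mulr1.
Qed.

Lemma laplace_nullZ V c : laplace_null V -> laplace_null (fun x => c * V x).
Proof.
move=> V0 a; have [iV eV] := V0 a; split.
  by apply: eq_integrable (L1Z c iV) => // x _; rewrite /= mulrA.
under eq_Rintegral do rewrite -mulrA.
by rewrite RintegralZl// eV mulr0.
Qed.

Lemma laplace_nullD V W : laplace_null V -> laplace_null W ->
  laplace_null (fun x => V x + W x).
Proof.
move=> V0 W0 a; have [iV eV] := V0 a; have [iW eW] := W0 a; split.
  by apply: eq_integrable (L1D iV iW) => // x _; rewrite /= mulrDl.
under eq_Rintegral do rewrite mulrDl.
by rewrite RintegralD// eV eW addr0.
Qed.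

Lemma laplace_null_bounded_cvg V (u_ : nat -> T -> R) u :
  laplace_null V -> (forall n, measurable_fun setT (u_ n)) ->
  (forall n x, `|u_ n x| <= 1) -> (forall x, u_ ^~ x @ \oo --> u x) ->
  (forall n, laplace_null (fun x => V x * u_ n x)) ->
  laplace_null (fun x => V x * u x).
Proof.
move=> V0 mu_ u1 uu Vu a; have [iV _] := V0 a.
have h : forall x, (fun n => V x * u_ n x * expR (a * zeta x)) @ \oo -->
    V x * u x * expR (a * zeta x).
  by move=> x; apply: cvgM; [apply: cvgM; [exact: cvg_cst|exact: uu]|exact: cvg_cst].
have m n : measurable_fun setT (fun x => V x * u_ n x * expR (a * zeta x)).
  by have [/L1_measurable] := Vu n a.
have dom n x : `|V x * u_ n x * expR (a * zeta x)| <= `|V x * expR (a * zeta x)|.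
  by rewrite mulrAC normrM ler_piMr.
have iV' := L1_norm iV.
split; first by have [] := Rintegral_dominated_cvg m h iV' dom.
by apply: (Rintegral_eq0_lim m h iV' dom) => n; have [] := Vu n a.
Qed.

(** Quantifying over all null weights makes the class closed under products: the first factor
    produces a null weight to which the second applies. With sums and bounded pointwise limits this
    leads from the sine to the sign. *)
Definition multiplier u := measurable_fun setT u /\
  forall V, laplace_null V -> laplace_null (fun x => V x * u x).

Lemma multiplier_cst c : multiplier (fun=> c).
Proof.
split=> // V /(laplace_nullZ c).
by under eq_fun do rewrite mulrC.
Qed.

Lemma multiplierD u v : multiplier u -> multiplier v ->
  multiplier (fun x => u x + v x).
Proof.
move=> [mu_ u0] [mv v0]; split; first exact: measurable_funD.
move=> V V0; under eq_fun do rewrite mulrDr.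
by apply: laplace_nullD; [exact: u0|exact: v0].
Qed.

Lemma multiplierM u v : multiplier u -> multiplier v ->
  multiplier (fun x => u x * v x).
Proof.
move=> [mu_ u0] [mv v0]; split; first exact: measurable_funM.
move=> V V0; under eq_fun do rewrite mulrA.
by apply: v0; exact: u0.
Qed.

Lemma multiplierZ c u : multiplier u -> multiplier (fun x => c * u x).
Proof. by move=> u0; apply: multiplierM => //; exact: multiplier_cst. Qed.

Lemma multiplier_cvg (u_ : nat -> T -> R) u :
  (forall n, multiplier (u_ n)) -> (forall n x, `|u_ n x| <= 1) ->
  (forall x, u_ ^~ x @ \oo --> u x) -> multiplier u.
Proof.
move=> um u1 uu; split.
  by apply: (measurable_fun_cvg (fun n => (um n).1)) => x _; exact: uu.
move=> V V0; apply: laplace_null_bounded_cvg uu _ => //.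
  by move=> n; exact: (um n).1.
by move=> n; exact: (um n).2.
Qed.

(** The sine series is integrated term by term: each power of [zeta] keeps the weight null, and the
    partial sums are at most exp |t zeta|, which the exponents [t] and [- t] control. *)
Lemma multiplier_sin t : multiplier (fun x => sin (t * zeta x)).
Proof.
have ms : measurable_fun setT (fun x => sin (t * zeta x)).
  apply: (@measurableT_comp _ _ _ _ _ _ (@sin R)); last exact: measurable_funM.
  by apply: continuous_measurable_fun; exact: continuous_sin.
split=> // V V0 a; have Va := laplace_null_expR a V0.
have [iVa _] := laplace_null_L1 Va.
have E x : V x * sin (t * zeta x) * expR (a * zeta x) =
    V x * expR (a * zeta x) * sin (t * zeta x) by rewrite mulrAC.
split.
  apply: (@L1_le _ _ _ _ _ (fun x => `|V x * expR (a * zeta x)|)).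
  - apply: measurable_funM; last exact: measurable_expRZ.
    by apply: measurable_funM => //; exact: laplace_null_measurable V0.
  - by move=> x; rewrite E normrM ler_piMr// ler_norml sin_geN1 sin_le1.
  - exact: L1_norm.
under eq_Rintegral do rewrite E.
pose f n x := V x * expR (a * zeta x) * series (sin_coeff (t * zeta x)) n.
have fE n x : f n x = \sum_(i <- index_iota 0 n)
   ((odd i)%:R * (-1) ^+ i.-1./2 * t ^+ i / i`!%:R) *
   (V x * expR (a * zeta x) * zeta x ^+ i).
  rewrite /f /series/= mulr_sumr; apply: eq_bigr => i _.
  by rewrite /sin_coeff/= exprMn; ring.
have Vi i : mu.-integrable setT (EFin \o (fun x =>
     ((odd i)%:R * (-1) ^+ i.-1./2 * t ^+ i / i`!%:R) *
   (V x * expR (a * zeta x) * zeta x ^+ i))).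
  by apply: L1Z; have [] := laplace_null_L1 (laplace_null_exp i Va).
apply: (@Rintegral_eq0_lim _ _ _ _ f _ (fun x =>
   `|V x * expR (a * zeta x) * expR (t * zeta x)| +
   `|V x * expR (a * zeta x) * expR (- t * zeta x)|)).
- move=> n; rewrite (_ : f n = (fun x => \sum_(i <- index_iota 0 n)
   ((odd i)%:R * (-1) ^+ i.-1./2 * t ^+ i / i`!%:R) *
   (V x * expR (a * zeta x) * zeta x ^+ i))); last by apply/funext => x; rewrite fE.
  exact: L1_measurable (L1_sum _ Vi).
- move=> x; apply: cvgM; first exact: cvg_cst.
  by rewrite unlock; exact: is_cvg_series_sin_coeff.
- by apply: L1D; apply: L1_norm; exact: (Va _).1.
- move=> n x; rewrite /f !normrM -!mulrA -!mulrDr !ler_wpM2l//.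
  rewrite !(ger0_norm (expR_ge0 _)) mulNr.
  exact: le_trans (norm_series_sin_coeff_le _ _) (expR_norm_le _).
- move=> n; under eq_Rintegral do rewrite fE.
  rewrite RintegralT_sum// big1// => i _.
  rewrite RintegralZl//; have [iVi eVi] := laplace_null_L1 (laplace_null_exp i Va) => //.
  by rewrite eVi mulr0.
Qed.

(** The smoothstep iterates of sin(t zeta) converge to its sign. At each point, t = 1/(n+1)
    eventually brings t zeta into the range where the sine has the sign of its argument. *)
Lemma multiplier_sg : multiplier (fun x => Num.sg (zeta x)).
Proof.
have sg1 (y : R) : `|Num.sg y| <= 1 by rewrite normr_sg; case: eqP.
have step t : multiplier (fun x => Num.sg (sin (t * zeta x))).
  have s1 x : `|sin (t * zeta x)| <= 1 by rewrite ler_norml sin_geN1 sin_le1.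
  apply: (@multiplier_cvg (fun n x => iter n (@smoothstep R) (sin (t * zeta x)))).
  - elim=> [|n ih] /=; first exact: multiplier_sin.
    rewrite (_ : (fun x => _) = (fun x => 2^-1 *
      (3 * iter n (@smoothstep R) (sin (t * zeta x)) +
       (-1) * (iter n (@smoothstep R) (sin (t * zeta x)) *
         (iter n (@smoothstep R) (sin (t * zeta x)) *
          iter n (@smoothstep R) (sin (t * zeta x))))))).
      by apply: multiplierZ; apply: multiplierD; apply: multiplierZ => //;
         do 2 (apply: multiplierM => //).
    by apply/funext => x; rewrite /smoothstep; field.
  - by move=> n x; exact: iter_smoothstep_norm_le1.
  - by move=> x; exact: cvg_iter_smoothstep.
apply: (@multiplier_cvg (fun n x => Num.sg (sin (n.+1%:R^-1 * zeta x)))) => //.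
move=> x; under eq_fun do rewrite mulrC.
exact: cvg_sg_sin.
Qed.

Lemma multiplier_gt0 : multiplier (fun x => (0 < zeta x)%R%:R).
Proof.
rewrite (_ : (fun x => _) = (fun x => 2^-1 *
  (Num.sg (zeta x) * Num.sg (zeta x) + Num.sg (zeta x)))).
  apply: multiplierZ; apply: multiplierD; last exact: multiplier_sg.
  by apply: multiplierM; exact: multiplier_sg.
apply/funext => x; case: ltrgt0P => z0.
- by rewrite gtr0_sg//=; field.
- by rewrite ltr0_sg//=; ring.
- by rewrite z0 sgr0/=; ring.
Qed.

Lemma multiplier_ge0 : multiplier (fun x => (0 <= zeta x)%R%:R).
Proof.
rewrite (_ : (fun x => _) = (fun x => 1 + 2^-1 *
  (Num.sg (zeta x) + (- 1) * (Num.sg (zeta x) * Num.sg (zeta x))))).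
  apply: multiplierD; first exact: multiplier_cst.
  apply: multiplierZ; apply: multiplierD; first exact: multiplier_sg.
  by apply: multiplierZ; apply: multiplierM; exact: multiplier_sg.
apply/funext => x; case: ltrgt0P => z0.
- by rewrite gtr0_sg//=; ring.
- by rewrite ltr0_sg//=; field.
- by rewrite z0 sgr0/=; ring.
Qed.

End LaplaceNull.

(* The induction peels off one coordinate at a time: for frozen exponents on the
   remaining coordinates, [V] times their exponential is again null. *)
Lemma laplace_null_orthant d (T : measurableType d) (R : realType)
    (mu : {measure set T -> \bar R}) (I : eqType) (s : seq I)
    (strict : I -> bool) (z : I -> T -> R) (V : T -> R) :
  uniq s -> (forall i, measurable_fun setT (z i)) ->
  (forall c : I -> R,
    mu.-integrable setT
      (EFin \o (fun x => V x * expR (\sum_(i <- s) c i * z i x))) /\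
    \int[mu]_x (V x * expR (\sum_(i <- s) c i * z i x)) = 0) ->
  \int[mu]_x (V x * \prod_(i <- s)
    (if strict i then (0 < z i x)%R%:R else (0 <= z i x)%R%:R)) = 0.
Proof.
move=> + mz; elim: s V => [|j s ih] V us hV.
  have [_ ] := hV (fun=> 0).
  under eq_Rintegral do rewrite big_nil expR0 mulr1.
  by under [X in _ -> X = _]eq_Rintegral do rewrite big_nil mulr1.
move: us => /= /andP[js us].
under eq_Rintegral do rewrite big_cons/= mulrA.
apply: ih => // c.
pose W x := V x * expR (\sum_(i <- s) c i * z i x).
have W0 : laplace_null mu (z j) W.
  move=> a; have := hV (fun i => if i == j then a else c i).
  have E x : V x * expR (\sum_(i <- j :: s) (if i == j then a else c i) * z i x) =
      W x * expR (a * z j x).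
    rewrite big_cons eqxx addrC expRD mulrA; congr (_ * expR _ * _).
    apply: eq_big_seq => i si; case: eqP => // ij.
    by rewrite ij (negbTE js) in si.
  by rewrite (funext E).
have [_ h1] := multiplier_gt0 mu (mz j).
have [_ h2] := multiplier_ge0 mu (mz j).
have : laplace_null mu (z j) (fun x => W x *
    (if strict j then (0 < z j x)%R%:R else (0 <= z j x)%R%:R)).
  by case: (strict j); [exact: h1|exact: h2].
move=> /laplace_null_L1.
by under [in X in X -> _]eq_fun do rewrite /W mulrAC.
Qed.

(** * Gaussian variables *)

Section Density.
Local Open Scope ereal_scope.
Import HBNNSimple.

(** Indicators, then simple functions, then monotone limits. It converts integrals under
    [normal_prob] into Lebesgue integrals against the Gaussian density. *)
Lemma ge0_integral_density d (T : measurableType d) (R : realType)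
    (mu nu : {measure set T -> \bar R}) (p : T -> R) (f : T -> \bar R) :
  measurable_fun setT p -> (forall x, 0 <= p x)%R ->
  (forall A, measurable A -> nu A = \int[mu]_(x in A) (p x)%:E) ->
  measurable_fun setT f -> (forall x, 0 <= f x) ->
  \int[nu]_x f x = \int[mu]_x (f x * (p x)%:E).
Proof.
move=> mp p0 nuE mf f0.
have mEp : measurable_fun setT (EFin \o p) by exact/measurable_EFinP.
have indicE' E : measurable E ->
    \int[nu]_x (\1_E x)%:E = \int[mu]_x ((\1_E x)%:E * (p x)%:E).
  move=> mE; rewrite integral_indic// setIT nuE// integral_mkcond.
  apply: eq_integral => x _; rewrite patchE indicE.
  by case: (x \in E); rewrite ?mul1e ?mul0e.
have nnsfunE (g : {nnsfun T >-> R}) :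
    \int[nu]_x (g x)%:E = \int[mu]_x ((g x)%:E * (p x)%:E).
  under [LHS]eq_integral do rewrite fimfunE -fsumEFin//.
  rewrite [LHS]ge0_integral_fsum//; last 2 first.
    - by move=> r; exact/measurable_EFinP/measurableT_comp.
    - by move=> n x _; rewrite EFinM nnfun_muleindic_ge0.
  under [RHS]eq_integral.
    move=> x xD; rewrite fimfunE -fsumEFin// ge0_mule_fsuml; last first.
      by move=> r; rewrite EFinM nnfun_muleindic_ge0.
    over.
  rewrite [RHS]ge0_integral_fsum//; last 2 first.
    - move=> r; apply: emeasurable_funM => //.
      by apply/measurable_EFinP; do 2 apply/measurableT_comp => //.
    - move=> n x _; rewrite EFinM mule_ge0//; first by rewrite nnfun_muleindic_ge0.
      by rewrite lee_fin.
  apply: eq_fsbigr => r rg.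
  have r0 : (0 <= r)%R by move: rg; rewrite inE/= => -[x _ <-].
  under eq_integral do rewrite EFinM.
  under [RHS]eq_integral do rewrite EFinM -muleA.
  have mI : measurable_fun setT (fun x : T => (\1_(g @^-1` [set r]) x : R)%:E).
    by apply/measurable_EFinP; apply: measurable_indic.
  have mI2 : measurable_fun setT
      (fun x : T => (\1_(g @^-1` [set r]) x : R)%:E * (p x)%:E).
    exact: (emeasurable_funM mI mEp).
  rewrite (ge0_integralZl _ measurableT mI)//.
  rewrite (ge0_integralZl _ measurableT mI2)//; last first.
    by move=> x _; rewrite mule_ge0// lee_fin.
  by rewrite indicE'.
pose f_ := nnsfun_approx measurableT mf.
have cvf x : (EFin \o f_^~ x) @ \oo --> f x by exact: cvg_nnsfun_approx.
have L1 : \int[nu]_x (f_ n x)%:E @[n --> \oo] --> \int[nu]_x f x.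
  rewrite [X in _ --> X](_ : _ = \int[nu]_x (limn (EFin \o f_^~ x))); last first.
    by apply: eq_integral => x _; apply/esym/cvg_lim.
  apply: cvg_monotone_convergence => //.
  - by move=> n; exact/measurable_EFinP/measurable_funTS.
  - by move=> n x _; rewrite lee_fin.
  - by move=> x _ m n mn; rewrite lee_fin; exact/lefP/nd_nnsfun_approx.
have L2 : \int[mu]_x ((f_ n x)%:E * (p x)%:E) @[n --> \oo] -->
    \int[mu]_x (f x * (p x)%:E).
  have cvp x : ((f_ n x)%:E * (p x)%:E) @[n --> \oo] --> f x * (p x)%:E.
    by apply: cvgeZr => //; exact: cvf.
  rewrite [X in _ --> X](_ : _ =
      \int[mu]_x (limn (fun n => (f_ n x)%:E * (p x)%:E))); last first.
    by apply: eq_integral => x _; apply/esym/cvg_lim.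
  apply: cvg_monotone_convergence => //.
  - move=> n; apply: emeasurable_funM => //.
    exact/measurable_EFinP/measurable_funTS.
  - by move=> n x _; rewrite mule_ge0// lee_fin.
  - move=> x _ m n mn; rewrite lee_wpmul2r ?lee_fin//.
    exact/lefP/nd_nnsfun_approx.
rewrite (_ : (fun n => \int[nu]_x (f_ n x)%:E) =
    (fun n => \int[mu]_x ((f_ n x)%:E * (p x)%:E))) in L1; last first.
  by apply/funext => n; rewrite nnsfunE.
exact: (cvg_unique _ L1 L2).
Qed.

End Density.

(** * Laplace transform and second moment of a centered Gaussian variable *)

Section GaussianMgf.
Context d (T : measurableType d) (R : realType) (P : probability T R).
Implicit Types Y : T -> R.

Lemma cg_measurable Y : centered_gaussian P Y -> measurable_fun setT Y.
Proof. by move=> [mY _] _ A mA; rewrite setTI; exact: mY. Qed.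

(** Completing the square: exponential tilting only moves the mean, and the factor left over is the
    moment generating function. *)
Lemma normal_pdf_tilt (s a x : R) : s != 0 ->
  expR (a * x) * normal_pdf 0 s x =
  expR (a ^+ 2 * s ^+ 2 / 2) * normal_pdf (a * s ^+ 2) s x.
Proof.
move=> s0; rewrite !normal_pdfE// mulrCA [RHS]mulrCA; congr (_ * _).
rewrite /normal_fun -!expRD; congr expR.
by rewrite subr0; field.
Qed.

Lemma ge0_integral_law Y (nu : {measure set (measurableTypeR R) -> \bar R})
    (g : measurableTypeR R -> \bar R) :
  measurable_fun setT Y -> (forall A, measurable A -> P (Y @^-1` A) = nu A) ->
  measurable_fun setT g -> (forall x, 0 <= g x)%E ->
  (\int[P]_w g (Y w) = \int[nu]_x g x)%E.
Proof.
move=> mY lawY mg g0.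
have mY' : measurable_fun setT (Y : T -> measurableTypeR R).
  by move=> _ A mA; exact: mY.
pose mYb := isMeasurableFun.Build _ _ _ _ _ mY'.
pose Y' : {mfun T >-> measurableTypeR R} := HB.pack (Y : T -> measurableTypeR R) mYb.
have := @ge0_integral_distribution _ _ T (measurableTypeR R) R P Y' g mg g0.
rewrite /comp/= => <-; apply: eq_measure_integral => A mA _.
exact: lawY.
Qed.

(** The degenerate law enters as [s = 0], so that one formula for the Laplace transform covers both
    cases. That [s ^+ 2] is the second moment is deduced afterwards from this formula. *)
Lemma cg_mgf Y : centered_gaussian P Y -> exists s : R,
  [/\ 0 <= s,
    0 < s -> forall A : set R, measurable A -> P (Y @^-1` A) = normal_prob 0 s A,
    s = 0 -> forall A : set R, measurable A -> P (Y @^-1` A) = \d_(0 : R) A &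
    forall a, P.-integrable setT (EFin \o (fun w => expR (a * Y w))) /\
      \int[P]_w expR (a * Y w) = expR (a ^+ 2 * s ^+ 2 / 2)].
Proof.
move=> gY; have mY := cg_measurable gY.
suff [s [s0 n1 n2 E]] : exists s : R, [/\ 0 <= s,
    0 < s -> forall A : set R, measurable A -> P (Y @^-1` A) = normal_prob 0 s A,
    s = 0 -> forall A : set R, measurable A -> P (Y @^-1` A) = \d_(0 : R) A &
    forall a : R,
    (\int[P]_w (expR (a * Y w))%:E = (expR (a ^+ 2 * s ^+ 2 / 2))%:E)%E].
  exists s; split => // a; split; last by rewrite /Rintegral E.
  apply/integrableP; split.
    by apply/measurable_EFinP/measurableT_comp => //; exact: measurable_funM.
  under eq_integral do rewrite /= ger0_norm ?expR_ge0//.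
  by rewrite E ltry.
have me (a : R) : measurable_fun setT (fun x : R => (expR (a * x))%:E).
  by apply/measurable_EFinP/measurableT_comp => //; exact: measurable_funM.
have e0 (a x : R) : (0 <= (expR (a * x))%:E)%E by rewrite lee_fin expR_ge0.
case: gY => mY' [[s [s0 lawY]]|lawY].
  exists s; split => [||s00|a] //; [exact: ltW|by rewrite s00 ltxx in s0|].
  rewrite (@ge0_integral_law Y (normal_prob 0 s : {measure set (measurableTypeR R) -> \bar R}) _ mY lawY (me a) (e0 a)).
  rewrite (@ge0_integral_density _ _ _ lebesgue_measure _ (normal_pdf 0 s))//.
  - under eq_integral do rewrite -EFinM normal_pdf_tilt ?gt_eqF// EFinM.
    rewrite ge0_integralZl//.
    + by rewrite integral_normal_pdf mule1.
    + by apply/measurable_EFinP; exact: measurable_normal_pdf.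
    + by move=> x _; rewrite lee_fin normal_pdf_ge0.
  - exact: measurable_normal_pdf.
  - by move=> x; exact: normal_pdf_ge0.
  - exact: me.
exists 0; split => // [|a]; first by rewrite ltxx.
rewrite (@ge0_integral_law Y (\d_(0 : measurableTypeR R)) _ mY lawY (me a) (e0 a)) integral_dirac//.
  by rewrite diracE in_setT mul1e mulr0 expr0n/= mulr0 mul0r.
exact: me.
Qed.

(** From exp(y/n) + exp(-y/n) - 2 = (exp(y/(2n)) - exp(-y/(2n)))^2: written as a square, the second
    difference needs only first-order quotients. *)
Lemma cvg_second_difference (y : R) :
  ((n.+1%:R * (expR (y / 2 / n.+1%:R) - 1) -
    n.+1%:R * (expR (- y / 2 / n.+1%:R) - 1)) ^+ 2 : R) @[n --> \oo] --> y ^+ 2.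
Proof.
have -> : y ^+ 2 = (y / 2 - (- y / 2)) ^+ 2 by field.
by under eq_fun do rewrite expr2; rewrite expr2; apply: cvgM; apply: cvgB;
  exact: cvg_expR_sub1.
Qed.


(* [n^2 (e^(Y/n) + e^(-Y/n) - 2)] tends to [Y^2], so the Laplace transform
   determines the second moment. *)
Lemma cg_second_moment Y (s : R) : measurable_fun setT Y ->
  (forall a, P.-integrable setT (EFin \o (fun w => expR (a * Y w))) /\
    \int[P]_w expR (a * Y w) = expR (a ^+ 2 * s ^+ 2 / 2)) ->
  P.-integrable setT (EFin \o (fun w => Y w ^+ 2)) /\
  \int[P]_w (Y w ^+ 2) = s ^+ 2.
Proof.
move=> mY hY.
pose f n w := (n.+1%:R * (expR (Y w / 2 / n.+1%:R) - 1) -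
    n.+1%:R * (expR (- Y w / 2 / n.+1%:R) - 1)) ^+ 2.
have fE n w : f n w = n.+1%:R ^+ 2 * (expR (n.+1%:R^-1 * Y w) +
    (expR (- n.+1%:R^-1 * Y w) + - 2)).
  have : n.+1%:R != 0 :> R by rewrite pnatr_eq0.
  rewrite /f; move: n.+1%:R => N N0.
  have -> : N^-1 * Y w = Y w / 2 / N + Y w / 2 / N by field.
  have -> : - N^-1 * Y w = - Y w / 2 / N + - Y w / 2 / N by field.
  have : expR (Y w / 2 / N) * expR (- Y w / 2 / N) = 1.
    by rewrite -expRD !mulNr subrr expR0.
  rewrite !expRD; set x := expR _; set y := expR _ => xy.
  by rewrite -[X in - X]mulr1 -xy; ring.
have if_ n : P.-integrable setT (EFin \o f n).
  rewrite (funext (fE n)); apply: L1Z; apply: L1D; first exact: (hY _).1.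
  by apply: L1D; [exact: (hY _).1|exact: finite_measure_integrable_cst].
have ef n : \int[P]_w f n w =
    2 * (n.+1%:R ^+ 2 * (expR (s ^+ 2 / 2 / n.+1%:R ^+ 2) - 1)).
  rewrite (funext (fE n)).
  have [i1 e1] := hY n.+1%:R^-1; have [i2 e2] := hY (- n.+1%:R^-1).
  have i3 : P.-integrable setT (EFin \o (fun=> - 2 : R)).
    exact: finite_measure_integrable_cst.
  rewrite RintegralZl//; last by apply: L1D => //; exact: L1D.
  rewrite RintegralD//; last exact: L1D.
  rewrite RintegralD// e1 e2 Rintegral_cst//.
  rewrite (_ : fine (P setT) = 1); last by rewrite probability_setT.
  rewrite sqrrN (_ : n.+1%:R^-1 ^+ 2 * s ^+ 2 / 2 = s ^+ 2 / 2 / n.+1%:R ^+ 2).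
    by ring.
  have : n.+1%:R != 0 :> R by rewrite pnatr_eq0.
  by move: n.+1%:R => N N0; field.
have fY w : f n w @[n --> \oo] --> Y w ^+ 2 by exact: cvg_second_difference.
(* Each of the two quotients is at most (|Y|/2) exp(|Y|/2), so the square is at most Y^2 exp |Y|,
   and Y^2 <= 2 exp |Y|. *)
have fdom n w : `|f n w| <= 2 * (expR (2 * Y w) + expR (- 2 * Y w)).
  have n0 : (0 : R) < n.+1%:R by [].
  have half (y : R) : `|n.+1%:R * (expR (y / n.+1%:R) - 1)| <= `|y| * expR `|y|.
    rewrite normrM (gtr0_norm n0) -ler_pdivlMl//.
    apply: (le_trans (expR_sub1_norm_le _)).
    rewrite normrM normfV (gtr0_norm n0) mulrA [_^-1 * _]mulrC.
    rewrite ler_wpM2l ?divr_ge0// ler_expR ler_pdivrMr// ler_peMr// ler1n.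
    by [].
  have e2 : `|Y w| ^+ 2 / 2 <= expR `|Y w|.
    by have := expR_ge1Dxn 1 (normr_ge0 (Y w)); rewrite (_ : 2`! = 2)%N//; lra.
  have e3 := expR_norm_le (2 * Y w); rewrite -mulNr in e3.
  apply: (@le_trans _ _ (2 * (expR `|Y w| * expR `|Y w|))); last first.
    rewrite ler_wpM2l// -expRD; apply: le_trans e3.
    by rewrite ler_expR normrM ger0_norm//; lra.
  rewrite /f normrX.
  have h1 := half (Y w / 2); have h2 := half (- Y w / 2).
  rewrite [in X in _ <= X]mulNr normrN in h2.
  have E : `|Y w / 2| = `|Y w| / 2 by rewrite normrM (@ger0_norm _ 2^-1).
  rewrite !E in h1 h2.
  apply: (@le_trans _ _ ((`|Y w| * expR (`|Y w| / 2)) ^+ 2)).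
    rewrite lerXn2r ?nnegrE ?mulr_ge0 ?expR_ge0//.
    by apply: (le_trans (ler_normB _ _)); lra.
  rewrite exprMn -expRM_natl (_ : 2%:R * (`|Y w| / 2) = `|Y w|); last by field.
  by rewrite mulrA ler_wpM2r ?expR_ge0//; lra.
have idom : P.-integrable setT
    (EFin \o (fun w => 2 * (expR (2 * Y w) + expR (- 2 * Y w)))).
  by apply: L1Z; apply: L1D; exact: (hY _).1.
have [iY2 cv] := Rintegral_dominated_cvg (fun n => L1_measurable (if_ n)) fY idom fdom.
split=> //.
suff cv2 : \int[P]_w f n w @[n --> \oo] --> s ^+ 2.
  by apply: (cvg_unique _ cv cv2); exact: Rhausdorff.
rewrite (funext ef).
rewrite [X in _ --> X](_ : _ = 2 * (s ^+ 2 / 2)); last by field.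
apply: cvgM; first exact: cvg_cst.
set x := s ^+ 2 / 2.
have := @cvg_expR_sub1 R x.
move=> /cvgrPdist_lt h; apply/cvgrPdist_lt => e e0.
have [N _ hN] := h _ e0; exists N => // n Nn.
(* The mean of the quotient at [n] is twice the sequence of [cvg_expR_sub1] read at index (n+1)^2 -
   1. *)
have [M EM] : exists M, M.+1 = (n.+1 ^ 2)%N.
  by exists (n.+1 ^ 2).-1; rewrite prednK ?expn_gt0.
have hle : (N <= M)%N.
  by rewrite -ltnS EM -mulnn; apply: leq_trans (leq_pmull _ _).
have /= := hN _ hle; rewrite EM natrX.
exact.
Qed.

End GaussianMgf.

(** * Real-valued probabilities, Gaussian tails from above and below *)

Section RealProbability.
Context d (T : measurableType d) (R : realType) (P : probability T R).
Implicit Types (A B : set T) (Y : T -> R).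

Definition pr A : R := fine (P A).

Lemma pr_ge0 A : 0 <= pr A.
Proof. by rewrite fine_ge0. Qed.

Lemma prE A : measurable A -> P A = (pr A)%:E.
Proof. by move=> mA; rewrite fineK// fin_num_measure. Qed.

Lemma pr_setT : pr setT = 1.
Proof. by rewrite /pr probability_setT. Qed.

Lemma pr_le A B : measurable A -> measurable B -> A `<=` B -> pr A <= pr B.
Proof. by move=> mA mB AB; rewrite -lee_fin -!prE// le_measure// inE. Qed.

Lemma pr_setU_le A B : measurable A -> measurable B ->
  pr (A `|` B) <= pr A + pr B.
Proof.
move=> mA mB; rewrite -lee_fin EFinD -!prE//; last exact: measurableU.
exact: measureU2.
Qed.

Lemma pr_bigcup_fin_le (I : Type) (s : seq I) (A : I -> set T) :
  (forall i, measurable (A i)) ->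
  pr (\big[setU/set0]_(i <- s) A i) <= \sum_(i <- s) pr (A i).
Proof.
move=> mA; elim: s => [|i s ih]; first by rewrite !big_nil /pr measure0.
rewrite !big_cons; apply: le_trans (pr_setU_le _ _) _ => //.
  exact: bigsetU_measurable.
by rewrite lerD2l.
Qed.

Lemma pr_RintegralE A : measurable A -> pr A = \int[P]_w \1_A w.
Proof. by move=> mA; rewrite /pr /Rintegral integral_indic// setIT. Qed.

Lemma integrable_bounded Y (M : R) : measurable_fun setT Y ->
  (forall w, `|Y w| <= M) -> P.-integrable setT (EFin \o Y).
Proof.
move=> mY YM; apply: (L1_le mY YM).
exact: finite_measure_integrable_cst.
Qed.

Lemma L1_indic A : measurable A -> P.-integrable setT (EFin \o (\1_A : T -> R)).
Proof.
move=> mA; apply: (@integrable_bounded _ 1); first exact: measurable_indic.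
by move=> w; rewrite indicE normr_nat; case: (w \in A).
Qed.

Lemma pr_markov A Y : measurable A -> P.-integrable setT (EFin \o Y) ->
  (forall w, 0 <= Y w) -> (forall w, A w -> 1 <= Y w) -> pr A <= \int[P]_w Y w.
Proof.
move=> mA iY Y0 Y1; rewrite pr_RintegralE//.
apply: le_Rintegral => //; first exact: L1_indic.
move=> w _; rewrite indicE; case: (boolP (w \in A)) => // /[!inE]; exact: Y1.
Qed.

Lemma measurable_ge Y (x : R) : measurable_fun setT Y ->
  measurable [set w | x <= Y w].
Proof.
move=> mY; rewrite (_ : [set w | _] = setT `&` Y @^-1` `[x, +oo[).
  exact: mY.
by rewrite setTI; apply/seteqP; split => w /=; rewrite in_itv/= andbT.
Qed.

Lemma measurable_gt Y (x : R) : measurable_fun setT Y ->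
  measurable [set w | x < Y w].
Proof.
move=> mY; rewrite (_ : [set w | _] = setT `&` Y @^-1` `]x, +oo[).
  exact: mY.
by rewrite setTI; apply/seteqP; split => w /=; rewrite in_itv/= andbT.
Qed.

Lemma measurable_le Y (x : R) : measurable_fun setT Y ->
  measurable [set w | Y w <= x].
Proof.
move=> mY; rewrite (_ : [set w | _] = ~` [set w | x < Y w]).
  by apply: measurableC; exact: measurable_gt.
by apply/seteqP; split => w /=; rewrite leNgt => /negP.
Qed.

Lemma subgaussian_tail Y (K x : R) : measurable_fun setT Y -> 0 < K -> 0 <= x ->
  (forall a, 0 <= a -> P.-integrable setT (EFin \o (fun w => expR (a * Y w))) /\
    \int[P]_w expR (a * Y w) <= expR (a ^+ 2 * K / 2)) ->
  pr [set w | x <= Y w] <= expR (- (x ^+ 2 / (2 * K))).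
Proof.
(* The Chernoff exponent: it minimises a^2 K / 2 - a x. *)
move=> mY K0 x0 hY; set a := x / K.
have a0 : 0 <= a by rewrite divr_ge0// ltW.
have [ia ea] := hY _ a0.
apply: (@le_trans _ _ (\int[P]_w (expR (- (a * x)) * expR (a * Y w)))).
  apply: pr_markov; first exact: measurable_ge.
  - exact: L1Z.
  - by move=> w; rewrite mulr_ge0 ?expR_ge0.
  - move=> w /= xY; rewrite -expRD -expR0 ler_expR addrC subr_ge0.
    by rewrite ler_wpM2l.
rewrite RintegralZl//; apply: (le_trans (ler_wpM2l (expR_ge0 _) ea)).
rewrite -expRD ler_expR le_eqVlt; apply/orP; left; apply/eqP.
by rewrite /a; field; rewrite gt_eqF.
Qed.

Definition var Y : R := \int[P]_w (Y w ^+ 2).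

Lemma var_ge0 Y : 0 <= var Y.
Proof. by apply: Rintegral_ge0 => w _; exact: sqr_ge0. Qed.

Lemma cg_L2 Y : centered_gaussian P Y ->
  P.-integrable setT (EFin \o (fun w => Y w ^+ 2)).
Proof.
move=> gY; have [s [_ _ _ h]] := cg_mgf gY.
by have [] := cg_second_moment (cg_measurable gY) h.
Qed.

Lemma cg_expR Y (a : R) : centered_gaussian P Y ->
  P.-integrable setT (EFin \o (fun w => expR (a * Y w))) /\
  \int[P]_w expR (a * Y w) = expR (a ^+ 2 * var Y / 2).
Proof.
move=> gY; have [s [_ _ _ h]] := cg_mgf gY.
by have [_ ] := cg_second_moment (cg_measurable gY) h; rewrite /var => ->.
Qed.

Lemma cg_law Y : centered_gaussian P Y ->
  (0 < var Y -> forall A : set R, measurable A ->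
     P (Y @^-1` A) = normal_prob 0 (Num.sqrt (var Y)) A).
Proof.
move=> gY; have [s [s0 n1 _ h]] := cg_mgf gY.
have [_ ] := cg_second_moment (cg_measurable gY) h; rewrite /var => ->.
rewrite sqrtr_sqr ger0_norm// exprn_even_gt0//= => s1.
by apply: n1; rewrite lt_def s1.
Qed.

Lemma cg_tail Y (x : R) (K : R) : centered_gaussian P Y -> 0 < K -> var Y <= K ->
  0 <= x -> pr [set w | x <= Y w] <= expR (- (x ^+ 2 / (2 * K))).
Proof.
move=> gY K0 YK x0; apply: (subgaussian_tail (cg_measurable gY)) => //.
move=> a a0; have [ia ->] := cg_expR a gY; split => //.
rewrite ler_expR; have a20 := sqr_ge0 a.
by have := ler_wpM2l a20 YK; lra.
Qed.

(** On []r, r + s]] the density is at least its value at [r + s], and the length [s] cancels the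
    factor 1/s of the peak. The shift by one standard deviation is of lower order for large
    levels. *)
Lemma cg_lower_tail Y (r : R) : centered_gaussian P Y -> 0 < var Y -> 0 <= r ->
  (Num.sqrt (2 * pi))^-1 * expR (- ((r / Num.sqrt (var Y) + 1) ^+ 2 / 2)) <=
  pr [set w | r < Y w].
Proof.
move=> gY v0 r0; set s := Num.sqrt (var Y).
have s0 : 0 < s by rewrite sqrtr_gt0.
rewrite -lee_fin -prE; last by apply: measurable_gt; exact: (cg_measurable gY).
rewrite (_ : [set w | r < Y w] = Y @^-1` `]r, +oo[); last first.
  by apply/seteqP; split => w /=; rewrite in_itv/= andbT.
rewrite (cg_law gY v0)//= -/s /normal_prob.
apply: (@le_trans _ _ (\int[lebesgue_measure]_(x in `]r, (r + s)%R])
   (normal_pdf 0 s (r + s))%:E)%E).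
  rewrite integral_cst//= lebesgue_measure_itv/= lte_fin ltrDl s0 -EFinD.
  rewrite -EFinM lee_fin normal_pdfE ?gt_eqF// /normal_peak /normal_fun subr0.
  rewrite le_eqVlt; apply/orP; left; apply/eqP.
  rewrite (_ : s ^+ 2 * pi *+ 2 = s ^+ 2 * (2 * pi)); last by ring.
  rewrite (sqrtrM _ (sqr_ge0 s)) sqrtr_sqr (gtr0_norm s0) invfM.
  have p0 : (Num.sqrt (2 * pi : R)) != 0.
    by rewrite gt_eqF// sqrtr_gt0 mulr_gt0// pi_gt0.
  rewrite (_ : - (r + s) ^+ 2 / (s ^+ 2 *+ 2) = - ((r / s + 1) ^+ 2 / 2)); last first.
    by rewrite -mulr_natl; field; rewrite gt_eqF.
  by field; rewrite p0 gt_eqF.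
apply: (@le_trans _ _ (\int[lebesgue_measure]_(x in `]r, (r + s)%R])
   (normal_pdf 0 s x)%:E)%E).
  apply: ge0_le_integral => //=.
  - by move=> x _; rewrite lee_fin normal_pdf_ge0.
  - by apply/measurable_EFinP/measurable_funTS; exact: measurable_normal_pdf.
  - move=> x /=; rewrite in_itv/= => /andP[rx xr].
    rewrite lee_fin !normal_pdfE ?gt_eqF// ler_wpM2l ?normal_peak_ge0//.
    rewrite ler_expR !subr0 !mulNr lerN2 ler_wpM2r ?invr_ge0 ?mulrn_wge0 ?sqr_ge0//.
    by rewrite lerXn2r ?nnegrE//; lra.
apply: ge0_subset_integral => //=.
- by apply/measurable_EFinP/measurable_funTS; exact: measurable_normal_pdf.
- by move=> x _; rewrite lee_fin normal_pdf_ge0.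
- by move=> x /=; rewrite !in_itv/= => /andP[-> _].
Qed.

(** The density is at most 1/(s sqrt(2 pi)) <= 1/(2 s), so an interval of length 2a carrying half of
    the mass forces s <= 2a. This is how a bound on a probability becomes a bound on a variance. *)
Lemma cg_sd_le Y (a : R) : centered_gaussian P Y -> 0 <= a ->
  2^-1 <= pr [set w | `|Y w| <= a] -> Num.sqrt (var Y) <= 2 * a.
Proof.
move=> gY a0; have mY := cg_measurable gY.
have [v0|] := ltP 0 (var Y); last first.
  by rewrite le_eqVlt ltNge var_ge0 orbF => /eqP -> _; rewrite sqrtr0 mulr_ge0.
set s := Num.sqrt (var Y); have s0 : 0 < s by rewrite sqrtr_gt0.
have -> : [set w | `|Y w| <= a] = Y @^-1` `[- a, a].
  by apply/seteqP; split => w /=; rewrite in_itv/= ler_norml.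
rewrite /pr (cg_law gY v0)//= -/s => half.
have : (normal_prob 0 s `[(- a)%R, a] <= (2 * a * normal_peak s)%:E)%E.
  apply: (@le_trans _ _ (\int[lebesgue_measure]_(x in `[(- a)%R, a])
     (normal_peak s)%:E)%E).
    apply: ge0_le_integral => //=.
    - by move=> x _; rewrite lee_fin normal_pdf_ge0.
    - by apply/measurable_EFinP/measurable_funTS; exact: measurable_normal_pdf.
    - by move=> x _; rewrite lee_fin normal_pdf_ub ?gt_eqF.
  rewrite integral_cst//= lebesgue_measure_itv/= lte_fin.
  case: ifPn => _; last by rewrite mule0 lee_fin !mulr_ge0// normal_peak_ge0.
  by rewrite -EFinD -EFinM lee_fin mulrC ler_wpM2r ?normal_peak_ge0//; lra.
rewrite -(@fineK _ (normal_prob 0 s `[(- a)%R, a])); last exact: fin_num_measure.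
rewrite lee_fin => /(le_trans half) h.
have s20 : 0 <= 2 * s by lra.
have p2 : 2 * s <= Num.sqrt (s ^+ 2 * pi *+ 2).
  rewrite -[X in X <= _](ger0_norm s20) -sqrtr_sqr.
  rewrite ler_sqrt; last by rewrite mulrn_wge0// mulr_ge0 ?sqr_ge0 ?pi_ge0.
  have pi2 := pi_ge2 R.
  rewrite (_ : (2 * s) ^+ 2 = s ^+ 2 * 4); last by ring.
  rewrite (_ : s ^+ 2 * pi *+ 2 = s ^+ 2 * (2 * pi)); last by ring.
  by rewrite ler_wpM2l ?sqr_ge0//; lra.
have q0 : 0 < Num.sqrt (s ^+ 2 * pi *+ 2) by apply: lt_le_trans p2; lra.
move: h; rewrite /normal_peak ler_pdivlMr//; lra.
Qed.

End RealProbability.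

(** * Concentration of Gaussian maxima *)

Section TrigBounds.
Context (R : realType).

Lemma sin_le_id (x : R) : 0 <= x -> sin x <= x.
Proof.
move=> x0.
have dsin y : y \in `]0, x[ -> is_derive y 1 (@sin R) (cos y) by move=> _; exact: is_derive_sin.
have csin : {within `[0, x], continuous (@sin R)}.
  by apply: continuous_subspaceT => y; exact: continuous_sin.
have [c _] := MVT_segment x0 dsin csin.
rewrite sin0 !subr0 => ->.
by rewrite ler_piMl// cos_le1.
Qed.

Lemma cos_ge_parabola (x : R) : 0 <= x <= pi -> 1 - x ^+ 2 / 2 <= cos x.
Proof.
move=> /andP[x0 xpi]; rewrite [in X in _ <= X](_ : x = (x / 2) *+ 2); last first.
  by rewrite -mulr_natl; field.
have h := sin_le_id (_ : 0 <= x / 2).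
have s0 : 0 <= sin (x / 2) by apply: sin_ge0_pi; lra.
have {}h : sin (x / 2) <= x / 2 by apply: h; lra.
rewrite cos_mulr2n; have := cos2Dsin2 (x / 2).
nra.
Qed.

(** A quarter turn in [k] equal steps: at its end the first copy of the pair has been replaced by
    the second. *)
Definition rot_step (k : nat) : R := pi / 2 / k%:R.

Lemma rot_step_bounds k : (0 < k)%N ->
  [/\ 0 <= cos (rot_step k), 0 <= sin (rot_step k) &
      k%:R * sin (rot_step k) <= 2].
Proof.
move=> k0; have kR : (0 : R) < k%:R by rewrite ltr0n.
have p0 := pi_gt0 R; have p2 := pihalf_lt2 R.
have h0 : 0 <= rot_step k by rewrite /rot_step divr_ge0//; lra.
have h1 : rot_step k <= pi / 2.
  by rewrite /rot_step ler_pdivrMr// ler_peMr ?ler1n//; lra.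
split.
- by apply: cos_ge0_pihalf; lra.
- by apply: sin_ge0_pi; lra.
- have := sin_le_id h0; rewrite -(ler_pM2l kR) => /le_trans; apply.
  by rewrite /rot_step mulrC divfK ?gt_eqF//; lra.
Qed.

Lemma Bernoulli_pow (x : R) n : 0 <= x <= 1 -> 1 - n%:R * x <= (1 - x) ^+ n.
Proof.
move=> /andP[x0 x1]; elim: n => [|n ih]; first by rewrite mul0r subr0 expr0.
have : (1 - x) * (1 - n%:R * x) <= (1 - x) ^+ n.+1.
  by rewrite exprS ler_wpM2l//; lra.
apply: le_trans; rewrite -[n.+1]addn1 natrD.
have : 0 <= n%:R * x ^+ 2 by rewrite mulr_ge0 ?sqr_ge0.
nra.
Qed.

(** cos h >= 1 - h^2/2 >= 1 - 2/k^2 since h <= 2/k, then Bernoulli; k = 1 is treated apart because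
    2/k^2 exceeds 1 there. The damping accumulated over the quarter turn thus vanishes as [k]
    grows. *)
Lemma cos_rot_step_pow_ge k : (0 < k)%N -> 1 - 2 / k%:R <= cos (rot_step k) ^+ k.
Proof.
move=> k0; have kR : (0 : R) < k%:R by rewrite ltr0n.
have p0 := pi_gt0 R; have p2 := pihalf_lt2 R.
have h0 : 0 <= rot_step k by rewrite /rot_step divr_ge0//; lra.
have h1 : rot_step k <= pi / 2.
  by rewrite /rot_step ler_pdivrMr// ler_peMr ?ler1n//; lra.
have [k1|k1] := leqP k 1.
  have -> : k = 1%N by case: k k0 k1 {kR h0 h1} => [|[]].
  have [c0 _ _] := @rot_step_bounds 1 isT.
  by rewrite expr1 divr1; lra.
have kR2 : (2 : R) <= k%:R by rewrite ler_nat.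
have h2 : rot_step k ^+ 2 / 2 <= 2 / k%:R ^+ 2.
  rewrite /rot_step expr_div_n mulrAC ler_pM2r ?invr_gt0 ?exprn_gt0//; nra.
have h3 : 2 / k%:R ^+ 2 <= (1 : R).
  by rewrite ler_pdivrMr ?exprn_gt0//; nra.
have h4 : 0 <= 2 / k%:R ^+ 2 :> R by rewrite divr_ge0// exprn_ge0.
apply: (@le_trans _ _ ((1 - 2 / k%:R ^+ 2) ^+ k)).
  apply: le_trans (Bernoulli_pow _ _); last by rewrite h4 h3.
  rewrite (_ : k%:R * (2 / k%:R ^+ 2) = 2 / k%:R)//.
  by field; rewrite gt_eqF.
apply: lerXn2r; rewrite ?nnegrE; first by lra.
  by apply: cos_ge0_pihalf; lra.
apply: le_trans (cos_ge_parabola _); first by lra.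
by apply/andP; split => //; lra.
Qed.

End TrigBounds.

(** * The argmax event as a product of half-line indicators *)

Section LeftmostArgmax.
Context (R : realDomainType) (N : nat).
Implicit Types u : 'I_N.+1 -> R.

Definition is_argmax u : pred 'I_N.+1 := fun i => [forall j, u j <= u i].

(** Taking the smallest maximiser keeps the argmax events disjoint when values coincide. *)
Definition argmax u : 'I_N.+1 := [arg min_(i < [arg max_(i > ord0) u i]%O | is_argmax u i) i]%N.

(** The indicator of [argmax u = i]. A maximiser to the left of [i] must be excluded, hence the
    strict inequalities there; the product over differences is the shape that [laplace_null_orthant]
    integrates. *)
Definition argmaxP_ u (i : 'I_N.+1) : R := \prod_(j <- enum 'I_N.+1)
  (if (j < i)%N then (0 < u i - u j)%R%:R else (0 <= u i - u j)%R%:R).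

Lemma argmax_spec u : (forall j, u j <= u (argmax u)) /\
  forall j : 'I_N.+1, (j < argmax u)%N -> u j < u (argmax u).
Proof.
have h0 : is_argmax u [arg max_(i > ord0) u i]%O.
  case: arg_maxP => // i _ ui; apply/forallP => j; exact: ui.
rewrite /argmax; case: arg_minnP => // i /forallP ui mi; split => // j ji.
rewrite lt_neqAle ui andbT; apply/negP => /eqP E.
have /mi : is_argmax u j by apply/forallP => l; rewrite E.
by rewrite leqNgt ji.
Qed.

Lemma argmaxP_E u i : argmaxP_ u i = (i == argmax u)%:R.
Proof.
have [h1 h2] := argmax_spec u.
have [->|ni] := eqVneq i (argmax u).
  rewrite /argmaxP_ big1_seq// => j _.
  case: ifPn => ji; first by rewrite subr_gt0 h2.
  by rewrite subr_ge0 h1.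
apply/eqP; rewrite /argmaxP_ prodf_seq_eq0; apply/hasP.
exists (argmax u); first by rewrite mem_enum.
rewrite /= subr_gt0 subr_ge0; case: ltnP => ji; first by rewrite ltNge h1.
have {}ji : (i < argmax u)%N.
  by rewrite ltn_neqAle ji andbT; apply: contra ni => /eqP /val_inj ->.
by rewrite leNgt h2.
Qed.

Lemma argmaxP_sum u (f : 'I_N.+1 -> R) :
  \sum_i argmaxP_ u i * f i = f (argmax u).
Proof.
rewrite (bigD1 (argmax u))//= argmaxP_E eqxx mul1r big1 ?addr0// => i ni.
by rewrite argmaxP_E (negbTE ni) mul0r.
Qed.

End LeftmostArgmax.

Section ProductIndep.
Context d (T : measurableType d) (R : realType) (P : probability T R).
Implicit Types f g : T -> R.

Definition PP : probability (T * T)%type R := (P \x P)%E.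

Lemma PP_mul f g : (forall x, 0 <= f x) -> (forall x, 0 <= g x) ->
  P.-integrable setT (EFin \o f) -> P.-integrable setT (EFin \o g) ->
  PP.-integrable setT (EFin \o (fun z : T * T => f z.1 * g z.2)) /\
  \int[PP]_z (f z.1 * g z.2) = (\int[P]_x f x) * (\int[P]_x g x).
Proof.
move=> f0 g0 if_ ig.
have mf := L1_measurable if_; have mg := L1_measurable ig.
have mfg : measurable_fun setT (fun z : T * T => f z.1 * g z.2).
  by apply: measurable_funM; apply: measurableT_comp.
have fE : (\int[P]_x (f x)%:E)%E = (\int[P]_x f x)%:E.
  by rewrite fineK//; exact: integrable_fin_num if_.
have gE : (\int[P]_x (g x)%:E)%E = (\int[P]_x g x)%:E.
  by rewrite fineK//; exact: integrable_fin_num ig.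
have E : (\int[PP]_z (f z.1 * g z.2)%:E)%E =
    ((\int[P]_x f x) * (\int[P]_x g x))%:E.
  rewrite fubini_tonelli1; last 2 first.
  - exact/measurable_EFinP.
  - by move=> z; rewrite lee_fin mulr_ge0.
  transitivity (\int[P]_x ((\int[P]_x g x)%:E * (f x)%:E))%E.
    apply: eq_integral => x _; rewrite /fubini_F /=.
    under eq_integral do rewrite EFinM.
    rewrite ge0_integralZl//.
    - by rewrite gE muleC.
    - exact/measurable_EFinP.
    - by move=> y _; rewrite lee_fin.
    - by rewrite lee_fin.
  rewrite ge0_integralZl//.
  - by rewrite fE mulrC EFinM.
  - exact/measurable_EFinP.
  - by move=> y _; rewrite lee_fin.
  - by rewrite lee_fin Rintegral_ge0.
split; last by rewrite /Rintegral E.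
apply/integrableP; split; first exact/measurable_EFinP.
under eq_integral do rewrite /= ger0_norm ?mulr_ge0//.
by rewrite E ltry.
Qed.

Lemma pr_PP_setX (A B : set T) : measurable A -> measurable B ->
  pr PP (A `*` B) = pr P A * pr P B.
Proof.
move=> mA mB; apply: EFin_inj; rewrite EFinM -!prE//; last exact: measurableX.
exact: product_measure1E.
Qed.

End ProductIndep.

(* Maurey-Pisier concentration for the maximum of finitely many Gaussian
   variables: rotate an independent pair [(xi, xi')] in steps of angle [h]; each
   step changes the maximum by at least [sin h] times the rotated copy evaluated
   at the current argmax, which is independent of that argmax. *)
Section Concentration.
Context d (T : measurableType d) (R : realType) (P : probability T R).
Variables (N : nat) (xi : 'I_N.+1 -> T -> R) (K : R).
Hypothesis gxi : forall c : 'I_N.+1 -> R,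
  centered_gaussian P (fun w => \sum_i c i * xi i w).
Hypothesis K0 : 0 < K.
Hypothesis vxi : forall i, var P (xi i) <= K.

Definition lincomb (c : 'I_N.+1 -> R) (w : T) : R := \sum_i c i * xi i w.

Lemma lincomb_delta i (a : R) w :
  lincomb (fun j => if j == i then a else 0) w = a * xi i w.
Proof.
rewrite /lincomb (bigD1 i)//= eqxx big1 ?addr0// => j /negbTE ->.
by rewrite mul0r.
Qed.

Lemma xi_gaussian i : centered_gaussian P (xi i).
Proof.
have := gxi (fun j => if j == i then 1 else 0).
congr (centered_gaussian P _); apply/funext => w.
by rewrite -/(lincomb _ w) lincomb_delta mul1r.
Qed.

Definition rot (t : R) i (z : T * T) : R := cos t * xi i z.1 + sin t * xi i z.2.
Definition rot' (t : R) i (z : T * T) : R :=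
  - sin t * xi i z.1 + cos t * xi i z.2.

Lemma rot_measurable t i : measurable_fun setT (rot t i).
Proof.
have mx := cg_measurable (xi_gaussian i).
by apply: measurable_funD; apply: measurable_funM => //; apply: measurableT_comp.
Qed.

Lemma rot'_measurable t i : measurable_fun setT (rot' t i).
Proof.
have mx := cg_measurable (xi_gaussian i).
by apply: measurable_funD; apply: measurable_funM => //; apply: measurableT_comp.
Qed.

Lemma rotD t h i z : rot (t + h) i z = cos h * rot t i z + sin h * rot' t i z.
Proof. by rewrite /rot /rot' cosD sinD; ring. Qed.

Lemma lincomb_sqr_L1 c : P.-integrable setT (EFin \o (fun w => lincomb c w ^+ 2)).
Proof. exact: cg_L2 (gxi c). Qed.

(** The coefficients carried by the two copies are a rotation of [(a, b)], so the cross terms cancel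
    when the variances are added. The result does not depend on [t] and splits into an [a] part and
    a [b] part: in terms of Laplace transforms, [rot t] and [rot' t] are again independent copies of
    the family. *)
Lemma rot_mgf t (a b : 'I_N.+1 -> R) :
  let E z := expR (\sum_i a i * rot t i z + \sum_i b i * rot' t i z) in
  (PP P).-integrable setT (EFin \o E) /\
  \int[PP P]_z E z = expR ((var P (lincomb a) + var P (lincomb b)) / 2).
Proof.
pose c i := a i * cos t - b i * sin t.
pose e i := a i * sin t + b i * cos t.
have EE z : expR (\sum_i a i * rot t i z + \sum_i b i * rot' t i z) =
    expR (1 * lincomb c z.1) * expR (1 * lincomb e z.2).
  rewrite -expRD !mul1r /lincomb -!big_split/=; congr expR.
  by apply: eq_bigr => i _; rewrite /rot /rot' /c /e; ring.
rewrite /= (funext EE).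
have [ic ec] := cg_expR 1 (gxi c); have [ie ee] := cg_expR 1 (gxi e).
have [iE ->] := PP_mul (fun x => expR_ge0 (1 * lincomb c x))
  (fun x => expR_ge0 (1 * lincomb e x)) ic ie.
split=> //; rewrite ec ee -expRD !expr1n !mul1r -mulrDl; congr (expR (_ / 2)).
rewrite /var -RintegralD//; [|exact: lincomb_sqr_L1..].
rewrite -RintegralD//; [|exact: lincomb_sqr_L1..].
apply: eq_Rintegral => w _.
have -> : \sum_i c i * xi i w = cos t * lincomb a w - sin t * lincomb b w.
  rewrite /lincomb !mulr_sumr -sumrB; apply: eq_bigr => i _.
  by rewrite /c; ring.
have -> : \sum_i e i * xi i w = sin t * lincomb a w + cos t * lincomb b w.
  rewrite /lincomb !mulr_sumr -big_split/=; apply: eq_bigr => i _.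
  by rewrite /e; ring.
have := cos2Dsin2 t; set C := cos t; set S := sin t => CS.
rewrite -[RHS]mul1r -CS; ring.
Qed.

Lemma var_lincomb_delta i (l : R) :
  var P (lincomb (fun j => if j == i then l else 0)) = l ^+ 2 * var P (xi i).
Proof.
rewrite /var; under eq_Rintegral do rewrite lincomb_delta exprMn.
by rewrite RintegralZl//; exact: cg_L2 (xi_gaussian i).
Qed.

Let pick t i z := argmaxP_ (fun j => rot t j z) i.

Lemma pick_measurable t i : measurable_fun setT (pick t i).
Proof.
rewrite /pick /argmaxP_; apply: measurable_prod => j _.
have m : measurable_fun setT (fun z => rot t i z - rot t j z).
  by apply: measurable_funB; exact: rot_measurable.
case: (j < i)%N.
- rewrite (_ : (fun z => _) = \1_[set z | 0 < rot t i z - rot t j z]).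
    by apply: measurable_indic; exact: measurable_gt.
  by apply/funext => z; rewrite indicE mem_setE.
- rewrite (_ : (fun z => _) = \1_[set z | 0 <= rot t i z - rot t j z]).
    by apply: measurable_indic; exact: measurable_ge.
  by apply/funext => z; rewrite indicE mem_setE.
Qed.

Lemma pick01 t i z : 0 <= pick t i z <= 1.
Proof. by rewrite /pick argmaxP_E; case: eqP => _; rewrite ?lexx ?ler01. Qed.

Lemma pick_expR_L1 t i (l : R) : (PP P).-integrable setT
  (EFin \o (fun z => pick t i z * expR (l * rot' t i z))).
Proof.
have [i0 _] := rot_mgf t (fun=> 0) (fun j => if j == i then l else 0).
apply: (L1_le _ _ i0).
  apply: measurable_funM; first exact: pick_measurable.
  by apply: measurableT_comp => //; apply: measurable_funM => //; exact: rot'_measurable.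
move=> z; have /andP[p0 p1] := pick01 t i z.
rewrite normrM (ger0_norm p0) (ger0_norm (expR_ge0 _)).
rewrite big1 ?add0r; last by move=> j _; rewrite mul0r.
rewrite (bigD1 i)//= eqxx big1 ?addr0; last by move=> j /negbTE ->; rewrite mul0r.
by rewrite ler_piMl// expR_ge0.
Qed.

(** Independence of the argmax event of [rot t] from [rot' t i]. By [rot_mgf] the weight [V], an
    exponential minus its mean, is null against all exponentials of the differences
    [rot t i - rot t j], hence against the indicator [pick t i]. *)
Lemma pick_indep t i (l : R) :
  \int[PP P]_z (pick t i z * expR (l * rot' t i z)) =
  expR (l ^+ 2 * var P (xi i) / 2) * \int[PP P]_z pick t i z.
Proof.
set k := expR _.
pose V z := expR (l * rot' t i z) - k.
have ipick : (PP P).-integrable setT (EFin \o pick t i).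
  apply: (@integrable_bounded _ _ _ _ _ 1); first exact: pick_measurable.
  by move=> z; have /andP[p0 p1] := pick01 t i z; rewrite ger0_norm.
apply/eqP; rewrite -subr_eq0 -RintegralZl// -RintegralB//; last 2 first.
- exact: pick_expR_L1.
- exact: L1Z.
apply/eqP; transitivity (\int[PP P]_z (V z * pick t i z)).
  by apply: eq_Rintegral => z _; rewrite /V; ring.
apply: (@laplace_null_orthant _ _ _ (PP P) _ (enum 'I_N.+1) (fun j => (j < i)%N)
  (fun j z => rot t i z - rot t j z)); first exact: enum_uniq.
  by move=> j; apply: measurable_funB; exact: rot_measurable.
move=> c.
(* Coefficients of the sum of differences once collected by index: [i] receives the total of all
   [c m]. *)
pose a j := (if j == i then \sum_(m <- enum 'I_N.+1) c m else 0) - c j.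
have aE z : \sum_(j <- enum 'I_N.+1) c j * (rot t i z - rot t j z) =
    \sum_j a j * rot t j z.
  rewrite /a; under eq_bigr do rewrite mulrBr.
  rewrite sumrB -mulr_suml; under [RHS]eq_bigr do rewrite mulrBl.
  rewrite sumrB; congr (_ - _); last by rewrite -big_enum.
  rewrite [RHS](bigD1 i)//= eqxx [X in _ = _ + X]big1 ?addr0//.
  by move=> j /negbTE ->; rewrite mul0r.
have [i1 e1] := rot_mgf t a (fun j => if j == i then l else 0).
have [i0 e0] := rot_mgf t a (fun=> 0).
have E1 z : \sum_j (if j == i then l else 0) * rot' t j z = l * rot' t i z.
  by rewrite (bigD1 i)//= eqxx big1 ?addr0// => j /negbTE ->; rewrite mul0r.
have E0 z : \sum_j 0 * rot' t j z = 0 by rewrite big1// => j _; rewrite mul0r.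
have VE z : V z * expR (\sum_(j <- enum 'I_N.+1) c j * (rot t i z - rot t j z)) =
    expR (\sum_j a j * rot t j z +
          \sum_j (if j == i then l else 0) * rot' t j z) -
    k * expR (\sum_j a j * rot t j z + \sum_j 0 * rot' t j z).
  by rewrite aE E1 E0 addr0 expRD /V; ring.
rewrite (funext VE); split; first exact: integrableB i1 (L1Z k i0).
rewrite RintegralB//; last exact: L1Z.
rewrite RintegralZl// e1 e0 var_lincomb_delta -expRD.
rewrite (_ : lincomb (fun=> 0) = fun=> 0); last first.
  by apply/funext => w; rewrite /lincomb big1// => j _; rewrite mul0r.
rewrite /var; under [X in expR (_ + (_ + X) / 2)]eq_Rintegral do rewrite expr0n/=.
rewrite Rintegral_cst// mul0r -/(var P (lincomb a)) -/(var P (xi i)) addr0.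
by rewrite -mulrDl [X in _ - expR (X / 2)]addrC subrr.
Qed.

Definition rot_top t z := rot t (argmax (fun j => rot t j z)) z.
Definition rot'_top t z := rot' t (argmax (fun j => rot t j z)) z.

Lemma rot'_topE t z : rot'_top t z = \sum_i pick t i z * rot' t i z.
Proof. by rewrite argmaxP_sum. Qed.

Lemma rot'_top_measurable t : measurable_fun setT (rot'_top t).
Proof.
rewrite (funext (rot'_topE t)); apply: measurable_sum => i.
by apply: measurable_funM; [exact: pick_measurable|exact: rot'_measurable].
Qed.

(** Given that the argmax is [i], [rot'_top] behaves like a copy of [xi i]. Averaging over [i] keeps
    the bound with the common [K], and the number of variables does not enter. *)
Lemma rot'_top_mgf t (l : R) :
  (PP P).-integrable setT (EFin \o (fun z => expR (l * rot'_top t z))) /\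
  \int[PP P]_z expR (l * rot'_top t z) <= expR (l ^+ 2 * K / 2).
Proof.
have E z : expR (l * rot'_top t z) = \sum_i pick t i z * expR (l * rot' t i z).
  by rewrite (@argmaxP_sum _ _ (fun j => rot t j z) (fun i => expR (l * rot' t i z))).
rewrite (funext E); split; first exact: L1_sum (fun i => pick_expR_L1 t i l).
rewrite RintegralT_sum; last by move=> i; exact: pick_expR_L1.
under eq_bigr do rewrite pick_indep.
have ipick i : (PP P).-integrable setT (EFin \o pick t i).
  apply: (@integrable_bounded _ _ _ _ _ 1); first exact: pick_measurable.
  by move=> z; have /andP[p0 p1] := pick01 t i z; rewrite ger0_norm.
apply: (@le_trans _ _ (\sum_i expR (l ^+ 2 * K / 2) * \int[PP P]_z pick t i z)).
  apply: ler_sum => i _; apply: ler_wpM2r.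
    by apply: Rintegral_ge0 => z _; have /andP[] := pick01 t i z.
  rewrite ler_expR; have := ler_wpM2l (sqr_ge0 l) (vxi i); lra.
rewrite -mulr_sumr -RintegralT_sum//.
rewrite (_ : (fun z => \sum_i pick t i z) = fun=> 1).
  by rewrite Rintegral_cst// mul1r -/(pr _ _) pr_setT mulr1.
apply/funext => z; rewrite -[RHS](@argmaxP_sum _ _ (fun j => rot t j z) (fun=> 1)).
by apply: eq_bigr => i _; rewrite mulr1.
Qed.

Section Steps.
Variable k : nat.
Hypothesis k0 : (0 < k)%N.
Let h : R := rot_step R k.
Let top (j : nat) z := rot_top (j%:R * h) z.
Let top' (j : nat) z := rot'_top (j%:R * h) z.
Let wt (j : nat) : R := cos h ^+ (k.-1 - j) * sin h.

(** The argmax at one angle is merely a candidate at the next angle, where [rotD] gives its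
    value. *)
Lemma rot_top_step j z : cos h * top j z + sin h * top' j z <= top j.+1 z.
Proof.
rewrite /top /top' /rot_top /rot'_top -rotD.
have -> : j%:R * h + h = j.+1%:R * h by rewrite -[j.+1]addn1 natrD mulrDl mul1r.
by have [h1 _] := argmax_spec (fun i => rot (j.+1%:R * h) i z); exact: h1.
Qed.

Lemma rot_top_chain z n : (n <= k)%N ->
  cos h ^+ n * top 0 z + \sum_(j < n) cos h ^+ (n.-1 - j) * sin h * top' j z
    <= top n z.
Proof.
have [c0 s0 _] := rot_step_bounds R k0.
elim: n => [_|n ih nk]; first by rewrite expr0 mul1r big_ord0 addr0.
apply: le_trans (rot_top_step n z).
have /(ler_wpM2l c0) := ih (ltnW nk); rewrite -/h => {}ih.
rewrite big_ord_recr/= subnn expr0 mul1r addrA lerD2r.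
apply: le_trans ih; rewrite [X in _ <= X]mulrDr [X in _ <= X + _]mulrA -exprS lerD2l mulr_sumr.
apply: ler_sum => j _; rewrite !mulrA -exprS.
by rewrite (_ : (n.-1 - j).+1 = (n - j)%N)//; case: n j {nk} => [[]//|n] j /=; rewrite subSn// -ltnS.
Qed.

Lemma wt_bounds (j : 'I_k) : 0 <= k%:R * wt j <= 2.
Proof.
have [c0 s0 ks] := rot_step_bounds R k0; rewrite -/h in c0 s0 ks.
rewrite /wt; apply/andP; split; first by rewrite !mulr_ge0 ?exprn_ge0.
apply: le_trans ks; rewrite ler_wpM2l// ler_piMl// exprn_ile1// cos_le1.
Qed.

(** The terms [top' j] are dependent for different [j]. The weighted sum is therefore written as an
    average over [j], which convexity reduces to single terms; as [k%:R * wt j] lies in [0, 2], each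
    has subgaussian constant at most 4 K. *)
Lemma chain_tail (x : R) : 0 <= x ->
  pr (PP P) [set z | x <= - \sum_(j < k) wt j * top' j z] <=
  expR (- (x ^+ 2 / (8 * K))).
Proof.
move=> x0; rewrite (_ : 8 * K = 2 * (4 * K)); last by ring.
have kR : (0 : R) < k%:R by rewrite ltr0n.
have mS : measurable_fun setT (fun z => - \sum_(j < k) wt j * top' j z).
  apply: measurableT_comp => //; apply: measurable_sum => j.
  by apply: measurable_funM => //; exact: rot'_top_measurable.
apply: subgaussian_tail => //; first by rewrite mulr_gt0.
move=> a a0.
pose y (j : 'I_k) z := (- (a * (k%:R * wt j))) * top' j z.
have avg z : a * (- \sum_(j < k) wt j * top' j z) = k%:R^-1 * \sum_j y j z.
  rewrite mulrN mulr_sumr -sumrN mulr_sumr; apply: eq_bigr => j _.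
  by rewrite /y; field; rewrite gt_eqF.
(* Jensen for the exponential, from its tangent line at the average. *)
have jensen z : expR (a * - \sum_(j < k) wt j * top' j z) <=
    k%:R^-1 * \sum_j expR (y j z).
  rewrite avg; set m := k%:R^-1 * _.
  have tang j : expR m * (1 + (y j z - m)) <= expR (y j z).
    have -> : expR (y j z) = expR m * expR (y j z - m).
      by rewrite -expRD addrC subrK.
    by rewrite ler_wpM2l ?expR_ge0// expR_ge1Dx.
  have : \sum_j expR m * (1 + (y j z - m)) <= \sum_j expR (y j z).
    by apply: ler_sum => j _.
  rewrite -mulr_sumr big_split/= sumrB !sumr_const card_ord.
  rewrite -[m *+ k]mulr_natl /m mulrA divff ?gt_eqF// mul1r subrr addr0.
  by rewrite -(@ler_pM2l _ k%:R^-1) ?invr_gt0// mulrCA mulVf ?gt_eqF// mulr1.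
have iy j : (PP P).-integrable setT (EFin \o (fun z => expR (y j z))).
  exact: (rot'_top_mgf _ _).1.
have iS : (PP P).-integrable setT
    (EFin \o (fun z => k%:R^-1 * \sum_j expR (y j z))).
  by apply: L1Z; exact: L1_sum.
have iE : (PP P).-integrable setT
    (EFin \o (fun z => expR (a * - \sum_(j < k) wt j * top' j z))).
  apply: L1_le iS; first by apply: measurableT_comp => //; exact: measurable_funM.
  by move=> z; rewrite ger0_norm ?expR_ge0.
split=> //; apply: (@le_trans _ _ (\int[PP P]_z (k%:R^-1 * \sum_j expR (y j z)))).
  exact: le_Rintegral.
rewrite RintegralZl//; last exact: L1_sum.
rewrite RintegralT_sum//.
apply: (@le_trans _ _ (k%:R^-1 * \sum_(j < k) expR (a ^+ 2 * (4 * K) / 2))).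
  rewrite ler_wpM2l ?invr_ge0//; apply: ler_sum => j _.
  apply: (le_trans (rot'_top_mgf _ _).2); rewrite ler_expR.
  have /andP[w0 w2] := wt_bounds j.
  rewrite sqrrN exprMn; set w := k%:R * wt j in w0 w2 *.
  have w4 : w ^+ 2 <= 4 by nra.
  have a2 := sqr_ge0 a.
  have : a ^+ 2 * w ^+ 2 * K <= a ^+ 2 * 4 * K.
    exact: ler_wpM2r (ltW K0) _ _ (ler_wpM2l a2 w4).
  lra.
by rewrite sumr_const card_ord -[X in _ * X <= _]mulr_natl mulrA mulVf ?gt_eqF// mul1r.
Qed.

(** On the product space the two events concern independent copies: the maximum is at least [r] at
    angle 0 and at most [m] at angle pi/2, so the weighted sum of the steps must be at most
    [m - cos h ^+ k * r]. *)
Lemma concentration (r m : R) : m <= cos h ^+ k * r ->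
  pr P [set w | exists i, r <= xi i w] * pr P [set w | forall i, xi i w <= m] <=
  expR (- ((cos h ^+ k * r - m) ^+ 2 / (8 * K))).
Proof.
move=> mr.
have [c0 s0 _] := rot_step_bounds R k0; rewrite -/h in c0 s0.
have mA : measurable [set w | exists i, r <= xi i w].
  rewrite (_ : [set w | _] = \big[setU/set0]_(i <- enum 'I_N.+1) [set w | r <= xi i w]).
    by apply: bigsetU_measurable => i _; apply: measurable_ge; exact: cg_measurable (xi_gaussian i).
  rewrite -bigcup_seq; apply/seteqP; split => w /=.
    by move=> [i ri]; exists i => //=; rewrite mem_enum.
  by move=> [i _ ri]; exists i.
have mB : measurable [set w | forall i, xi i w <= m].
  rewrite (_ : [set w | _] = \big[setI/setT]_(i <- enum 'I_N.+1) [set w | xi i w <= m]).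
    by apply: bigsetI_measurable => i _; apply: measurable_le; exact: cg_measurable (xi_gaussian i).
  rewrite -bigcap_seq; apply/seteqP; split => w /=.
    by move=> h1 i _; exact: h1.
  by move=> h1 i; apply: h1; rewrite /= mem_enum.
rewrite -pr_PP_setX//; apply: le_trans (chain_tail _); last by rewrite subr_ge0.
apply: pr_le; first exact: measurableX.
  apply: measurable_ge; apply: measurableT_comp => //; apply: measurable_sum => j.
  by apply: measurable_funM => //; exact: rot'_top_measurable.
move=> [w1 w2] [/= [i ri] xm].
have := rot_top_chain (w1, w2) (leqnn k).
have t0 : r <= top 0 (w1, w2).
  apply: le_trans ri _; rewrite /top mul0r /rot_top.
  have [h1 _] := argmax_spec (fun i => rot 0 i (w1, w2)).
  apply: le_trans (h1 i); by rewrite /rot/= cos0 sin0 mul1r mul0r addr0.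
have tk : top k (w1, w2) <= m.
  rewrite /top /rot_top (_ : k%:R * h = pi / 2); last first.
    by rewrite /h /rot_step; field; rewrite pnatr_eq0 -lt0n.
  by rewrite /rot cos_pihalf sin_pihalf mul0r mul1r add0r.
have tr := ler_wpM2l (exprn_ge0 k c0) t0.
rewrite -/h; set S := \sum_(j < k) _ => ck.
rewrite lerNr; lra.
Qed.

End Steps.
End Concentration.

(** * Lower bound for the maximum of nearly uncorrelated variables *)

Section SecondMoment.
Context d (T : measurableType d) (R : realType) (P : probability T R).

(* Cauchy-Schwarz for the counting variable, in the form
   [x <= l / 2 + x ^+ 2 / (2 * l)]. *)
Lemma second_moment_lower (n : nat) (B : 'I_n -> set T) (A c : R) :
  (forall i, measurable (B i)) -> 0 < A -> 0 <= c ->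
  A <= \sum_i pr P (B i) ->
  \sum_i \sum_(j | j != i) pr P (B i `&` B j) <= c ->
  A ^+ 2 / (A + c) <= pr P [set w | exists i, B i w].
Proof.
move=> mB A0 c0 AB Bc.
set U := [set w | exists i, B i w].
have mU : measurable U.
  rewrite (_ : U = \big[setU/set0]_(i <- enum 'I_n) B i).
    by apply: bigsetU_measurable => i _; exact: mB.
  rewrite -bigcup_seq; apply/seteqP; split => w /=.
    by move=> [i ri]; exists i => //=; rewrite mem_enum.
  by move=> [i _ ri]; exists i.
have cA : 0 < A + c by lra.
(* With this [l] the quadratic term costs exactly half of [A]: (2 l)^-1 (A + c) = A / 2. *)
pose l := (A + c) / A; have l1 : 1 <= l by rewrite ler_pdivlMr// mul1r; lra.
pose S w : R := \sum_i \1_(B i) w.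
have SS w : S w ^+ 2 = S w + \sum_i \sum_(j | j != i) \1_(B i `&` B j) w.
  rewrite expr2 {1}/S mulr_suml [in RHS]/S -big_split/=; apply: eq_bigr => i _.
  rewrite /S (bigD1 i)//= mulrDr mulr_sumr; congr (_ + _).
    by rewrite indicE; case: (w \in B i); rewrite ?mulr1 ?mulr0.
  by apply: eq_bigr => j _; rewrite indicI.
have key w : S w <= l / 2 * \1_U w + (2 * l)^-1 * S w +
   (2 * l)^-1 * \sum_i \sum_(j | j != i) \1_(B i `&` B j) w.
  have [Uw|nU] := boolP (w \in U).
    rewrite indicE Uw mulr1 -addrA -mulrDr -SS.
    have : 0 <= (2 * l)^-1 * (S w - l) ^+ 2.
      by rewrite mulr_ge0 ?sqr_ge0// invr_ge0; lra.
    rewrite (_ : (2 * l)^-1 * (S w - l) ^+ 2 = l / 2 + (2 * l)^-1 * S w ^+ 2 - S w).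
      by lra.
    by field; rewrite gt_eqF//; lra.
  have nB i : w \notin B i.
    by apply: contra nU; rewrite !inE => Biw; exists i.
  have S0 : S w = 0 by apply: big1 => i _; rewrite indicE (negbTE (nB i)).
  rewrite S0 indicE (negbTE nU) !mulr0 !add0r mulr_ge0 ?invr_ge0//; first by lra.
  by apply: sumr_ge0 => i _; apply: sumr_ge0 => j _.
have iB i : P.-integrable setT (EFin \o (\1_(B i) : T -> R)) by exact: L1_indic.
have iBB i j : P.-integrable setT (EFin \o (\1_(B i `&` B j) : T -> R)).
  by apply: L1_indic; exact: measurableI.
have iS : P.-integrable setT (EFin \o S) by exact: L1_sum.
have iBBs i : P.-integrable setT
    (EFin \o (fun w => \sum_(j | j != i) \1_(B i `&` B j) w : R)).
  rewrite (_ : (fun w => _) = (fun w => \sum_(j <- enum 'I_n | j != i) \1_(B i `&` B j) w)).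
    under eq_fun do rewrite -big_filter.
    exact: L1_sum.
  by apply/funext => w; rewrite big_enum_cond.
have iSS : P.-integrable setT
    (EFin \o (fun w => \sum_i \sum_(j | j != i) \1_(B i `&` B j) w : R)).
  exact: L1_sum.
have eS : \int[P]_w S w = \sum_i pr P (B i).
  by rewrite RintegralT_sum//; apply: eq_bigr => i _; rewrite pr_RintegralE.
have eSS : \int[P]_w (\sum_i \sum_(j | j != i) \1_(B i `&` B j) w : R) =
    \sum_i \sum_(j | j != i) pr P (B i `&` B j).
  rewrite RintegralT_sum//; apply: eq_bigr => i _.
  under eq_Rintegral do rewrite -big_filter.
  rewrite RintegralT_sum// -[RHS]big_filter; apply: eq_bigr => j _.
  by rewrite pr_RintegralE//; exact: measurableI.
have iU : P.-integrable setT (EFin \o (\1_U : T -> R)) by exact: L1_indic.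
have := @le_Rintegral _ _ _ P setT S (fun w => l / 2 * \1_U w + (2 * l)^-1 * S w +
   (2 * l)^-1 * \sum_i \sum_(j | j != i) \1_(B i `&` B j) w) measurableT iS.
have i1 := L1Z (l / 2) iU; have i2 := L1Z (2 * l)^-1 iS.
have i3 := L1Z (2 * l)^-1 iSS.
move=> /(_ (L1D (L1D i1 i2) i3) (fun w _ => key w)).
rewrite RintegralD//; last exact: L1D i1 i2.
rewrite RintegralD// !RintegralZl// -pr_RintegralE// eS eSS.
move: (\sum_i pr P (B i)) AB (\sum_i _) Bc => a Aa b bc h.
rewrite ler_pdivrMr//.
have l0 : 0 < l by lra.
have h1 : a - (2 * l)^-1 * (a + c) <= l / 2 * pr P U.
  have : (2 * l)^-1 * b <= (2 * l)^-1 * c by rewrite ler_wpM2l// invr_ge0; lra.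
  lra.
have h2 : A - (2 * l)^-1 * (A + c) <= a - (2 * l)^-1 * (a + c).
  have : (2 * l)^-1 <= 1 by rewrite invf_le1; lra.
  nra.
have h3 : (2 * l)^-1 * (A + c) = A / 2.
  by rewrite /l; field; rewrite !gt_eqF.
have h4 : A / 2 <= l / 2 * pr P U by lra.
have h5 : A * (A / 2) <= A * (l / 2 * pr P U) by rewrite ler_pM2l.
have h6 : A * (l / 2 * pr P U) = (A + c) * pr P U / 2.
  by rewrite /l; field; rewrite gt_eqF.
by rewrite mulrC; nra.
Qed.

End SecondMoment.

(** * Second moment method combined with concentration *)

Section MaxLower.
Context (R : realType).

Lemma quadratic_dominates (a1 a0 c : R) : 0 < c -> exists2 b0 : R, 0 < b0 &
  forall b, b0 <= b -> a1 * b + a0 <= c * b ^+ 2.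
Proof.
move=> c0; exists (1 + (`|a1| + `|a0|) / c).
  by rewrite ltr_pwDl// divr_ge0// ?addr_ge0// ltW.
move=> b hb; have n0 : 0 <= (`|a1| + `|a0|) / c by rewrite divr_ge0// ?addr_ge0// ltW.
have b1 : 1 <= b by lra.
have h1 : `|a1| + `|a0| <= c * b by rewrite -ler_pdivrMl// mulrC; lra.
have h2 := ler_norm a1; have h3 := ler_norm a0; have h4 := normr_ge0 a0.
have : (`|a1| + `|a0|) * b <= c * b * b by rewrite ler_wpM2r//; lra.
nra.
Qed.

(** [b0] depends only on [dl] and [c1], so one threshold serves all dyadic scales. At the level r =
    (1 - dl) s b the expected number of exceedances is at least 1 and the pairs cost q / p0^2 <=
    exp(dl^2 b^2 / 16), so some value exceeds r with probability at least exp(-dl^2 b^2 / 16) / 2.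
    Dividing the concentration bound exp(-dl^2 b^2 / 8) by this gives the claim. *)
Lemma gaussian_max_lower (dl c1 : R) : 0 < dl -> dl < 1 -> 0 < c1 ->
  exists2 b0 : R, 0 < b0 & forall b, b0 <= b ->
  forall d (T : measurableType d) (P : probability T R) (N : nat)
    (xi : 'I_N.+1 -> T -> R) (v : R),
  (forall c : 'I_N.+1 -> R, centered_gaussian P (fun w => \sum_i c i * xi i w)) ->
  0 < v -> (forall i, var P (xi i) = v) ->
  (forall i j, i != j -> var P (fun w => xi i w + xi j w) <=
     2 * v * (1 + dl ^+ 2 / 32)) ->
  c1 * expR (b ^+ 2 / 2) <= N.+1%:R ->
  pr P [set w | forall i, xi i w <= (1 - 3 * dl) * Num.sqrt v * b] <=
    2 * expR (- (dl ^+ 2 / 16 * b ^+ 2)).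
Proof.
move=> dl0 dl1 c10.
pose c0 : R := (Num.sqrt (2 * pi))^-1.
have c00 : 0 < c0 by rewrite invr_gt0 sqrtr_gt0 mulr_gt0// pi_gt0.
(* Beyond [b1] the expected count is at least 1. Beyond [b2] the lower-order terms of q / p0^2 fit
   into exp(dl^2 b^2 / 32); the other half of dl^2 b^2 / 16 pays for the correlations. *)
have [b1 b10 hb1] := @quadratic_dominates (1 - dl) (1 / 2 - ln (c1 * c0))
  (dl * (2 - dl) / 2) ltac:(nra).
have d20 : 0 < dl ^+ 2 / 32 by rewrite divr_gt0// exprn_gt0.
have [b2 b20 hb2] := @quadratic_dominates (2 * (1 - dl)) (1 - 2 * ln c0) _ d20.
exists (b1 + b2); first by lra.
move=> b bb d T P N xi v gxi v0 vv cv hN.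
have b0 : 0 < b by lra.
have {}hb1 := hb1 b ltac:(lra); have {}hb2 := hb2 b ltac:(lra).
set s := Num.sqrt v; have s0 : 0 < s by rewrite sqrtr_gt0.
have sv : s ^+ 2 = v by rewrite sqr_sqrtr// ltW.
pose r := (1 - dl) * s * b.
have r0 : 0 <= r by rewrite !mulr_ge0//; lra.
pose p0 := c0 * expR (- (((1 - dl) * b + 1) ^+ 2 / 2)).
have p00 : 0 < p0 by rewrite mulr_gt0// expR_gt0.
have gi i : centered_gaussian P (xi i) := xi_gaussian gxi i.
have pi_ i : p0 <= pr P [set w | r < xi i w].
  have := cg_lower_tail (gi i) _ r0; rewrite vv => /(_ v0).
  by rewrite -/s /r (_ : (1 - dl) * s * b / s = (1 - dl) * b)//; field; rewrite gt_eqF.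
pose A := N.+1%:R * p0.
have A1 : 1 <= A.
  have h : c1 * expR (b ^+ 2 / 2) * p0 <= A by rewrite /A ler_wpM2r// ltW.
  apply: le_trans h.
  rewrite /p0 (_ : _ * _ = c1 * c0 * (expR (b ^+ 2 / 2) *
     expR (- (((1 - dl) * b + 1) ^+ 2 / 2)))); last by ring.
  have cc : 0 < c1 * c0 by rewrite mulr_gt0.
  rewrite -expRD -[c1 * c0]lnK ?posrE// -expRD -[X in X <= _]expR0 ler_expR.
  nra.
pose q := expR (- (r ^+ 2 / (v * (1 + dl ^+ 2 / 32)))).
have e0 : 0 < v * (1 + dl ^+ 2 / 32) by rewrite mulr_gt0//; lra.
(* Two exceedances push the sum above [2 * r], a Gaussian tail with almost additive variance. *)
have pij i j : j != i ->
    pr P ([set w | r < xi i w] `&` [set w | r < xi j w]) <= q.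
  move=> ji; have gij : centered_gaussian P (fun w => xi i w + xi j w).
    have := gxi (fun l => if (l == i) || (l == j) then 1 else 0).
    congr (centered_gaussian P _); apply/funext => w.
    rewrite (bigD1 i)//= eqxx mul1r (bigD1 j)//= eqxx orbT mul1r big1 ?addr0//.
    by move=> l /andP[/negbTE -> /negbTE ->]; rewrite mul0r.
  have K0 : 0 < 2 * v * (1 + dl ^+ 2 / 32) by rewrite -mulrA mulr_gt0.
  have ij : i != j by rewrite eq_sym.
  have := @cg_tail _ _ _ P _ (2 * r) _ gij K0 (cv _ _ ij).
  have r20 : 0 <= 2 * r by lra.
  move=> /(_ r20).
  rewrite (_ : (2 * r) ^+ 2 / _ = r ^+ 2 / (v * (1 + dl ^+ 2 / 32))); last first.
    by field; rewrite !gt_eqF//; lra.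
  apply: le_trans; apply: pr_le.
  - by apply: measurableI; apply: measurable_gt; exact: cg_measurable (gi _).
  - by apply: measurable_ge; exact: cg_measurable gij.
  - by move=> w [/= h1 h2]; lra.
have c_0 : 0 <= N.+1%:R ^+ 2 * q by rewrite mulr_ge0 ?exprn_ge0// expR_ge0.
have := @second_moment_lower _ _ _ P _ (fun i => [set w | r < xi i w]) A
  (N.+1%:R ^+ 2 * q).
have mB i : measurable [set w | r < xi i w].
  by apply: measurable_gt; exact: cg_measurable (gi i).
have A0 : 0 < A by lra.
move=> /(_ mB A0 c_0).
have sA : A <= \sum_i pr P [set w | r < xi i w].
  apply: (@le_trans _ _ (\sum_(i < N.+1) p0)); last exact: ler_sum.
  by rewrite sumr_const card_ord /A mulr_natl.
have sB : \sum_i \sum_(j | j != i)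
    pr P ([set w | r < xi i w] `&` [set w | r < xi j w]) <= N.+1%:R ^+ 2 * q.
  apply: (@le_trans _ _ (\sum_(i < N.+1) \sum_(j < N.+1) q)).
    apply: ler_sum => i _; rewrite [in X in _ <= X](bigID (fun j => j != i))/=.
    apply: (@le_trans _ _ (\sum_(j < N.+1 | j != i) q)).
      by apply: ler_sum => j; exact: pij.
    by rewrite lerDl sumr_ge0// => j _; exact: expR_ge0.
  by rewrite !sumr_const !card_ord -mulrnA -[X in X <= _]mulr_natl natrM expr2.
move=> /(_ sA sB) low {sA sB pij pi_}.
have Qq : q / p0 ^+ 2 <= expR (dl ^+ 2 / 16 * b ^+ 2).
  rewrite ler_pdivrMr ?exprn_gt0// /p0 exprMn -expRM_natl.
  rewrite -[in X in _ <= _ * (X * _)](lnK (_ : c0 \in Num.pos)) ?posrE//.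
  rewrite -expRM_natl -!expRD /q ler_expR.
  have E : r ^+ 2 / (v * (1 + dl ^+ 2 / 32)) =
      ((1 - dl) * b) ^+ 2 / (1 + dl ^+ 2 / 32).
    by rewrite /r -sv; field; rewrite !gt_eqF//; lra.
  rewrite E.
  have h : ((1 - dl) * b) ^+ 2 * (1 - dl ^+ 2 / 32) <=
      ((1 - dl) * b) ^+ 2 / (1 + dl ^+ 2 / 32).
    rewrite ler_wpM2l ?sqr_ge0// -[X in _ <= X]mul1r ler_pdivlMr; last by lra.
    have := sqr_ge0 (dl ^+ 2 / 32); nra.
  have h' : ((1 - dl) * b) ^+ 2 <= b ^+ 2.
    by rewrite lerXn2r ?nnegrE//; nra.
  nra.
have h1 : (2 * expR (dl ^+ 2 / 16 * b ^+ 2))^-1 <= A ^+ 2 / (A + N.+1%:R ^+ 2 * q).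
  rewrite -[leRHS]invrK lef_pV2 ?posrE ?mulr_gt0 ?expR_gt0//; last first.
    by rewrite !invr_gt0 divr_gt0 ?exprn_gt0//; lra.
  rewrite invf_div mulrDl.
  have -> : N.+1%:R ^+ 2 * q / A ^+ 2 = q / p0 ^+ 2.
    by rewrite /A; field; rewrite gt_eqF//= pnatr_eq0.
  have -> : A / A ^+ 2 = A^-1 by field; rewrite gt_eqF.
  have : A^-1 <= 1 by rewrite invf_le1.
  have : 1 <= expR (dl ^+ 2 / 16 * b ^+ 2).
    by rewrite -[X in X <= _]expR0 ler_expR mulr_ge0 ?sqr_ge0// divr_ge0 ?sqr_ge0.
  lra.
(* Then the damping is at least 1 - dl, and (1 - dl)^2 >= 1 - 2 dl leaves a margin of dl above the
   level 1 - 3 dl. *)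
have [k k0 hk] : exists2 k, (0 < k)%N & 2 / k%:R <= dl.
  exists (Num.trunc (2 / dl)).+1 => //.
  have h : 2 / dl < (Num.trunc (2 / dl)).+1%:R by exact: truncnS_gt.
  by rewrite ler_pdivrMr// mulrC -ler_pdivrMr// ltW.
have ck := cos_rot_step_pow_ge R k0.
set C := cos _ ^+ k in ck.
have Cr : (1 - 2 * dl) * s * b <= C * r.
  rewrite /r !mulrA !ler_wpM2r ?(ltW b0) ?(ltW s0)//; nra.
have vK i : var P (xi i) <= v by rewrite vv.
have m0 : (1 - 3 * dl) * s * b <= C * r.
  by apply: le_trans Cr; rewrite !ler_wpM2r ?(ltW b0) ?(ltW s0)//; lra.
have conc := concentration gxi v0 vK k0 m0.
rewrite -/C in conc.
set m := (1 - 3 * dl) * s * b in conc *.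
have sb : dl * s * b <= C * r - m by rewrite /m; lra.
have {}conc : pr P [set w | exists i, r <= xi i w] *
    pr P [set w | forall i, xi i w <= m] <= expR (- (dl ^+ 2 / 8 * b ^+ 2)).
  apply: (le_trans conc); rewrite ler_expR lerN2 ler_pdivlMr ?mulr_gt0//.
  rewrite (_ : _ * (8 * v) = (dl * s * b) ^+ 2); last by rewrite -sv; field.
  by rewrite lerXn2r ?nnegrE//; [rewrite !mulr_ge0// ltW|apply: le_trans sb; rewrite !mulr_ge0// ltW].
have low2 : (2 * expR (dl ^+ 2 / 16 * b ^+ 2))^-1 <=
    pr P [set w | exists i, r <= xi i w].
  apply: (le_trans h1); apply: (le_trans low); apply: pr_le.
  - rewrite (_ : [set w | _] = \bigcup_i [set w | r < xi i w]).
      by apply: fin_bigcup_measurable => // i _; exact: mB.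
    by apply/seteqP; split => w /= [i]; [exists i|move=> _; exists i].
  - rewrite (_ : [set w | _] = \bigcup_i [set w | r <= xi i w]).
      by apply: fin_bigcup_measurable => // i _; apply: measurable_ge; exact: cg_measurable (gi i).
    by apply/seteqP; split => w /= [i]; [exists i|move=> _; exists i].
  - by move=> w [i /= ri]; exists i; exact: ltW.
set y := pr P [set w | forall i, _] in conc *.
have y0 : 0 <= y by exact: pr_ge0.
have := ler_wpM2r y0 low2 => /le_trans /(_ conc).
rewrite -ler_pdivlMl ?invr_gt0 ?mulr_gt0 ?expR_gt0// invrK.
rewrite -[2 * _ * _]mulrA -expRD => /le_trans; apply.
by rewrite ler_wpM2l// ler_expR; lra.
Qed.

End MaxLower.

(** * Dyadic blocks and Borel-Cantelli *)

Section SeparatedSubset.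

Lemma sum_count_classes (I : Type) (J : finType) (rho : I -> J) (s : seq I) :
  (\sum_(c : J) count (fun i => rho i == c) s)%N = size s.
Proof.
elim: s => [|i s ih] /=; first by rewrite big1.
rewrite big_split/= ih (bigD1 (rho i))//= eqxx big1// => c.
by rewrite eq_sym => /negbTE ->.
Qed.

Lemma pigeonhole (I : choiceType) (J : finType) (rho : I -> J) (S : {fset I})
  (c0 : J) : exists c : J, (#|` S| <= #|J| * #|` [fset t in S | rho t == c]%fset|)%N.
Proof.
have E c : #|` [fset t in S | rho t == c]%fset| = count (fun i => rho i == c) (enum_fset S).
  rewrite card_fset_sum1 -size_filter; transitivity (size [seq t <- enum_fset S | rho t == c]).
    rewrite -card_fset_sum1; apply/perm_size/uniq_perm => //.
      by rewrite filter_uniq.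
    by move=> t; rewrite !inE/= mem_filter andbC.
  by [].
exists [arg max_(c > c0) count (fun i => rho i == c) (enum_fset S)]%N.
case: arg_maxnP => // c _ cmax; rewrite E.
rewrite -(sum_count_classes rho (enum_fset S)) -sum_nat_const.
by apply: leq_sum => c' _; exact: cmax.
Qed.

(* Two distinct points in the same residue class modulo [L] are at distance at
   least [L]. *)
Lemma separated_subset (m L : nat) (S : {fset Zm m}) :
  exists S' : {fset Zm m}, [/\ (S' `<=` S)%fset,
    forall t s, t \in S' -> s \in S' -> t != s -> (L < dist_inf t s)%N &
    (#|` S| <= L.+1 ^ m * #|` S'|)%N].
Proof.
pose rho (t : Zm m) : {ffun 'I_m -> 'I_L.+1} :=
  [ffun k => inord `|(t k %% L.+1%:Z)%Z|%N].
have [c hc] := pigeonhole rho S [ffun=> ord0].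
exists [fset t in S | rho t == c]%fset; split.
- by apply/fsubsetP => t; rewrite !inE => /andP[].
- move=> t s; rewrite !inE/= => /andP[_ /eqP tc] /andP[_ /eqP sc] ts.
  have [k tsk] : exists k, t k != s k.
    apply/existsP; apply: contraNT ts; rewrite negb_exists => /forallP h.
    by apply/eqP/ffunP => k; have := h k; rewrite negbK => /eqP.
  have modE (x : int) : (`|(x %% L.+1%:Z)%Z| < L.+1)%N.
    by rewrite -ltz_nat gez0_abs ?modz_ge0// ltz_mod.
  have : rho t k = rho s k by rewrite tc sc.
  rewrite !ffunE => /(congr1 (@nat_of_ord _)); rewrite !inordK//.
  move=> /(congr1 Posz); rewrite !gez0_abs ?modz_ge0// => /eqP.
  rewrite eqz_mod_dvd => dv.
  apply: leq_trans (leq_bigmax k); apply: dvdn_leq => //.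
  by rewrite absz_gt0 subr_eq0.
- by move: hc; rewrite card_ffun !card_ord.
Qed.

End SeparatedSubset.

Section DyadicBlocks.

(** [L k] is the first [T n] with at least 2^k points, [U k] the last one before 2^(k+1) points are
    reached. Each scale thus contributes a single event to Borel-Cantelli, even when the cardinality
    jumps over the block. *)
Lemma dyadic_blocks (I : choiceType) (T : nat -> {fset I}) :
  (forall n, (T n `<=` T n.+1)%fset) ->
  (forall M : nat, exists N, forall n, (N <= n)%N -> (M <= #|` T n|)%N) ->
  exists L U : nat -> {fset I}, forall k,
    [/\ (2 ^ k <= #|` L k|)%N, (#|` U k| <= 2 ^ k.+1)%N &
      forall n, (2 ^ k <= #|` T n| < 2 ^ k.+1)%N ->
        (L k `<=` T n)%fset /\ (T n `<=` U k)%fset].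
Proof.
move=> Tinc Tcard.
have Tmono : forall a b, (a <= b)%N -> (T a `<=` T b)%fset.
  move=> a b ab; rewrite -(subnK ab); elim: (b - a)%N => [|c ih]; first by rewrite add0n.
  by rewrite addSn; exact: fsubset_trans ih (Tinc _).
suff h k : exists LU : {fset I} * {fset I},
    [/\ (2 ^ k <= #|` LU.1|)%N, (#|` LU.2| <= 2 ^ k.+1)%N &
      forall n, (2 ^ k <= #|` T n| < 2 ^ k.+1)%N ->
        (LU.1 `<=` T n)%fset /\ (T n `<=` LU.2)%fset].
  have [F hF] := choice h.
  by exists (fun k => (F k).1), (fun k => (F k).2).
have exL : exists n, (2 ^ k <= #|` T n|)%N.
  by have [N hN] := Tcard (2 ^ k)%N; exists N; exact: hN.
have exU : exists n, (2 ^ k.+1 <= #|` T n|)%N.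
  by have [N hN] := Tcard (2 ^ k.+1)%N; exists N; exact: hN.
case: (ex_minnP exL) => a aL amin; case: (ex_minnP exU) => b bU bmin.
(* If [T 0] already has 2^(k+1) points, no [n] belongs to the block and [fset0] serves. *)
exists (T a, if b is b'.+1 then T b' else fset0); split => //=.
- case: b bU bmin => [|b] bU bmin; first by rewrite cardfs0.
  by rewrite leqNgt; apply/negP => /ltnW /bmin; rewrite ltnn.
- move=> n /andP[n1 n2]; split; first by apply: Tmono; exact: amin.
  have nb : (n < b)%N.
    rewrite ltnNge; apply/negP => /Tmono /fsubset_leq_card.
    by rewrite leqNgt (leq_trans n2 bU).
  by case: b nb {bU bmin} => // b nb; exact: Tmono.
Qed.

Lemma dyadic_scale (I : choiceType) (T : nat -> {fset I}) :
  (forall M : nat, exists N, forall n, (N <= n)%N -> (M <= #|` T n|)%N) ->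
  forall k0, exists n0, forall n, (n0 <= n)%N ->
    exists2 k, (k0 <= k)%N & (2 ^ k <= #|` T n| < 2 ^ k.+1)%N.
Proof.
move=> Tcard k0; have [N hN] := Tcard (2 ^ k0)%N; exists N => n /hN hn.
have n0 : (0 < #|` T n|)%N by apply: leq_trans hn; rewrite expn_gt0.
exists (trunc_log 2 #|` T n|); last by rewrite trunc_logP//= trunc_log_ltn.
exact: trunc_log_max.
Qed.

End DyadicBlocks.

(** * Borel-Cantelli with geometric bounds *)

Section BorelCantelli.
Context d (T : measurableType d) (R : realType) (P : probability T R).

Lemma geometric_sum_le (rho : R) n : 0 <= rho -> rho < 1 ->
  \sum_(0 <= k < n) rho ^+ k <= (1 - rho)^-1.
Proof.
move=> r0 r1; have d0 : 0 < 1 - rho by lra.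
rewrite -[X in _ <= X]mul1r ler_pdivlMr// mulrC.
have -> : (1 - rho) * \sum_(0 <= i < n) rho ^+ i = 1 - rho ^+ n.
  rewrite big_mkord -opprB mulNr -subrX1 opprB//.
by rewrite lerBlDr lerDl exprn_ge0.
Qed.

Lemma ae_eventually_not (F : nat -> set T) (C rho : R) (k1 : nat) :
  (forall k, measurable (F k)) -> 0 <= rho -> rho < 1 ->
  (forall k, (k1 <= k)%N -> pr P (F k) <= C * rho ^+ k) ->
  {ae P, forall w, exists k0, forall k, (k0 <= k)%N -> ~ F k w}.
Proof.
move=> mF r0 r1 hF.
pose G k := F (k + k1)%N.
have mG k : measurable (G k) by exact: mF.
have C0 : 0 <= `|C| by [].
have hG k : pr P (G k) <= `|C| * rho ^+ k.
  apply: le_trans (hF _ (leq_addl _ _)) _.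
  apply: (@le_trans _ _ (`|C| * rho ^+ (k + k1))).
    by rewrite ler_wpM2r ?exprn_ge0// ler_norm.
  by rewrite ler_wpM2l// exprD ler_piMr ?exprn_ge0// exprn_ile1// ltW.
have sG : (\sum_(k <oo) P (G k) < +oo)%E.
  apply: (@le_lt_trans _ _ (`|C| * (1 - rho)^-1)%:E); last by rewrite ltry.
  apply: lime_le; first by apply: is_cvg_nneseries.
  apply: nearW => n.
  rewrite (eq_bigr (fun k => (pr P (G k))%:E)); last by move=> k _; exact: prE.
  rewrite sumEFin lee_fin.
  apply: (@le_trans _ _ (\sum_(0 <= k < n) `|C| * rho ^+ k)).
    by apply: ler_sum => k _.
  by rewrite -mulr_sumr ler_wpM2l// geometric_sum_le.
have L0 := lim_sup_set_cvg0 mG sG.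
exists (lim_sup_set G); split => //.
  apply: bigcapT_measurable => n; apply: bigcup_measurable => k _; exact: mG.
move=> w /= nw n _ /=; apply: contrapT => h; apply: nw.
exists (n + k1)%N => k nk Fk; apply: h; exists (k - k1)%N => /=.
  by rewrite leq_subRL ?(leq_trans (leq_addl _ _) nk)// addnC.
by rewrite /G subnK// (leq_trans (leq_addl _ _) nk).
Qed.

End BorelCantelli.

Section Scale.
Context (R : realType).
Implicit Types x y : R.

Lemma bfun_gt0 x : 0 < bfun x.
Proof.
by rewrite sqrtr_gt0 mulr_gt0// ln_gt0// lt_max [X in _ || X]ltr1n orbT.
Qed.

Lemma bfun_le x y : x <= y -> bfun x <= bfun y.
Proof.
move=> xy; have p z : 0 < Num.max z (2 : R) by rewrite lt_max ltr0n orbT.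
rewrite ler_wsqrtr// ler_wpM2l// ler_ln ?posrE//.
by rewrite ge_max !le_max xy lexx orbT.
Qed.

Definition bdyad k : R := bfun (2 ^ k)%:R.

(** [k = 0] is excluded because the cut-off at 2 in [bfun] acts there. *)
Lemma bdyad_sqr k : (0 < k)%N -> bdyad k ^+ 2 = 2 * (k%:R * ln 2).
Proof.
move=> k0; have h : (2 : R) <= (2 ^ k)%:R.
  by rewrite ler_nat -{1}(expn1 2) leq_exp2l.
have l2 : 0 <= ln (2 : R) by rewrite ln_ge0// ler1n.
rewrite /bdyad /bfun max_l// natrX lnXn// sqr_sqrtr; first by rewrite -[ln 2 *+ k]mulr_natl.
by rewrite mulr_ge0// mulrn_wge0.
Qed.

Lemma ln2_gt0 : 0 < ln (2 : R).
Proof. by rewrite ln_gt0// ltr1n. Qed.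

Lemma expR_bdyad k (c : R) : (0 < k)%N ->
  expR (- (c * bdyad k ^+ 2)) = expR (- (2 * c * ln 2)) ^+ k.
Proof.
by move=> k0; rewrite bdyad_sqr// -expRM_natl; congr expR; ring.
Qed.

Lemma expR_bdyad_half k : (0 < k)%N -> expR (bdyad k ^+ 2 / 2) = 2 ^+ k.
Proof.
move=> k0; have -> : (2 : R) ^+ k = expR (ln 2) ^+ k by rewrite lnK ?posrE.
by rewrite bdyad_sqr// -expRM_natl; congr expR; field.
Qed.

Lemma bdyad_cvgy (M : R) : exists k0, forall k, (k0 <= k)%N -> M <= bdyad k.
Proof.
have l2 := ln2_gt0.
exists (Num.trunc (M ^+ 2 / (2 * ln 2))).+1 => k hk.
have k0 : (0 < k)%N by exact: leq_trans hk.
have [M0|M0] := ltP M 0; first by apply: ltW; apply: lt_trans M0 (bfun_gt0 _).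
have b0 : 0 < bdyad k := bfun_gt0 _.
rewrite -(@ler_pXn2r _ 2)// ?nnegrE ?(ltW b0)// bdyad_sqr//.
have h : M ^+ 2 / (2 * ln 2) <= k%:R.
  apply: ltW; apply: lt_le_trans (truncnS_gt _) _; by rewrite ler_nat.
move: h; rewrite ler_pdivrMr ?mulr_gt0//; lra.
Qed.

Lemma bdyad_succ (dl : R) : 0 < dl -> exists k0, forall k, (k0 <= k)%N ->
  bdyad k.+1 <= (1 + dl) * bdyad k.
Proof.
move=> d0; have l2 := ln2_gt0.
exists (Num.trunc (1 / dl)).+1 => k hk.
have k0 : (0 < k)%N by exact: leq_trans hk.
have b0 j : 0 < bdyad j := bfun_gt0 _.
rewrite -(@ler_pXn2r _ 2)// ?nnegrE ?mulr_ge0 ?(ltW (b0 _))//; last by lra.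
rewrite exprMn !bdyad_sqr//.
have h : 1 / dl <= k%:R.
  apply: ltW; apply: lt_le_trans (truncnS_gt _) _; by rewrite ler_nat.
have {}h : 1 <= dl * k%:R by move: h; rewrite ler_pdivrMr// mulrC.
have kR : (0 : R) < k%:R by rewrite ltr0n.
have h2 : k.+1%:R <= (1 + dl) ^+ 2 * k%:R :> R.
  rewrite -natr1; have : 0 <= dl ^+ 2 * k%:R by rewrite mulr_ge0 ?sqr_ge0// ltW.
  nra.
have := ler_wpM2r (ltW l2) h2; lra.
Qed.

End Scale.

Lemma var_law d (T : measurableType d) (R : realType) (P : probability T R)
    (Y Z : T -> R) : measurable_fun setT Y -> measurable_fun setT Z ->
  (forall A : set R, measurable A -> P (Y @^-1` A) = P (Z @^-1` A)) ->
  var P Y = var P Z.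
Proof.
move=> mY mZ YZ.
have mZ' : measurable_fun setT (Z : T -> measurableTypeR R).
  by move=> _ A mA; exact: mZ.
pose mZb := isMeasurableFun.Build _ _ _ _ _ mZ'.
pose Z' : {mfun T >-> measurableTypeR R} := HB.pack (Z : T -> measurableTypeR R) mZb.
pose nu : {measure set (measurableTypeR R) -> \bar R} := distribution P Z'.
have mg : measurable_fun setT (fun x : measurableTypeR R => ((x : R) ^+ 2)%:E).
  by apply/measurable_EFinP; exact: measurable_funX.
have g0 (x : measurableTypeR R) : (0 <= ((x : R) ^+ 2)%:E)%E.
  by rewrite lee_fin sqr_ge0.
rewrite /var /Rintegral; congr fine.
have hY (A : set (measurableTypeR R)) : measurable A -> P (Y @^-1` A) = nu A by exact: YZ.
have hZ (A : set (measurableTypeR R)) : measurable A -> P (Z @^-1` A) = nu A by [].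
by rewrite (ge0_integral_law mY hY mg g0) (ge0_integral_law mZ hZ mg g0).
Qed.

(** * Support functions of the hulls *)

Section Dual.
Context (R : realType) (B : normedModType R).
Implicit Types (f g : B -> R) (x y : B).

Lemma dualD f : dual B f -> forall x y, f (x + y) = f x + f y.
Proof. by move=> [lf _] x y; have := lf 1 x y; rewrite scale1r mul1r. Qed.

Lemma dual0 f : dual B f -> f 0 = 0.
Proof.
by move=> /dualD /(_ 0 0); rewrite addr0 => /esym/eqP; rewrite -subr_eq0 addrK => /eqP.
Qed.

Lemma dualZ f : dual B f -> forall a x, f (a *: x) = a * f x.
Proof.
move=> df a x; have [lf _] := df.
by have := lf a x 0; rewrite addr0 (dual0 df) addr0.
Qed.

Lemma dualN f : dual B f -> forall x, f (- x) = - f x.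
Proof. by move=> df x; rewrite -scaleN1r (dualZ df) mulN1r. Qed.

Lemma dualB f : dual B f -> forall x y, f (x - y) = f x - f y.
Proof. by move=> df x y; rewrite (dualD df) (dualN df). Qed.

Lemma dual_sum f : dual B f -> forall (I : Type) (s : seq I) (F : I -> B),
  f (\sum_(i <- s) F i) = \sum_(i <- s) f (F i).
Proof.
move=> df I s F; elim: s => [|i s ih]; first by rewrite !big_nil (dual0 df).
by rewrite !big_cons (dualD df) ih.
Qed.

Lemma dual_scale a f : dual B f -> dual B (fun x => a * f x).
Proof.
move=> df; have [lf cf] := df; split; first by move=> b x y; rewrite lf; ring.
by move=> x; apply: cvgM; [exact: cvg_cst|exact: cf].
Qed.

Lemma dual_add f g : dual B f -> dual B g -> dual B (fun x => f x + g x).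
Proof.
move=> [lf cf] [lg cg]; split; first by move=> b x y; rewrite lf lg; ring.
by move=> x; apply: cvgD; [exact: cf|exact: cg].
Qed.

End Dual.

Lemma nat_pow_geometric (R : realType) (rho C : R) (k : nat) :
  (2 ^ k.+1)%:R * (C * rho ^+ k) = 2 * C * (2 * rho) ^+ k.
Proof. by rewrite expnS natrM natrX exprMn; ring. Qed.

(** * Almost sure growth of one functional along the process *)

Section Process.
Context (R : realType) (B : normedModType R) (d : measure_display)
  (Om : measurableType d) (P : probability Om R) (m : nat) (X : Zm m -> Om -> B)
  (T : nat -> {fset Zm m}).
Hypothesis gX : forall s : seq (Zm m * (B -> R)), (forall p, p \in s -> dual B p.2) ->
  centered_gaussian P (fun w => \sum_(p <- s) p.2 (X p.1 w)).
Hypothesis lawX : forall t t' C, cylinder_sigma B C ->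
  P (X t @^-1` C) = P (X t' @^-1` C).
Hypothesis Tinc : forall n, (T n `<=` T n.+1)%fset.
Hypothesis Tcard :
  forall M : nat, exists N, forall n, (N <= n)%N -> (M <= #|` T n|)%N.

Let bT n : R := bfun (#|` T n|)%:R.

(** Union bound over the at most 2^(k+1) points of [U k], each of probability at most C 2^(-gam k):
    the bound is geometric of ratio 2^(1 - gam), whence the threshold [1 < gam]. Monotonicity in the
    level passes from the scale 2^k to the actual cardinality of [T n]. *)
Lemma eventually_not_any (A : Zm m -> R -> set Om) (C gam b1 : R) :
  1 < gam -> 0 <= C ->
  (forall t b, measurable (A t b)) ->
  (forall t b b', b <= b' -> A t b' `<=` A t b) ->
  (forall t b, b1 <= b -> pr P (A t b) <= C * expR (- (gam / 2 * b ^+ 2))) ->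
  {ae P, forall w, exists n0, forall n, (n0 <= n)%N ->
    forall t, t \in T n -> ~ A t (bT n) w}.
Proof.
move=> g1 C0 mA Amono hA.
have [L [U LU]] := dyadic_blocks Tinc Tcard.
pose F k := \big[setU/set0]_(t <- enum_fset (U k)) A t (bdyad R k).
have mF k : measurable (F k) by apply: bigsetU_measurable.
have l2 := ln2_gt0 R.
pose rho : R := expR (- (2 * (gam / 2) * ln 2)).
have r2 : 2 * rho < 1.
  rewrite /rho -[X in X * _]lnK ?posrE// -expRD expR_lt1; nra.
have r0 : 0 <= 2 * rho by rewrite mulr_ge0// expR_ge0.
have [k1 hk1] := bdyad_cvgy b1.
have hF k : (maxn k1 1 <= k)%N -> pr P (F k) <= 2 * C * (2 * rho) ^+ k.
  rewrite geq_max => /andP[k1k k0].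
  apply: (le_trans (@pr_bigcup_fin_le _ _ _ P _ (enum_fset (U k))
    (fun t => A t (bdyad R k)) (fun t => mA t _))).
  apply: (@le_trans _ _ (\sum_(t <- enum_fset (U k)) C * rho ^+ k)).
    apply: ler_sum => t _; rewrite /rho -expR_bdyad//; apply: hA; exact: hk1.
  apply: (@le_trans _ _ ((2 ^ k.+1)%:R * (C * rho ^+ k))); last by rewrite nat_pow_geometric.
  rewrite big_const_seq count_predT iter_addr addr0 -[X in X <= _]mulr_natl.
  rewrite ler_wpM2r ?mulr_ge0 ?exprn_ge0 ?expR_ge0// ler_nat.
  by have [_ ? _] := LU k.
have := ae_eventually_not mF r0 r2 hF.
apply: filterS => w [k0 hk0].
have [n0 hn0] := dyadic_scale Tcard k0.
exists n0 => n nn0 t tTn Aw; have [k k0k /andP[n1 n2]] := hn0 _ nn0.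
apply: (hk0 _ k0k); rewrite /F -bigcup_seq; exists t => /=.
  have [_ _ /(_ n)] := LU k; rewrite n1 n2 => /(_ isT)[_ /fsubsetP]; exact.
apply: Amono Aw; rewrite /bT /bdyad; apply: bfun_le.
by rewrite ler_nat.
Qed.

Lemma functional_gaussian f t : dual B f -> centered_gaussian P (fun w => f (X t w)).
Proof.
move=> df; have := gX (s := [:: (t, f)]).
have -> : (fun w => \sum_(p <- [:: (t, f)]) p.2 (X p.1 w)) = fun w => f (X t w).
  by apply/funext => w; rewrite big_seq1.
by apply => p; rewrite inE => /eqP ->.
Qed.

Lemma functional_measurable f t : dual B f -> measurable_fun setT (fun w => f (X t w)).
Proof. by move=> df; exact: cg_measurable (functional_gaussian t df). Qed.

Lemma functional_var f t t' : dual B f ->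
  var P (fun w => f (X t w)) = var P (fun w => f (X t' w)).
Proof.
move=> df; apply: var_law; [exact: functional_measurable..|].
move=> A mA; apply: (lawX t t' (C := f @^-1` A)).
by apply: sub_sigma_algebra; exists f, A.
Qed.

Variable t0 : Zm m.

Definition sd f : R := Num.sqrt (var P (fun w => f (X t0 w))).

Lemma sd_ge0 f : 0 <= sd f. Proof. exact: sqrtr_ge0. Qed.

Lemma sd_sqr f : sd f ^+ 2 = var P (fun w => f (X t0 w)).
Proof. by rewrite sqr_sqrtr// var_ge0. Qed.

Lemma functional_upper f (e : R) : dual B f -> 0 < e ->
  {ae P, forall w, exists n0, forall n, (n0 <= n)%N ->
    forall t, t \in T n -> f (X t w) <= (sd f + e) * bT n}.
Proof.
move=> df e0; have s0 := sd_ge0 f.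
(* Half of [e] inflates the variance: [K] stays positive when [sd f] is 0, and [gam] still exceeds
   1. *)
pose K := (sd f + e / 2) ^+ 2.
have K0 : 0 < K by rewrite exprn_gt0//; lra.
pose gam := (sd f + e) ^+ 2 / K.
have g1 : 1 < gam by rewrite ltr_pdivlMr// mul1r /K ltrXn2r ?nnegrE//; lra.
have := @eventually_not_any
  (fun t b => [set w | (sd f + e) * Num.max 0 b < f (X t w)]) 1 gam 0 g1 ler01.
have mA t b : measurable [set w | (sd f + e) * Num.max 0 b < f (X t w)].
  by apply: measurable_gt; exact: functional_measurable.
have mono t b b' : b <= b' -> [set w | (sd f + e) * Num.max 0 b' < f (X t w)] `<=`
    [set w | (sd f + e) * Num.max 0 b < f (X t w)].
  move=> bb w /=; apply: le_lt_trans; rewrite ler_wpM2l//; first by lra.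
  by rewrite ge_max !le_max lexx bb orbT.
have tail t b : 0 <= b -> pr P [set w | (sd f + e) * Num.max 0 b < f (X t w)] <=
    1 * expR (- (gam / 2 * b ^+ 2)).
  move=> b0; rewrite mul1r (max_r b0).
  have gt_ := functional_gaussian t df.
  have x0 : 0 <= (sd f + e) * b by rewrite mulr_ge0//; lra.
  have vK : var P (fun w => f (X t w)) <= K.
    rewrite (functional_var t t0 df) -sd_sqr lerXn2r ?nnegrE//; lra.
  have := cg_tail gt_ K0 vK x0.
  rewrite (_ : ((sd f + e) * b) ^+ 2 / (2 * K) = gam / 2 * b ^+ 2); last first.
    by rewrite /gam; field; rewrite gt_eqF.
  apply: le_trans; apply: pr_le.
  - by apply: measurable_gt; exact: functional_measurable.
  - by apply: measurable_ge; exact: functional_measurable.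
  - by move=> w /= /ltW.
move=> /(_ mA mono tail); apply: filterS => w [n0 hn0]; exists n0 => n nn0 t tT.
have := hn0 n nn0 t tT => /=; rewrite max_r; last exact: ltW (bfun_gt0 _).
by move=> /negP; rewrite -leNgt.
Qed.

Hypothesis covX : forall f, dual B f -> forall e : R, 0 < e -> exists N : nat,
  forall t s, (N <= dist_inf t s)%N ->
    (`| 'E_P[fun w => (f (X t w) * f (X s w))%R] | <= e%:E)%E.

(** The large value is sought in [S k], inside the smallest set of the block, so that it is present
    in [T n] for every [n] of the block. *)
Lemma functional_lower_pos f (dl : R) : dual B f -> 0 < sd f -> 0 < dl -> dl < 1 / 4 ->
  {ae P, forall w, exists n0, forall n, (n0 <= n)%N ->
    exists2 t, t \in T n & (1 - 4 * dl) * sd f * bT n <= f (X t w)}.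
Proof.
move=> df s0 dl0 dl4; pose v := sd f ^+ 2.
have v0 : 0 < v by rewrite exprn_gt0.
have vE t : var P (fun w => f (X t w)) = v.
  by rewrite (functional_var t t0 df) -sd_sqr.
(* As a covariance bound this keeps the variance of the sum of two separated terms below 2 v (1 +
   dl^2 / 32). *)
have ev : 0 < v * (dl ^+ 2 / 32) by rewrite mulr_gt0// divr_gt0// exprn_gt0.
have [N hN] := covX df ev.
have [L [U LU]] := dyadic_blocks Tinc Tcard.
have /choice[S hS] k : exists S' : {fset Zm m}, [/\ (S' `<=` L k)%fset,
    forall t s, t \in S' -> s \in S' -> t != s -> (N < dist_inf t s)%N &
    (#|` L k| <= N.+1 ^ m * #|` S'|)%N] by exact: separated_subset.
pose c1 : R := ((N.+1 ^ m)%:R)^-1.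
have Nm0 : (0 : R) < (N.+1 ^ m)%:R by rewrite ltr0n expn_gt0.
have c10 : 0 < c1 by rewrite invr_gt0.
have dl1 : dl < 1 by lra.
have [b0 b00 hb] := gaussian_max_lower dl0 dl1 c10.
pose F k := \big[setI/setT]_(t <- enum_fset (S k))
  [set w | f (X t w) <= (1 - 3 * dl) * sd f * bdyad R k].
have mF k : measurable (F k).
  apply: bigsetI_measurable => t _; apply: measurable_le.
  exact: functional_measurable.
have l2 := ln2_gt0 R.
pose rho : R := expR (- (2 * (dl ^+ 2 / 16) * ln 2)).
have r1 : rho < 1.
  by rewrite expR_lt1 oppr_lt0 !mulr_gt0// ?divr_gt0 ?exprn_gt0.
have r0 : 0 <= rho by exact: expR_ge0.
have [k1 hk1] := bdyad_cvgy b0.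
have hF k : (maxn k1 1 <= k)%N -> pr P (F k) <= 2 * rho ^+ k.
  rewrite geq_max => /andP[k1k k0].
  have [SL Ssep Scard] := hS k; have [L2k _ _] := LU k.
  have S0 : (0 < #|` S k|)%N.
    rewrite lt0n; apply/eqP => SE; move: Scard; rewrite SE muln0 leqn0 => /eqP LE.
    by move: L2k; rewrite LE leqn0 expn_eq0.
  pose M := #|` S k|.-1; have ME : M.+1 = size (enum_fset (S k)) by rewrite prednK.
  pose tt (i : 'I_M.+1) := nth t0 (enum_fset (S k)) i.
  have ttS i : tt i \in S k by rewrite mem_nth// -ME.
  have tti i j : i != j -> tt i != tt j.
    by move=> ij; rewrite nth_uniq -?ME ?fset_uniq.
  pose xi i w := f (X (tt i) w).
  have gxi (c : 'I_M.+1 -> R) : centered_gaussian P (fun w => \sum_i c i * xi i w).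
    have := gX (s := [seq (tt i, fun x => c i * f x) | i <- enum 'I_M.+1]).
    have -> : (fun w => \sum_(p <- [seq (tt i, fun x => c i * f x) | i <- enum 'I_M.+1])
        p.2 (X p.1 w)) = fun w => \sum_i c i * xi i w.
      by apply/funext => w; rewrite big_map big_enum.
    by apply => p /mapP[i _ ->]; exact: dual_scale.
  have cv i j : i != j -> var P (fun w => xi i w + xi j w) <=
      2 * v * (1 + dl ^+ 2 / 32).
    move=> ij; have dij := Ssep _ _ (ttS i) (ttS j) (tti _ _ ij).
    have L2i i' : P.-integrable setT (EFin \o (fun w => xi i' w ^+ 2)).
      exact: cg_L2 (functional_gaussian _ df).
    have iij : P.-integrable setT (EFin \o (fun w => xi i w * xi j w)).
      apply: (L1_le _ _ (L1D (L2i i) (L2i j))).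
        by apply: measurable_funM; exact: functional_measurable.
      move=> w; rewrite ler_norml.
      have := sqr_ge0 (xi i w + xi j w); have := sqr_ge0 (xi i w - xi j w).
      have := sqr_ge0 (xi i w); have := sqr_ge0 (xi j w).
      by move=> ? ? ? ?; apply/andP; split; nra.
    have := hN _ _ (ltnW dij); rewrite unlock.
    rewrite -[X in (`| X | <= _)%E]fineK; last exact: integrable_fin_num iij.
    rewrite /= lee_fin -/(Rintegral P setT (fun w => xi i w * xi j w)).
    move=> /(le_trans (ler_norm _)) cov.
    have -> : var P (fun w => xi i w + xi j w) =
        var P (xi i) + (2 * \int[P]_w (xi i w * xi j w) + var P (xi j)).
      rewrite /var -RintegralZl// -RintegralD//; last exact: L1Z.
      rewrite -RintegralD//; last by apply: L1D => //; exact: L1Z.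
      by apply: eq_Rintegral => w _; ring.
    by rewrite /xi !vE; lra.
  have cM : c1 * expR (bdyad R k ^+ 2 / 2) <= M.+1%:R.
    rewrite expR_bdyad_half// /c1 -natrX mulrC ler_pdivrMr// -natrM ler_nat.
    by rewrite ME mulnC; exact: leq_trans L2k Scard.
  have := hb _ (hk1 _ k1k) _ _ P M xi v gxi v0 (fun i => vE (tt i)) cv cM.
  rewrite /v sqrtr_sqr (ger0_norm (ltW s0)) expR_bdyad//.
  apply: le_trans; apply: pr_le => //.
    rewrite (_ : [set w | _] = \bigcap_i [set w | xi i w <= (1 - 3 * dl) * sd f * bdyad R k]).
      apply: fin_bigcap_measurable => // i _; apply: measurable_le.
      exact: functional_measurable.
    by apply/seteqP; split => w /= h i => [_|]; exact: h.
  move=> w; rewrite /F -bigcap_seq => h i; apply: h => /=; exact: ttS.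
have := ae_eventually_not mF r0 r1 hF.
apply: filterS => w [k0 hk0].
have [k2 hk2] := bdyad_succ dl0.
have [n0 hn0] := dyadic_scale Tcard (maxn k0 k2).
exists n0 => n nn0; have [k] := hn0 _ nn0.
rewrite geq_max => /andP[k0k k2k] /andP[n1 n2].
have : ~ F k w by exact: hk0.
rewrite /F -bigcap_seq => /existsNP[t] /not_implyP[/= tS /negP].
rewrite -ltNge => ft; exists t.
  have [SL _ _] := hS k; have [_ _ /(_ n)] := LU k; rewrite n1 n2 => /(_ isT)[LT _].
  by move/fsubsetP: LT; apply; move/fsubsetP: SL; apply.
apply: ltW; apply: le_lt_trans ft.
have bb : bT n <= (1 + dl) * bdyad R k.
  apply: le_trans (hk2 _ k2k); rewrite /bT /bdyad; apply: bfun_le.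
  by rewrite ler_nat ltnW.
have bk : 0 < bdyad R k := bfun_gt0 _.
(* (1 - 4 dl)(1 + dl) <= 1 - 3 dl absorbs the growth of b inside the block. *)
apply: (@le_trans _ _ ((1 - 4 * dl) * sd f * ((1 + dl) * bdyad R k))).
  by rewrite ler_wpM2l// mulr_ge0; lra.
have : 0 <= dl ^+ 2 * (sd f * bdyad R k) by rewrite !mulr_ge0 ?sqr_ge0// ltW.
nra.
Qed.

Lemma functional_lower f (e : R) : dual B f -> 0 < e ->
  {ae P, forall w, exists n0, forall n, (n0 <= n)%N ->
    exists2 t, t \in T n & (sd f - e) * bT n <= f (X t w)}.
Proof.
move=> df e0; have := sd_ge0 f; rewrite le_eqVlt => /orP[/eqP s0|s0].
  (* For a degenerate functional any point of [T n] will do: the upper bound for [- f] already gives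
     f(X t) >= - e b. *)
  have dN : dual B (fun x => - 1 * f x) by exact: dual_scale.
  have sN : sd (fun x => - 1 * f x) = sd f.
    rewrite /sd /var; congr Num.sqrt; apply: eq_Rintegral => w _; ring.
  have := functional_upper dN e0; rewrite sN.
  apply: filterS => w [n0 hn0].
  have [n1 hn1] := Tcard 1.
  exists (maxn n0 n1) => n; rewrite geq_max => /andP[nn0 nn1].
  have : (0 < #|` T n|)%N by exact: hn1.
  rewrite cardfs_gt0 => /fset0Pn[t tT]; exists t => //.
  by have := hn0 n nn0 t tT; rewrite -s0; lra.
pose dl := Num.min (1 / 8) (e / (8 * sd f)).
have dl0 : 0 < dl by rewrite lt_min divr_gt0//= divr_gt0// mulr_gt0.
have dl4 : dl < 1 / 4 by rewrite gt_min; apply/orP; left; lra.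
have := functional_lower_pos df s0 dl0 dl4.
apply: filterS => w [n0 hn0]; exists n0 => n /hn0[t tT ft]; exists t => //.
apply: le_trans ft; rewrite ler_wpM2r//; first exact: ltW (bfun_gt0 _).
have : dl <= e / (8 * sd f) by rewrite ge_min lexx orbT.
rewrite ler_pdivlMr ?mulr_gt0//; nra.
Qed.

End Process.

(** * Hahn-Banach separation *)

Section HahnBanach.
Context (R : realType) (V : lmodType R).
Implicit Types (p q : V -> R) (x y : V).

Definition sublinear p := (forall x y, p (x + y) <= p x + p y) /\
  (forall a x, 0 < a -> p (a *: x) <= a * p x).

Lemma sublinear0 p : sublinear p -> p 0 = 0.
Proof.
move=> [pD pZ]; apply/eqP; rewrite eq_le; apply/andP; split.
  have := pZ (1 / 2) 0 ltac:(lra); rewrite scaler0; lra.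
by have := pD 0 0; rewrite addr0; lra.
Qed.

Lemma sublinearZ p a x : sublinear p -> 0 <= a -> p (a *: x) = a * p x.
Proof.
move=> sp; rewrite le_eqVlt => /orP[/eqP <-|a0].
  by rewrite scale0r mul0r sublinear0.
apply/eqP; rewrite eq_le sp.2//= -ler_pdivlMl//.
have := sp.2 a^-1 (a *: x); rewrite scalerA mulVf ?gt_eqF// scale1r.
by apply; rewrite invr_gt0.
Qed.

Lemma sublinear_geN p x : sublinear p -> - p (- x) <= p x.
Proof. by move=> sp; have := sp.1 x (- x); rewrite subrr sublinear0//; lra. Qed.

Lemma inf_le (A : set R) (m a : R) : (forall c, A c -> m <= c) -> A a -> inf A <= a.
Proof. by move=> mA Ax; apply: ge_inf => //; exists m. Qed.

Lemma le_inf_set (A : set R) (m : R) : A !=set0 -> (forall c, A c -> m <= c) ->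
  m <= inf A.
Proof. by move=> A0 mA; apply: lb_le_inf. Qed.

(** A sublinear functional below [q] whose value at [- y] is at most [- q y]. A minimal [q]
    coincides with it, which forces [q (- y) = - q y]. *)
Definition tighten q y x : R := inf [set q (x + a *: y) - a * q y | a in [set a | 0 <= a]].

Section Tighten.
Variables (q : V -> R) (y : V).
Hypothesis sq : sublinear q.

Lemma tighten_lb x c :
  [set q (x + a *: y) - a * q y | a in [set a | 0 <= a]] c -> - q (- x) <= c.
Proof.
move=> [a /= a0 <-]; have := sq.1 (x + a *: y) (- x).
by rewrite addrAC subrr add0r sublinearZ//; lra.
Qed.

Lemma tighten_le_at a x : 0 <= a -> tighten q y x <= q (x + a *: y) - a * q y.
Proof. by move=> a0; apply: inf_le (@tighten_lb x) _; exists a. Qed.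

Lemma tighten_le x : tighten q y x <= q x.
Proof. by have := @tighten_le_at 0 x (lexx _); rewrite scale0r addr0 mul0r subr0. Qed.

Lemma le_tighten m x : (forall a, 0 <= a -> m <= q (x + a *: y) - a * q y) ->
  m <= tighten q y x.
Proof.
move=> h; apply: le_inf_set; first by exists (q (x + 0 *: y) - 0 * q y); exists 0 => /=.
by move=> c [a a0 <-]; exact: h.
Qed.

Lemma tighten_sublinear : sublinear (tighten q y).
Proof.
split=> [x z|a x a0].
  rewrite -lerBlDr; apply: le_tighten => a a0; rewrite lerBlDr [X in _ <= X]addrC -lerBlDr.
  apply: le_tighten => b b0; rewrite lerBlDr.
  apply: (le_trans (tighten_le_at _ (addr_ge0 a0 b0))).
  have := sq.1 (x + a *: y) (z + b *: y).
  by rewrite addrACA -scalerDl; lra.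
rewrite -ler_pdivrMl//; apply: le_tighten => b b0; rewrite ler_pdivrMl//.
apply: (le_trans (tighten_le_at _ (mulr_ge0 (ltW a0) b0))).
by rewrite -scalerA -scalerDr sublinearZ ?(ltW a0)//; lra.
Qed.

Lemma tightenN : tighten q y (- y) <= - q y.
Proof.
have := @tighten_le_at 1 (- y) ler01.
by rewrite scale1r addNr sublinear0// mul1r sub0r.
Qed.

End Tighten.

(* A minimal sublinear functional is linear. *)
Lemma hahn_banach_below p : sublinear p -> exists f : V -> R,
  (forall a x y, f (a *: x + y) = a * f x + f y) /\ (forall x, f x <= p x).
Proof.
move=> sp.
pose S := {q : V -> R | sublinear q /\ forall x, q x <= p x}.
(* Reversed order, so that the maximal element given by [Zorn] is pointwise minimal. *)
pose le_ (q1 q2 : S) : bool := `[< forall x, sval q2 x <= sval q1 x >].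
have [[f [sf fp]] /= fmin] : exists t : S, forall s, le_ t s -> s = t.
  apply: Zorn.
  - by move=> q; apply/asboolP => x.
  - move=> q1 q2 q3 /asboolP h1 /asboolP h2; apply/asboolP => x.
    exact: le_trans (h2 x) (h1 x).
  - move=> [q1 h1] [q2 h2] /asboolP/= l1 /asboolP/= l2; apply: eq_exist => /=.
    by apply/funext => x; apply/eqP; rewrite eq_le l1 l2.
  move=> A Atot; have [[s0 As0]|A0] := pselect (exists s, A s); last first.
    exists (exist _ p (conj sp (fun x => lexx (p x)))) => s As.
    by exfalso; apply: A0; exists s.
  pose Q x := [set sval s x | s in A].
  pose q x := inf (Q x).
  have Qlb x c : Q x c -> - p (- x) <= c.
    move=> [[s [ss sp']] /= As <-].
    by apply: le_trans (sublinear_geN _ ss); rewrite lerN2.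
  have qle x s : A s -> q x <= sval s x.
    by move=> As; apply: inf_le (@Qlb x) _; exists s.
  have lQ x m : (forall s, A s -> m <= sval s x) -> m <= q x.
    move=> h; apply: le_inf_set; first by exists (sval s0 x); exists s0.
    by move=> c [s As <-]; exact: h.
  have sq : sublinear q.
    split=> [x y|a x a0].
      rewrite -lerBlDr; apply: (lQ) => s1 As1; rewrite lerBlDr [X in _ <= X]addrC -lerBlDr.
      apply: (lQ) => s2 As2; rewrite lerBlDr.
      have [s1D _] := (svalP s1).1; have [s2D _] := (svalP s2).1.
      have [/asboolP h|/asboolP h] := Atot _ _ As1 As2.
        apply: (le_trans (qle _ _ As2)); apply: (le_trans (s2D _ _)).
        by rewrite addrC lerD2l.
      apply: (le_trans (qle _ _ As1)); apply: (le_trans (s1D _ _)).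
      by rewrite addrC lerD2r.
    rewrite -ler_pdivrMl//; apply: (lQ) => s As; rewrite ler_pdivrMl//.
    by apply: (le_trans (qle _ _ As)); exact: (svalP s).1.2.
  have qp x : q x <= p x by apply: le_trans (qle _ _ As0) ((svalP s0).2 x).
  exists (exist _ q (conj sq qp)) => s As; apply/asboolP => x /=.
  exact: qle.
have fN y : f (- y) = - f y.
  have sT := tighten_sublinear y sf.
  have Tp x : tighten f y x <= p x by exact: le_trans (tighten_le _ sf _) (fp x).
  have := fmin (exist _ (tighten f y) (conj sT Tp)).
  have -> : le_ (exist _ f (conj sf fp)) (exist _ (tighten f y) (conj sT Tp)).
    by apply/asboolP => x /=; exact: tighten_le.
  move=> /(_ isT) /(congr1 sval) /= Tf.
  have := tightenN y sf; rewrite Tf => h.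
  by apply/eqP; rewrite eq_le h /= lerNl; have := sublinear_geN (- y) sf; rewrite opprK; lra.
have fD x y : f (x + y) = f x + f y.
  apply/eqP; rewrite eq_le sf.1/=.
  by have := sf.1 (x + y) (- y); rewrite addrK fN; lra.
exists f; split => // a x y; rewrite fD; congr (_ + _).
have [a0|a0] := leP 0 a; first exact: sublinearZ.
rewrite -[a *: x]opprK fN -scaleNr sublinearZ//; first by lra.
lra.
Qed.

End HahnBanach.

Section Separation.
Context (R : realType) (B : normedModType R).
Implicit Types (C : set B) (x y z : B) (f : B -> R).

Definition unit_dual f := dual B f /\ forall z, `|f z| <= `|z|.

Lemma linear_bounded_dual f (K : R) :
  (forall a x y, f (a *: x + y) = a * f x + f y) -> (forall z, f z <= K * `|z|) ->
  dual B f /\ forall z, `|f z| <= K * `|z|.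
Proof.
move=> lf fb.
have f0 : f 0 = 0.
  have := lf 1 0 0; rewrite scale1r addr0 mul1r => /esym/eqP.
  by rewrite -subr_eq0 addrK => /eqP.
have fZ a z : f (a *: z) = a * f z by rewrite -[a *: z]addr0 lf f0 addr0.
have fb' z : `|f z| <= K * `|z|.
  rewrite ler_norml fb andbT lerNl.
  by have := fb (- z); rewrite -scaleN1r fZ mulN1r scaleN1r normrN.
have fB x y : f (x - y) = f x - f y.
  by rewrite addrC -scaleN1r lf mulN1r addrC.
split=> //; split => // x; apply/cvgrPdist_lt => e e0.
have K1 : 0 < `|K| + 1 by rewrite ltr_wpDl.
near=> y.
have : ball x (e / (`|K| + 1)) y.
  by near: y; apply: nbhsx_ballx; rewrite divr_gt0.
rewrite -ball_normE/=.
rewrite ltr_pdivlMr// -fB; apply: le_lt_trans; apply: (le_trans (fb' _)).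
rewrite mulrC ler_wpM2l//; have := ler_norm K; lra.
Unshelve. all: by end_near.
Qed.

Definition segment_closed C := forall x y t, C x -> C y -> 0 <= t -> t <= 1 ->
  C (t *: x + (1 - t) *: y).

(* The sublinear functional [inf_(a >= 0, y in C) (|z - a (y - x0)| - a r)] is at
   most the norm, and at most [- r] on [C - x0]. *)
Lemma separation C x0 (r : R) : C !=set0 -> segment_closed C -> 0 <= r ->
  (forall y, C y -> r <= `|x0 - y|) ->
  exists2 f, unit_dual f & forall y, C y -> f y + r <= f x0.
Proof.
move=> [y0 Cy0] cC r0 dC.
pose Q z := [set c | exists a y, [/\ 0 <= a, C y & c = `|z - a *: (y - x0)| - a * r]].
pose p z := inf (Q z).
have Qlb z c : Q z c -> - `|z| <= c.
  move=> [a [y [a0 Cy ->]]].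
  have h1 : `|a *: (y - x0)| <= `|z - a *: (y - x0)| + `|z|.
    by have := ler_normB z (z - a *: (y - x0)); rewrite subKr; lra.
  have h2 : a * r <= `|a *: (y - x0)|.
    by rewrite normrZ (ger0_norm a0) ler_wpM2l// distrC dC.
  lra.
have ple z a y : 0 <= a -> C y -> p z <= `|z - a *: (y - x0)| - a * r.
  by move=> a0 Cy; apply: inf_le (@Qlb z) _; exists a, y.
have lep z m : (forall a y, 0 <= a -> C y -> m <= `|z - a *: (y - x0)| - a * r) ->
    m <= p z.
  move=> h; apply: le_inf_set.
    by exists (`|z - 0 *: (y0 - x0)| - 0 * r); exists 0, y0.
  by move=> c [a [y [a0 Cy ->]]]; exact: h.
have sp : sublinear p.
  split=> [z w|b z b0].
    rewrite -lerBlDr; apply: (lep) => a y a0 Cy; rewrite lerBlDr [X in _ <= X]addrC -lerBlDr.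
    apply: (lep) => a' y' a0' Cy'; rewrite lerBlDr.
    have [s0|] := ltP 0 (a + a'); last first.
      move=> s0; have ea : a = 0 by lra.
      have ea' : a' = 0 by lra.
      rewrite ea ea' !scale0r !mul0r !subr0.
      apply: (le_trans (ple _ 0 y (lexx _) Cy)).
      by rewrite scale0r mul0r !subr0 addrC ler_normD.
    (* Convexity enters here: the pairs (a, y) and (a', y') merge into the weight a + a' and one
       convex combination of the points. *)
    pose t := a / (a + a').
    have t0 : 0 <= t by rewrite divr_ge0// ltW.
    have t1 : t <= 1 by rewrite ler_pdivrMr// mul1r lerDl.
    have Cy2 := cC _ _ _ Cy Cy' t0 t1.
    apply: (le_trans (ple _ (a + a') _ (ltW s0) Cy2)).
    have -> : (a + a') *: (t *: y + (1 - t) *: y' - x0) =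
        a *: (y - x0) + a' *: (y' - x0).
      rewrite !scalerBr scalerDr !scalerA.
      have -> : (a + a') * t = a by rewrite /t; field; rewrite gt_eqF.
      have -> : (a + a') * (1 - t) = a' by rewrite /t; field; rewrite gt_eqF.
      by rewrite scalerDl opprD addrACA.
    rewrite opprD addrACA.
    have := ler_normD (z - a *: (y - x0)) (w - a' *: (y' - x0)); lra.
  rewrite -ler_pdivrMl//; apply: (lep) => a y a0 Cy; rewrite ler_pdivrMl//.
  apply: (le_trans (ple _ (b * a) y (mulr_ge0 (ltW b0) a0) Cy)).
  rewrite -scalerA -scalerBr normrZ (gtr0_norm b0); lra.
have [f [lf fp]] := hahn_banach_below sp.
have fb z : f z <= 1 * `|z|.
  apply: (le_trans (fp z)); apply: (le_trans (ple z 0 y0 (lexx _) Cy0)).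
  by rewrite scale0r mul0r !subr0 mul1r.
have [df fb'] := linear_bounded_dual lf fb.
exists f; first by split => // z; have := fb' z; rewrite mul1r.
move=> y Cy; have := fp (y - x0); rewrite (dualB df).
have := ple (y - x0) 1 y ler01 Cy; rewrite scale1r subrr normr0 mul1r; lra.
Qed.

(** Separation of [x] from the origin at distance |x|. *)
Lemma norming x : exists2 f, unit_dual f & f x = `|x|.
Proof.
have [|//|//|y /= ->|f uf h] := @separation [set 0] x `|x|.
- by exists 0.
- by move=> _ _ t -> -> _ _; rewrite !scaler0 addr0.
- by rewrite subr0.
exists f => //; apply/eqP; rewrite eq_le; have [df fb] := uf.
rewrite (le_trans (ler_norm _) (fb x))/=.
by have := h 0 erefl; rewrite (dual0 df) add0r.
Qed.

End Separation.

(** * Tightness of the hulls *)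

Section SeparableSpace.
Context (R : realType) (B : normedModType R).
Implicit Types (x y z : B) (U : set B).

Lemma separable_dense_seq : separable B ->
  exists a : nat -> B, forall x e, 0 < e -> exists n, `|x - a n| < e.
Proof.
move=> [D [cD clD]].
have near_ x e : 0 < e -> exists2 y, D y & `|x - y| < e.
  move=> e0; have : closure D x by rewrite clD.
  move=> /(_ (ball x e) (nbhsx_ballx _ _ e0))[y [Dy]].
  by rewrite -ball_normE => xy; exists y.
have [D0|[a]] := pfcard_geP cD.
  by have [y] := near_ 0 1 ltr01; rewrite D0.
exists a => x e e0; have [y Dy xy] := near_ x e e0.
have [n _ an] := @surj _ _ _ _ a y Dy.
by exists n; rewrite an.
Qed.

Variable a : nat -> B.
Hypothesis dense_a : forall x e, 0 < e -> exists n, `|x - a n| < e.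

(** Countably many half-spaces suffice: if |y - x| > r, the functional norming some [a n] close to
    [y - x] exceeds [f n x + r] at [y]. *)
Lemma cylinder_closed_ball x (r : R) : cylinder_sigma B [set y | `|y - x| <= r].
Proof.
have /choice[f hf] n : exists f, unit_dual f /\ f (a n) = `|a n|.
  by have [f uf fa] := norming (a n); exists f.
have -> : [set y | `|y - x| <= r] =
    ~` \bigcup_n (~` (f n @^-1` [set c | c <= f n x + r])).
  rewrite setC_bigcup; apply/seteqP; split => y /=.
    move=> yr n _; rewrite setCK/= -lerBlDl; have [[df fb] _] := hf n.
    by rewrite -(dualB df); apply: le_trans yr; apply: le_trans (fb _); rewrite ler_norm.
  move=> h; rewrite leNgt; apply/negP => ry.
  pose e := (`|y - x| - r) / 2; have e0 : 0 < e by rewrite /e; lra.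
  have [n hn] := dense_a (y - x) e0; have [[df fb] fa] := hf n.
  have := h n I; rewrite setCK/= -lerBlDl -(dualB df) => fr.
  have h1 : `|y - x| <= `|a n| + `|y - x - a n|.
    by have := ler_normD (a n) (y - x - a n); rewrite addrC subrK.
  have h2 : f n (a n) - f n (y - x) <= `|y - x - a n|.
    rewrite -(dualB df); apply: (le_trans (ler_norm _)).
    by apply: (le_trans (fb _)); rewrite distrC.
  move: h1 h2 hn; rewrite fa /e; lra.
apply: sigma_algebraC; apply: sigma_algebra_bigcup => n.
apply: sigma_algebraC; apply: sub_sigma_algebra.
exists (f n), [set c | c <= f n x + r]; split; first by have [[]] := hf n.
split=> //; rewrite (_ : [set c | _] = `]-oo, f n x + r]%classic).
  exact: measurable_itv.
by apply/seteqP; split => c /=; rewrite in_itv.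
Qed.

Lemma cylinder_open U :
  (forall y, U y -> exists2 e, 0 < e & forall z, `|z - y| <= e -> U z) ->
  cylinder_sigma B U.
Proof.
move=> oU.
pose D n k := [set y | `|y - a n| <= k.+1%:R^-1].
have -> : U = \bigcup_n \bigcup_k (if `[< D n k `<=` U >] then D n k else set0).
  apply/seteqP; split => y.
    move=> Uy; have [e e0 he] := oU y Uy.
    have [k hk] : exists k : nat, k.+1%:R^-1 < e / 2.
      exists (Num.trunc (2 / e)); rewrite -[e / 2]invrK ltf_pV2 ?posrE//.
        by rewrite invf_div truncnS_gt.
      by rewrite invr_gt0 divr_gt0.
    have k0 : (0 : R) < k.+1%:R^-1 by rewrite invr_gt0.
    have [n hn] := dense_a y k0.
    exists n => //; exists k => //.
    rewrite asboolT; first exact: ltW.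
    move=> z /= zn; apply: he.
    have -> : z - y = (z - a n) - (y - a n) by rewrite opprB addrA subrK.
    apply: le_trans (ler_normB _ _) _.
    move: zn hn hk; rewrite /D/=; move: k.+1%:R^-1 => u; lra.
  by move=> [n _ [k _]]; case: asboolP => // h; exact: h.
apply: sigma_algebra_bigcup => n; apply: sigma_algebra_bigcup => k.
case: asboolP => _; last exact: sigma_algebra0.
exact: cylinder_closed_ball.
Qed.

End SeparableSpace.

(** * Finite-dimensional cubes spanned by the dense sequence *)

Section Cubes.
Context (R : realType) (B : normedModType R) (a : nat -> B).
Implicit Types (x y z : B).

(** Symmetric, convex, totally bounded and increasing in [n], with dense union: these sets exhaust
    the space up to any epsilon. *)
Definition cube n : set B :=
  [set z | exists2 c : nat -> R, (forall i, `|c i| <= 1) & z = \sum_(i < n) c i *: a i].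

Lemma cube_le n p : (n <= p)%N -> cube n `<=` cube p.
Proof.
move=> np z [c hc ->]; exists (fun i => if (i < n)%N then c i else 0).
  by move=> i; case: ifP => _ //; rewrite normr0.
rewrite (big_ord_widen _ (fun i => c i *: a i) np) big_mkcond/=.
by apply: eq_bigr => i _; case: ifP => _ //; rewrite scale0r.
Qed.

Lemma cube_mem n : cube n.+1 (a n).
Proof.
exists (fun i => (i == n)%:R); first by move=> i; case: eqP => _; rewrite ?normr1 ?normr0.
rewrite big_ord_recr/= eqxx scale1r big1 ?add0r// => i _.
by rewrite (ltn_eqF (ltn_ord i)) scale0r.
Qed.

Lemma cube0 n : cube n 0.
Proof.
exists (fun=> 0); first by move=> i; rewrite normr0.
by rewrite big1// => i _; rewrite scale0r.
Qed.

Lemma cubeN n z : cube n z -> cube n (- z).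
Proof.
move=> [c hc ->]; exists (fun i => - c i); first by move=> i; rewrite normrN.
by rewrite -sumrN; apply: eq_bigr => i _; rewrite scaleNr.
Qed.

Lemma cube_convex n : segment_closed (cube n).
Proof.
move=> x y t [c hc ->] [c' hc' ->] t0 t1.
exists (fun i => t * c i + (1 - t) * c' i).
  have t1' : 0 <= 1 - t by lra.
  move=> i; apply: (le_trans (ler_normD _ _)).
  rewrite !normrM (ger0_norm t0) (ger0_norm t1').
  have := ler_wpM2l t0 (hc i); have := ler_wpM2l t1' (hc' i); lra.
rewrite !scaler_sumr -big_split/=; apply: eq_bigr => i _.
by rewrite !scalerA -scalerDl.
Qed.

Lemma eps_nbhd_convex (C : set B) (e : R) : segment_closed C -> segment_closed (eps_nbhd B C e).
Proof.
move=> cC x y t [x' Cx xx] [y' Cy yy] t0 t1.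
exists (t *: x' + (1 - t) *: y'); first exact: cC.
rewrite opprD addrACA -!scalerBr; apply: le_lt_trans (ler_normD _ _) _.
have t1' : 0 <= 1 - t by lra.
rewrite !normrZ (ger0_norm t0) (ger0_norm t1').
have [t00|tn0] := eqVneq t 0; first by rewrite t00 mul0r add0r subr0 mul1r.
have tp : 0 < t by rewrite lt_def tn0.
have := ltr_pM2l tp `|x - x'| e; rewrite xx => h1.
have := ler_wpM2l t1' (ltW yy); lra.
Qed.

(** The coefficients are rounded down to multiples of 1/M, with M larger than the sum of the norms
    divided by [e]. *)
Lemma cube_totally_bounded n (e : R) : 0 < e ->
  exists F : seq B, forall z, cube n z -> exists2 y, y \in F & `|z - y| < e.
Proof.
move=> e0; pose S := \sum_(i < n) `|a i|.
have S0 : 0 <= S by exact: sumr_ge0.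
pose M := (Num.trunc (S / e)).+1.
have MS : S / M%:R < e.
  rewrite ltr_pdivrMr ?ltr0n// mulrC -ltr_pdivrMr//; exact: truncnS_gt.
have M0 : (0 : R) < M%:R by rewrite ltr0n.
pose g (k : {ffun 'I_n -> 'I_(M + M).+1}) : B :=
  \sum_(i < n) (((k i)%:R - M%:R) / M%:R) *: a i.
exists [seq g k | k <- enum {ffun 'I_n -> 'I_(M + M).+1}] => z [c hc ->].
pose k : {ffun 'I_n -> 'I_(M + M).+1} :=
  [ffun i : 'I_n => inord (Num.trunc ((c i + 1) * M%:R))].
exists (g k); first by apply: map_f; rewrite mem_enum.
rewrite /g -sumrB; apply: le_lt_trans MS; rewrite /S mulr_suml.
apply: le_trans (ler_norm_sum _ _ _) _; apply: ler_sum => i _.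
rewrite -scalerBl normrZ mulrC ler_wpM2l// /k ffunE.
have /andP[c1 c2] : -1 <= c i <= 1 by have := hc i; rewrite ler_norml.
have cM0 : 0 <= (c i + 1) * M%:R by rewrite mulr_ge0//; lra.
have /andP[t1 t2] := truncn_itv cM0.
rewrite inordK; last first.
  rewrite ltnS -(ler_nat R); apply: (le_trans t1); rewrite natrD; nra.
set u := (Num.trunc _)%:R in t1 t2 *.
rewrite (_ : c i - (u - M%:R) / M%:R = ((c i + 1) * M%:R - u) / M%:R); last first.
  by field; rewrite gt_eqF.
rewrite normrM normfV (gtr0_norm M0) ler_piMl ?invr_ge0 ?ler0n// ger0_norm; last by lra.
move: t2; rewrite -natr1 -/u; lra.
Qed.

End Cubes.

Lemma cos_rot_step2 (R : realType) : cos (rot_step R 2) ^+ 2 = 2^-1.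
Proof.
have := cos_mulr2n (rot_step R 2).
rewrite (_ : rot_step R 2 *+ 2 = pi / 2); last by rewrite /rot_step; field.
by rewrite cos_pihalf; lra.
Qed.

(** * Gauges of a neighbourhood of a cube and their Gaussian tails *)

Section Tightness.
Context (R : realType) (B : normedModType R) (d : measure_display)
  (Om : measurableType d) (P : probability Om R) (m : nat) (X : Zm m -> Om -> B)
  (T : nat -> {fset Zm m}) (a : nat -> B) (t0 : Zm m).
Hypothesis dense_a : forall x e, 0 < e -> exists n, `|x - a n| < e.
Hypothesis mX : forall t C, cylinder_sigma B C -> measurable (X t @^-1` C).
Hypothesis gX : forall s : seq (Zm m * (B -> R)), (forall p, p \in s -> dual B p.2) ->
  centered_gaussian P (fun w => \sum_(p <- s) p.2 (X p.1 w)).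
Hypothesis lawX : forall t t' C, cylinder_sigma B C ->
  P (X t @^-1` C) = P (X t' @^-1` C).
Hypothesis Tinc : forall n, (T n `<=` T n.+1)%fset.
Hypothesis Tcard :
  forall M : nat, exists N, forall n, (N <= n)%N -> (M <= #|` T n|)%N.

Lemma cylinder_eps_nbhd (C : set B) (e : R) : cylinder_sigma B (eps_nbhd B C e).
Proof.
apply: (cylinder_open dense_a) => y [z Cz yz].
exists ((e - `|y - z|) / 2); first by rewrite divr_gt0// subr_gt0.
move=> y' yy; exists z => //.
have := ler_normD (y' - y) (y - z); rewrite addrA subrK; lra.
Qed.

(** The neighbourhoods of the cubes increase to the whole space, so continuity from below yields
    mass 1/2; the common law makes [n] uniform in [t]. *)
Lemma cube_half (e : R) : 0 < e -> exists n, forall t,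
  2^-1 <= pr P (X t @^-1` (eps_nbhd B (cube a n) e)).
Proof.
move=> e0; pose F n := X t0 @^-1` (eps_nbhd B (cube a n) e).
have mF n : measurable (F n) by apply: mX; exact: cylinder_eps_nbhd.
have ndF : nondecreasing_seq F.
  move=> n p np; apply/subsetPset => w [z cz wz]; exists z => //.
  exact: cube_le cz.
have UF : \bigcup_n F n = setT.
  apply/seteqP; split => // w _; have [n hn] := dense_a (X t0 w) e0.
  by exists n.+1 => //; exists (a n) => //; exact: cube_mem.
have : P (F n) @[n --> \oo] --> P (\bigcup_n F n).
  exact: (nondecreasing_cvg_mu (mu := P) mF (bigcupT_measurable F mF) ndF).
rewrite UF probability_setT => /fine_cvgP[_ /cvgrPdist_lt /(_ 2^-1)].
rewrite invr_gt0 ltr0n => /(_ isT)[N _ hN].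
exists N => t; have /= := hN N (leqnn N).
have -> : pr P (X t @^-1` eps_nbhd B (cube a N) e) = fine (P (F N)).
  by congr fine; apply: lawX; exact: cylinder_eps_nbhd.
move=> h; have := ler_norm (1 - fine (P (F N))); lra.
Qed.

(** A countable substitute for the Minkowski gauge of a neighbourhood of the cube. Mass 1/2 on the
    unit region is what concentration asks for. *)
Definition gauges (e : R) (n : nat) (g : nat -> B -> R) : Prop :=
  [/\ forall i, dual B (g i),
    forall t, 2^-1 <= pr P [set w | forall i, `|g i (X t w)| <= 1] &
    forall y, (forall i, g i y <= 1) -> eps_nbhd B (cube a n) (4 * e) y].

Lemma measurable_forall_le (g : nat -> B -> R) t : (forall i, dual B (g i)) ->
  measurable [set w | forall i, `|g i (X t w)| <= 1].
Proof.
move=> dg; rewrite (_ : [set w | _] = \bigcap_i [set w | `|g i (X t w)| <= 1]).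
  apply: bigcapT_measurable => i; apply: measurable_le.
  by apply: measurableT_comp => //; exact: (functional_measurable gX).
by apply/seteqP; split => w /= h i => [_|]; exact: h.
Qed.

(** For each dense point [a i] at distance at least e from [A], a separating [f] is divided by s =
    f(a i) - e/2. On [A] one has f <= f(a i) - e < s, and symmetry gives |f| <= s; within e/4 of
    [a i], f stays above s. *)
Lemma gauges_exist (e : R) : 0 < e -> exists n g, gauges e n g.
Proof.
move=> e0; have [n hn] := cube_half e0.
set A := eps_nbhd B (cube a n) e in hn.
have A0 : A 0 by exists 0; [exact: cube0|rewrite subrr normr0].
have AN y : A y -> A (- y).
  move=> [z cz yz]; exists (- z); first exact: cubeN.
  by rewrite opprK addrC distrC.
have cA : segment_closed A by apply: eps_nbhd_convex; exact: cube_convex.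
have /choice[g hg] i : exists g, [/\ dual B g, forall y, A y -> `|g y| <= 1 &
    forall y, (forall z, A z -> 2 * e <= `|y - z|) -> `|y - a i| < e / 4 -> 1 < g y].
  have [far|nfar] := pselect (forall z, A z -> e <= `|a i - z|); last first.
    (* Here [a i] is within e of [A], so no point within e/4 of it is at distance 2e from [A] and
       the last clause is vacuous. *)
    exists (fun=> 0); split.
    - by split; [move=> *; rewrite mulr0 addr0|move=> x; exact: cvg_cst].
    - by move=> y _; rewrite normr0.
    - move=> y hy yi; exfalso; apply: nfar => z Az.
      have := hy z Az; have := ler_normD (y - a i) (a i - z).
      by rewrite addrA subrK; lra.
  have [f [df fb] hf] := separation (ex_intro _ 0 A0) cA (ltW e0) far.
  pose s := f (a i) - e / 2.
  have s0 : 0 < s by have := hf 0 A0; rewrite (dual0 df) /s; lra.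
  exists (fun x => s^-1 * f x); split; first exact: dual_scale.
    move=> y Ay; rewrite normrM gtr0_norm ?invr_gt0// ler_pdivrMl// mulr1.
    rewrite ler_norml; have := hf y Ay; have := hf _ (AN _ Ay).
    by rewrite (dualN df) /s => h1 h2; apply/andP; split; lra.
  move=> y _ yi; rewrite ltr_pdivlMl// mulr1 /s.
  have := fb (a i - y); rewrite (dualB df) [X in _ <= X]distrC => h.
  have := ler_norm (f (a i) - f y); lra.
exists n, g; split.
- by move=> i; have [] := hg i.
- move=> t; apply: (le_trans (hn t)); apply: pr_le.
  + by apply: mX; exact: cylinder_eps_nbhd.
  + by apply: measurable_forall_le => i; have [] := hg i.
  + by move=> w Aw i; have [_ /(_ _ Aw)] := hg i.
- move=> y gy; apply: contrapT => ny.
  have e4 : 0 < e / 4 by rewrite divr_gt0.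
  have [i hi] := dense_a y e4.
  have [_ _ /(_ y)] := hg i.
  have far z : A z -> 2 * e <= `|y - z|.
    move=> [z' cz zz]; rewrite leNgt; apply/negP => yz; apply: ny.
    exists z' => //; have := ler_normD (y - z) (z - z'); rewrite addrA subrK; lra.
  by move=> /(_ far hi); rewrite ltNge gy.
Qed.

Section Gauge.
Variables (e : R) (n : nat) (g : nat -> B -> R).
Hypothesis hg : gauges e n g.

Lemma gauge_sd i t : Num.sqrt (var P (fun w => g i (X t w))) <= 2.
Proof.
have [dg half _] := hg.
rewrite -[X in _ <= X]mulr1; apply: cg_sd_le => //.
  exact: (functional_gaussian gX).
apply: (le_trans (half t)); apply: pr_le.
- exact: measurable_forall_le.
- apply: measurable_le; apply: measurableT_comp => //.
  exact: (functional_measurable gX).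
- by move=> w /= h; exact: h.
Qed.

(** Concentration for finitely many gauges, with two rotation steps (damping 1/2), variance bound 4
    and m = 1. Dividing by P(all gauges <= 1) >= 1/2 gives the factor 2. The bound is uniform in the
    number of gauges and passes to the countable union. *)
Lemma gauge_tail t (s : R) : 2 <= s ->
  pr P (\bigcup_i [set w | s < g i (X t w)]) <=
  2 * expR (- ((s / 2 - 1) ^+ 2 / 32)).
Proof.
move=> s2; have [dg half _] := hg.
pose F N := \big[setU/set0]_(i < N) [set w | s < g i (X t w)].
have mg i : measurable [set w | s < g i (X t w)].
  by apply: measurable_gt; exact: (functional_measurable gX).
have FE N : F N = \bigcup_(i < N) [set w | s < g i (X t w)] by rewrite bigcup_mkord.
have mF N : measurable (F N) by apply: bigsetU_measurable.
have ndF : nondecreasing_seq F.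
  move=> N M NM; apply/subsetPset; rewrite !FE => w [i /= iN h]; exists i => //=.
  exact: leq_trans NM.
have UF : \bigcup_N F N = \bigcup_i [set w | s < g i (X t w)].
  apply/seteqP; split => w.
    by move=> [N _]; rewrite FE => -[i _ h]; exists i.
  by move=> [i _ h]; exists i.+1 => //; rewrite FE; exists i => /=.
have bF N : pr P (F N.+1) <= 2 * expR (- ((s / 2 - 1) ^+ 2 / 32)).
  pose xi (i : 'I_N.+1) w := g i (X t w).
  have gxi (c : 'I_N.+1 -> R) : centered_gaussian P (fun w => \sum_i c i * xi i w).
    have := gX (s := [seq (t, fun x => c i * g i x) | i <- enum 'I_N.+1]).
    have -> : (fun w => \sum_(p <- [seq (t, fun x => c i * g i x) | i <- enum 'I_N.+1])
        p.2 (X p.1 w)) = fun w => \sum_i c i * xi i w.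
      by apply/funext => w; rewrite big_map big_enum.
    by apply => p /mapP[i _ ->]; exact: dual_scale.
  have v4 i : var P (xi i) <= 4.
    have := gauge_sd i t; rewrite -(@ler_pXn2r _ 2)// ?nnegrE ?sqrtr_ge0//.
    by rewrite sqr_sqrtr ?var_ge0//; rewrite (_ : 2 ^+ 2 = 4 :> R)//; ring.
  have K0 : 0 < 4 :> R by [].
  have m0 : 1 <= cos (rot_step R 2) ^+ 2 * s by rewrite cos_rot_step2; lra.
  have := concentration gxi K0 v4 (isT : (0 < 2)%N) m0.
  rewrite cos_rot_step2 [2^-1 * s]mulrC (_ : 8 * 4 = 32 :> R); last by ring.
  set p1 := pr P _; set p2 := pr P _ => conc.
  have h2 : 2^-1 <= p2.
    apply: (le_trans (half t)); apply: pr_le.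
    - exact: measurable_forall_le.
    - rewrite (_ : [set w | _] = \bigcap_i [set w | xi i w <= 1]).
        apply: fin_bigcap_measurable => // i _; apply: measurable_le.
        exact: (functional_measurable gX).
      by apply/seteqP; split => w /= h i => [_|]; exact: h.
    - by move=> w /= h i; apply: le_trans (h i); exact: ler_norm.
  have h1 : pr P (F N.+1) <= p1.
    apply: pr_le => //.
      rewrite (_ : [set w | _] = \bigcup_i [set w | s <= xi i w]).
        apply: fin_bigcup_measurable => // i _; apply: measurable_ge.
        exact: (functional_measurable gX).
      by apply/seteqP; split => w /= [i]; [exists i|move=> _; exists i].
    rewrite FE => w [i /= iN h]; exists (Ordinal iN); exact: ltW.
  have p10 : 0 <= p1 by exact: pr_ge0.
  have := ler_wpM2l p10 h2; lra.
rewrite -UF -lee_fin -prE; last exact: (bigcupT_measurable F mF).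
have cv : P (F n) @[n --> \oo] --> P (\bigcup_n F n).
  exact: (nondecreasing_cvg_mu (mu := P) mF (bigcupT_measurable F mF) ndF).
rewrite -(cvg_lim _ cv)//; apply: lime_le; first by apply/cvg_ex; eexists; exact: cv.
near=> N; rewrite /= prE// lee_fin.
have [N'] : exists N', N = N'.+1.
  by exists N.-1; rewrite prednK//; near: N; exact: nbhs_infty_gt.
by move=> ->.
Unshelve. all: by end_near.
Qed.

(** For b >= 1 the level 64 b gives (32 b - 1)^2 / 32 >= 8 b^2, that is [gam = 16], well above the
    threshold 1 of the union bound. *)
Lemma gauge_eventually : {ae P, forall w, exists n0, forall k, (n0 <= k)%N ->
  forall t, t \in T k -> forall i, g i (X t w) <= 64 * bfun (#|` T k|)%:R}.
Proof.
have [dg _ _] := hg.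
have := @eventually_not_any R d Om P m T Tinc Tcard
  (fun t b => \bigcup_i [set w | 64 * b < g i (X t w)]) 2 16 1.
have mA t b : measurable (\bigcup_i [set w | 64 * b < g i (X t w)]).
  apply: bigcupT_measurable => i; apply: measurable_gt.
  exact: (functional_measurable gX).
have mono t b b' : b <= b' -> \bigcup_i [set w | 64 * b' < g i (X t w)] `<=`
    \bigcup_i [set w | 64 * b < g i (X t w)].
  by move=> bb w [i _ /= h]; exists i => //=; lra.
have tail t (b : R) : 1 <= b -> pr P (\bigcup_i [set w | 64 * b < g i (X t w)]) <=
    2 * expR (- (16 / 2 * b ^+ 2)).
  move=> b1; apply: (le_trans (gauge_tail t _)); first by lra.
  rewrite ler_wpM2l// ler_expR lerN2; nra.
have c1 : (1 : R) < 16 by lra.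
have c2 : (0 : R) <= 2 by [].
move=> /(_ c1 c2 mA mono tail); apply: filterS => w [n0 hn0].
exists n0 => k k0 t tT i; rewrite leNgt; apply/negP => h.
by apply: (hn0 k k0 t tT); exists i.
Qed.

End Gauge.
End Tightness.

(** * The concentration ellipsoid *)

Section Ellipsoid.
Context (R : realType) (B : normedModType R) (d : measure_display)
  (Om : measurableType d) (P : probability Om R) (Y : Om -> B) (a : nat -> B).
Implicit Types (f : B -> R) (h : B).
Hypothesis dense_a : forall x e, 0 < e -> exists n, `|x - a n| < e.
Hypothesis mY : forall C, cylinder_sigma B C -> measurable (Y @^-1` C).
Hypothesis gY : forall f, dual B f -> centered_gaussian P (fun w => f (Y w)).

Let sdY f : R := Num.sqrt (var P (fun w => f (Y w))).

Let sdY_sqr f : sdY f ^+ 2 = var P (fun w => f (Y w)).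
Proof. by rewrite sqr_sqrtr// var_ge0. Qed.

Let mfY f : dual B f -> measurable_fun setT (fun w => f (Y w)).
Proof. by move=> df; exact: cg_measurable (gY df). Qed.

Lemma L2_mul (u v : Om -> R) : measurable_fun setT u -> measurable_fun setT v ->
  P.-integrable setT (EFin \o (fun w => u w ^+ 2)) ->
  P.-integrable setT (EFin \o (fun w => v w ^+ 2)) ->
  P.-integrable setT (EFin \o (fun w => u w * v w)).
Proof.
move=> mu mv iu iv; apply: (L1_le _ _ (L1D iu iv)); first exact: measurable_funM.
move=> w; rewrite ler_norml.
have := sqr_ge0 (u w + v w); have := sqr_ge0 (u w - v w).
have := sqr_ge0 (u w); have := sqr_ge0 (v w).
by move=> ? ? ? ?; apply/andP; split; nra.
Qed.

(** Young's inequality with a free [l]; a suitable choice yields Cauchy-Schwarz up to epsilon, also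
    when a norm vanishes. *)
Lemma Rintegral_mul_le (u v : Om -> R) (l : R) : 0 < l ->
  measurable_fun setT u -> measurable_fun setT v ->
  P.-integrable setT (EFin \o (fun w => u w ^+ 2)) ->
  P.-integrable setT (EFin \o (fun w => v w ^+ 2)) ->
  \int[P]_w `|u w * v w| <=
    l / 2 * (\int[P]_w (u w ^+ 2)) + (2 * l)^-1 * (\int[P]_w (v w ^+ 2)).
Proof.
move=> l0 mu mv iu iv.
have i1 := L1Z (l / 2) iu; have i2 := L1Z (2 * l)^-1 iv.
rewrite -!RintegralZl// -RintegralD//; apply: le_Rintegral => //.
- by apply: L1_norm; exact: L2_mul.
- exact: L1D.
move=> w _; rewrite normrM -(real_normK (num_real (u w))) -(real_normK (num_real (v w))).
move: `|u w| `|v w| => x y.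
have : 0 <= (2 * l)^-1 * (l * x - y) ^+ 2.
  by rewrite mulr_ge0 ?sqr_ge0// invr_ge0; lra.
rewrite (_ : (2 * l)^-1 * (l * x - y) ^+ 2 =
   l / 2 * x ^+ 2 + (2 * l)^-1 * y ^+ 2 - x * y); first by lra.
by field; rewrite gt_eqF.
Qed.

Lemma ellipsoid_le_sd h f : concentration_ellipsoid B P Y h -> dual B f ->
  f h <= sdY f.
Proof.
move=> [g [mg [_ [g1 gf]]]] df.
have ig : P.-integrable setT (EFin \o (fun w => g w ^+ 2)).
  apply/integrableP; split; first by apply/measurable_EFinP; exact: measurable_funX.
  under eq_integral do rewrite /= ger0_norm ?sqr_ge0//.
  by rewrite unlock in g1; apply: le_lt_trans g1 _; rewrite ltry.
have g1' : \int[P]_w (g w ^+ 2) <= 1.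
  rewrite -lee_fin /Rintegral fineK; last exact: integrable_fin_num ig.
  by rewrite unlock in g1.
have iF := cg_L2 (gY df).
have igf := L2_mul mg (mfY df) ig iF.
have fE : f h = \int[P]_w (g w * f (Y w)).
  have := gf f df; rewrite unlock => hh.
  by apply: EFin_inj; rewrite -hh /Rintegral fineK//; exact: integrable_fin_num igf.
have s0 : 0 <= sdY f by exact: sqrtr_ge0.
apply/ler_addgt0Pr => e e0.
(* This [l] makes both terms of Young's inequality at most (sdY f + e) / 2 and stays positive when
   [sdY f] is 0. *)
have l0 : 0 < sdY f + e by lra.
rewrite fE; apply: (@le_trans _ _ (\int[P]_w `|g w * f (Y w)|)).
  by apply: le_Rintegral => //; [exact: L1_norm|move=> w _; exact: ler_norm].
apply: (le_trans (Rintegral_mul_le l0 mg (mfY df) ig iF)).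
rewrite -/(var P (fun w => f (Y w))) -sdY_sqr.
set s := sdY f in s0 l0 *.
have h1 : (2 * (s + e))^-1 * s ^+ 2 <= (s + e) / 2.
  rewrite ler_pdivrMl ?mulr_gt0//.
  rewrite (_ : 2 * (s + e) * ((s + e) / 2) = (s + e) ^+ 2); last by field.
  by rewrite lerXn2r ?nnegrE//; lra.
have := ler_wpM2l (_ : 0 <= (s + e) / 2) g1' => h2.
have {}h2 := h2 ltac:(lra); lra.
Qed.

(* The images of functionals under the covariance operator, without the L2
   closure: this part of the ellipsoid already attains every support value
   [sdY f], which is all the Hausdorff estimate needs. *)
Definition functional_ellipsoid : set B :=
  [set h | exists2 f, dual B f /\ sdY f <= 1 &
    forall f', dual B f' -> \int[P]_w (f (Y w) * f' (Y w)) = f' h].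

Lemma functional_ellipsoid_sub :
  functional_ellipsoid `<=` concentration_ellipsoid B P Y.
Proof.
move=> h [f [df f1] hf]; exists (fun w => f (Y w)); split; first exact: mfY.
split; last split.
- exists (fun=> f); split => //.
  have -> : (fun n : nat => 'E_P[fun w => ((f (Y w) - f (Y w)) ^+ 2)%R])%E = fun=> 0%E.
    apply/funext => n; rewrite unlock.
    by under eq_integral do rewrite subrr expr0n/=; rewrite integral0.
  exact: cvg_cst.
- rewrite unlock -[X in (X <= _)%E]fineK; last exact: integrable_fin_num (cg_L2 (gY df)).
  rewrite lee_fin -/(Rintegral P setT (fun w => f (Y w) ^+ 2)) -/(var _ _) -sdY_sqr.
  by rewrite expr_le1// sqrtr_ge0.
- move=> f' df'; rewrite unlock -hf// /Rintegral fineK//.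
  have := L2_mul (mfY df) (mfY df') (cg_L2 (gY df)) (cg_L2 (gY df')).
  exact: integrable_fin_num.
Qed.

Lemma functional_ellipsoid_convex : segment_closed functional_ellipsoid.
Proof.
move=> x y t [f [df f1] hf] [g [dg g1] hg] t0 t1.
exists (fun z => t * f z + (1 - t) * g z).
  split; first by apply: dual_add; exact: dual_scale.
  have dfg : dual B (fun z => t * f z + (1 - t) * g z).
    by apply: dual_add; exact: dual_scale.
  rewrite -(@expr_le1 _ 2)// ?sqrtr_ge0// sdY_sqr.
  have vf : var P (fun w => f (Y w)) <= 1 by rewrite -sdY_sqr expr_le1// sqrtr_ge0.
  have vg : var P (fun w => g (Y w)) <= 1 by rewrite -sdY_sqr expr_le1// sqrtr_ge0.
  have i1 := L1Z t (cg_L2 (gY df)); have i2 := L1Z (1 - t) (cg_L2 (gY dg)).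
  apply: (@le_trans _ _ (t * var P (fun w => f (Y w)) + (1 - t) * var P (fun w => g (Y w)))).
    rewrite /var -!RintegralZl//; [|exact: cg_L2 (gY dg)|exact: cg_L2 (gY df)].
    rewrite -RintegralD//; apply: le_Rintegral => //.
    - exact: cg_L2 (gY dfg).
    - exact: L1D.
    - move=> w _; move: (f (Y w)) (g (Y w)) => u v.
      have t1' : 0 <= 1 - t by lra.
      have : 0 <= t * (1 - t) * (u - v) ^+ 2 by rewrite mulr_ge0 ?sqr_ge0// mulr_ge0.
      nra.
  have t1' : 0 <= 1 - t by lra.
  have := ler_wpM2l t0 vf; have := ler_wpM2l t1' vg; lra.
move=> f' df'.
have i1 := L2_mul (mfY df) (mfY df') (cg_L2 (gY df)) (cg_L2 (gY df')).
have i2 := L2_mul (mfY dg) (mfY df') (cg_L2 (gY dg)) (cg_L2 (gY df')).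
rewrite (dualD df') !(dualZ df') -hf// -hg// -!RintegralZl//.
rewrite -RintegralD//; [|exact: L1Z..].
by apply: eq_Rintegral => w _; ring.
Qed.

(** With probability at least 1/2, [Y] is within 1 of finitely many points and thus bounded by S.
    [cg_sd_le] turns this into a bound for all unit functionals at once, with no moment of |Y|
    involved. *)
Lemma unit_dual_sd_bounded : exists2 C : R, 0 < C & forall f, unit_dual f -> sdY f <= C.
Proof.
pose F n := [set w | exists2 i, (i < n)%N & `|Y w - a i| <= 1].
have FE n : F n = \bigcup_(i < n) (Y @^-1` [set y | `|y - a i| <= 1]).
  by apply/seteqP; split => w [i h1 h2]; exists i.
have mF n : measurable (F n).
  rewrite FE bigcup_mkord; apply: bigsetU_measurable => i _.
  by apply: mY; exact: (cylinder_closed_ball dense_a).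
have ndF : nondecreasing_seq F.
  move=> n p np; apply/subsetPset => w [i iN h]; exists i => //.
  exact: leq_trans np.
have UF : \bigcup_n F n = setT.
  apply/seteqP; split => // w _; have [i hi] := dense_a (Y w) ltr01.
  by exists i.+1 => //; exists i => //; exact: ltW.
have : P (F n) @[n --> \oo] --> P (\bigcup_n F n).
  exact: (nondecreasing_cvg_mu (mu := P) mF (bigcupT_measurable F mF) ndF).
rewrite UF probability_setT => /fine_cvgP[_ /cvgrPdist_lt /(_ 2^-1)].
rewrite invr_gt0 ltr0n => /(_ isT)[N _ /(_ N (leqnn N))/= hN].
have half : 2^-1 <= pr P (F N).
  rewrite /pr; have := ler_norm (1 - fine (P (F N))); lra.
pose S := 1 + \sum_(i < N) `|a i|.
have S1 : 1 <= S by rewrite lerDl sumr_ge0.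
exists (2 * S); first by lra.
move=> f [df fb]; apply: cg_sd_le; [exact: gY|by lra|].
apply: (le_trans half); apply: pr_le => //.
  by apply: measurable_le; apply: measurableT_comp => //; exact: mfY.
move=> w [i iN h] /=; apply: (le_trans (fb _)).
have : `|a i| <= \sum_(i < N) `|a i|.
  by rewrite (bigD1 (Ordinal iN))//= lerDl sumr_ge0.
have := ler_normD (Y w - a i) (a i); rewrite subrK /S; lra.
Qed.

Lemma dual_bounded f : dual B f -> exists2 K : R, 0 < K & forall z, `|f z| <= K * `|z|.
Proof.
move=> df; have [_ cf] := df.
have /cvgrPdist_lt /(_ 1 ltr01) := cf 0.
rewrite (dual0 df) => /nbhs_ballP[e /= e0 he].
exists (2 / e); first by rewrite divr_gt0.
move=> z; have [->|z0] := eqVneq z 0; first by rewrite (dual0 df) !normr0 mulr0.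
have nz : 0 < `|z| by rewrite normr_gt0.
pose c := e / 2 / `|z|; have c0 : 0 < c by rewrite !divr_gt0.
have : ball 0 e (c *: z).
  rewrite -ball_normE /= sub0r normrN normrZ gtr0_norm// /c divfK ?gt_eqF//; lra.
move=> /he /=; rewrite sub0r normrN (dualZ df) normrM gtr0_norm// => h1.
have -> : 2 / e * `|z| = c^-1 by rewrite /c; field; rewrite !gt_eqF.
by rewrite -[c^-1]mulr1 ler_pdivlMl// ltW.
Qed.

End Ellipsoid.

(** * Pettis integrals and support points of the ellipsoid *)

Section Pettis.
Context (R : realType) (B : completeNormedModType R) (d : measure_display)
  (Om : measurableType d) (P : probability Om R) (Y : Om -> B) (a : nat -> B).
Implicit Types (f : B -> R) (h : B).
Hypothesis dense_a : forall x e, 0 < e -> exists n, `|x - a n| < e.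
Hypothesis mY : forall C, cylinder_sigma B C -> measurable (Y @^-1` C).
Hypothesis gY : forall f, dual B f -> centered_gaussian P (fun w => f (Y w)).

(* Replace [Y w] by the first point of the dense sequence at distance less than
   [eta], and truncate to the first [N] points. *)
Lemma pettis_approx f (e : R) : dual B f -> 0 < e ->
  exists h, forall f', unit_dual f' ->
    `|f' h - \int[P]_w (f (Y w) * f' (Y w))| <= e.
Proof.
move=> df e0; pose g w := f (Y w).
have mg : measurable_fun setT g := cg_measurable (gY df).
have ig2 : P.-integrable setT (EFin \o (fun w => g w ^+ 2)) := cg_L2 (gY df).
have ig : P.-integrable setT (EFin \o g).
  have i1 : P.-integrable setT (EFin \o (fun w : Om => (1 : R) ^+ 2)).
    exact: finite_measure_integrable_cst.
  have m1 : measurable_fun setT (fun w : Om => 1 : R) by [].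
  by apply: eq_integrable (L2_mul mg m1 ig2 i1) => // w _; rewrite /= mulr1.
have [C C0 hC] := unit_dual_sd_bounded dense_a mY gY.
pose I1 := \int[P]_w `|g w|.
have I10 : 0 <= I1 by exact: Rintegral_ge0.
pose eta := e / (3 * (1 + I1)).
have eta0 : 0 < eta by rewrite divr_gt0// mulr_gt0//; lra.
have exJ w : exists n, `|Y w - a n| < eta by exact: dense_a.
pose J w := ex_minn (exJ w).
have mJ j : measurable [set w | J w = j].
  have mA i : measurable [set w | `|Y w - a i| < eta].
    have := mY (cylinder_eps_nbhd dense_a [set a i] eta); congr measurable.
    by apply/seteqP; split => w /=; [case=> _ ->|exists (a i)].
  rewrite (_ : [set w | _] = [set w | `|Y w - a j| < eta] `\`
     \bigcup_(i < j) [set w | `|Y w - a i| < eta]).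
    by apply: measurableD => //; rewrite bigcup_mkord; apply: bigsetU_measurable.
  apply/seteqP; split => w /=.
    move=> <-; rewrite /J; case: ex_minnP => n hn nmin; split => //.
    by move=> [i /= ij] /nmin; rewrite leqNgt ij.
  move=> [hj nj]; rewrite /J; case: ex_minnP => n hn nmin.
  apply/eqP; rewrite eqn_leq nmin//= leqNgt; apply/negP => ij.
  by apply: nj; exists n.
have mJN N : measurable [set w | (N <= J w)%N].
  rewrite (_ : [set w | _] = ~` \bigcup_(j < N) [set w | J w = j]).
    apply: measurableC; rewrite bigcup_mkord; exact: bigsetU_measurable.
  apply/seteqP; split => w /=.
    by move=> NJ [j /= jN Jj]; rewrite Jj leqNgt jN in NJ.
  by move=> h; rewrite leqNgt; apply/negP => JN; apply: h; exists (J w).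
(* It makes (2 l)^-1 C^2 equal to e/3; the truncation index [N] is chosen afterwards for this [l].
   The remaining third is the discretisation error governed by [eta]. *)
pose l := 3 * C ^+ 2 / (2 * e) ; have l0 : 0 < l.
  by rewrite divr_gt0 ?mulr_gt0 ?exprn_gt0.
pose rest N w : R := g w * \1_[set w | (N <= J w)%N] w.
have mrest N : measurable_fun setT (rest N).
  by apply: measurable_funM => //; exact: measurable_indic.
have rest2 : forall N w, rest N w ^+ 2 <= g w ^+ 2.
  by move=> N w; rewrite /rest exprMn ler_piMr ?sqr_ge0// indicE.
have irest N : P.-integrable setT (EFin \o (fun w => rest N w ^+ 2)).
  apply: (L1_le _ _ ig2); first exact: measurable_funX.
  by move=> w; rewrite ger0_norm ?sqr_ge0.
have [N hN] : exists N, l / 2 * (\int[P]_w (rest N w ^+ 2)) <= e / 3.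
  have dom N w : `|rest N w ^+ 2| <= g w ^+ 2 by rewrite ger0_norm ?sqr_ge0.
  have ptw w : rest N w ^+ 2 @[N --> \oo] --> (0 : R).
    apply: cvg_near_cst; near=> N.
    rewrite /rest indicE memNset ?mulr0 ?expr0n//= => NJ.
    have : (J w < N)%N by near: N; exact: nbhs_infty_gt.
    by rewrite ltnNge NJ.
  have [_ cv] := Rintegral_dominated_cvg (fun N => L1_measurable (irest N)) ptw ig2 dom.
  move: cv; rewrite Rintegral_cst// mul0r => /cvgrPdist_lt.
  have q0 : 0 < 2 * e / (3 * l) by rewrite divr_gt0// mulr_gt0.
  move=> cv; have := cv _ q0; move=> [N _ hN]; have := hN N (leqnn N).
  rewrite /= sub0r normrN => h.
  exists N; have := le_lt_trans (ler_norm _) h.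
  have l3 : 0 < 3 * l by exact: mulr_gt0.
  rewrite ltr_pdivlMr//; move: (Rintegral _ _ _) => I; lra.
pose ind j w : R := \1_[set w | J w = j] w.
have igi j : P.-integrable setT (EFin \o (fun w => g w * ind j w)).
  apply: (L1_le _ _ (L1_norm ig)).
    by apply: measurable_funM => //; exact: measurable_indic.
  move=> w; rewrite normrM ler_piMr// /ind indicE normr_nat lern1.
  exact: leq_b1.
pose h := \sum_(j < N) (\int[P]_w (g w * ind j w)) *: a j.
exists h => f' uf'; have [df' fb'] := uf'.
have mf' : measurable_fun setT (fun w => f' (Y w)) := cg_measurable (gY df').
have if2 := cg_L2 (gY df').
have igf := L2_mul mg mf' ig2 if2.
have iS : P.-integrable setT
    (EFin \o (fun w => \sum_(j < N) f' (a j) * (g w * ind j w))).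
  by apply: L1_sum => j; exact: L1Z.
have fh : f' h = \int[P]_w (\sum_(j < N) f' (a j) * (g w * ind j w)).
  rewrite (dual_sum df') RintegralT_sum; last by move=> j; exact: L1Z.
  by apply: eq_bigr => j _; rewrite (dualZ df') RintegralZl// mulrC.
rewrite fh -RintegralB//.
have iD : P.-integrable setT (EFin \o (fun w =>
    \sum_(j < N) f' (a j) * (g w * ind j w) - g w * f' (Y w))) by exact: integrableB iS igf.
apply: (le_trans (le_normr_Rintegral _ iD)) => //.
have i1 := L1Z eta (L1_norm ig).
have i2 := L1_norm (L2_mul (mrest N) mf' (irest N) if2).
apply: (@le_trans _ _ (\int[P]_w (eta * `|g w| + `|rest N w * f' (Y w)|))).
  apply: le_Rintegral => //; [exact: L1_norm|exact: L1D|].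
  move=> w _; have [NJ|JN] := leqP N (J w).
    rewrite big1; last first.
      move=> j _; rewrite /ind indicE memNset ?mulr0//= => Jj.
      by move: (ltn_ord j); rewrite -Jj ltnNge NJ.
    rewrite sub0r normrN /rest indicE mem_set//= mulr1 lerDr.
    by rewrite mulr_ge0// ltW.
  rewrite (bigD1 (Ordinal JN))//= /ind indicE mem_set//= mulr1 big1 ?addr0; last first.
    move=> j nj; rewrite indicE memNset ?mulr0//= => Jj.
    by move: nj; rewrite -val_eqE/= Jj eqxx.
  rewrite mulrC -mulrBr -(dualB df') normrM [eta * _]mulrC.
  rewrite -[X in X <= _]addr0 lerD// ler_wpM2l//.
  apply: (le_trans (fb' _)); rewrite distrC /J.
  by case: ex_minnP => n /ltW.
rewrite RintegralD// RintegralZl//; last exact: L1_norm.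
have cs := Rintegral_mul_le l0 (mrest N) mf' (irest N) if2.
have t1 : eta * I1 <= e / 3.
  rewrite /eta mulrAC ler_pdivrMr ?mulr_gt0//; last by lra.
  rewrite (_ : e / 3 * (3 * (1 + I1)) = e * (1 + I1)); last by field.
  by rewrite ler_pM2l//; lra.
have t3 : (2 * l)^-1 * (\int[P]_w (f' (Y w) ^+ 2)) <= e / 3.
  have v : \int[P]_w (f' (Y w) ^+ 2) <= C ^+ 2.
    rewrite -/(var P (fun w => f' (Y w))) -[X in X <= _]sqr_sqrtr ?var_ge0//.
    by rewrite ler_pXn2r// ?nnegrE ?sqrtr_ge0 ?(ltW C0)// hC.
  rewrite ler_pdivrMl; last by rewrite mulr_gt0.
  apply: (le_trans v).
  by rewrite /l le_eqVlt; apply/orP; left; apply/eqP; field; rewrite gt_eqF.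
rewrite -/I1; lra.
Unshelve. all: by end_near.
Qed.

(** The approximants are Cauchy in norm, since their differences are tested by a norming unit
    functional, and completeness provides the limit. Other functionals are divided by their bound
    [K]. *)
Lemma pettis f : dual B f -> exists h, forall f', dual B f' ->
  \int[P]_w (f (Y w) * f' (Y w)) = f' h.
Proof.
move=> df.
have /choice[h hh] n : exists h, forall f', unit_dual f' ->
    `|f' h - \int[P]_w (f (Y w) * f' (Y w))| <= n.+1%:R^-1.
  by apply: pettis_approx => //; rewrite invr_gt0.
have close n p : (n <= p)%N -> `|h n - h p| <= 2 / n.+1%:R.
  move=> np; have [f' uf' <-] := norming (h n - h p).
  rewrite (dualB uf'.1); have h1 := hh n f' uf'; have h2 := hh p f' uf'.
  have : p.+1%:R^-1 <= n.+1%:R^-1 :> R by rewrite lef_pV2 ?posrE// ler_nat.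
  move: h1 h2; rewrite !ler_norml; move: n.+1%:R^-1 p.+1%:R^-1 => x y.
  move=> /andP[? ?] /andP[? ?] ?; lra.
have cvh : cvg (h @ \oo).
  apply: cauchy_cvg; apply: cauchy_exP => e e0.
  have [n hn] : exists n : nat, 2 / n.+1%:R < e.
    exists (Num.trunc (2 / e)); rewrite ltr_pdivrMr// mulrC -ltr_pdivrMr//.
    exact: truncnS_gt.
  exists (h n); exists n => // p /= np; rewrite -ball_normE /=.
  exact: le_lt_trans (close _ _ np) hn.
exists (limn h) => f' df'.
have [K K0 fb] := dual_bounded df'.
have uf' : unit_dual (fun x => K^-1 * f' x).
  split; first exact: dual_scale.
  by move=> z; rewrite normrM gtr0_norm ?invr_gt0// ler_pdivrMl.
have c1 : f' (h n) @[n --> \oo] --> f' (limn h).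
  by apply: (cvg_comp _ _ cvh); exact: df'.2.
have c2 : f' (h n) @[n --> \oo] --> \int[P]_w (f (Y w) * f' (Y w)).
  apply/cvgrPdist_lt => e e0; near=> n.
  have := hh n _ uf'.
  have -> : \int[P]_w (f (Y w) * (K^-1 * f' (Y w))) =
      K^-1 * \int[P]_w (f (Y w) * f' (Y w)).
    under eq_Rintegral do rewrite mulrCA.
    rewrite RintegralZl//.
    have mf := cg_measurable (gY df); have mf' := cg_measurable (gY df').
    exact: L2_mul mf mf' (cg_L2 (gY df)) (cg_L2 (gY df')).
  rewrite -mulrBr normrM gtr0_norm ?invr_gt0// distrC ler_pdivrMl//.
  move=> /le_lt_trans; apply.
  rewrite ltr_pdivrMr// mulrC -ltr_pdivrMr//.
  apply: (lt_le_trans (truncnS_gt _)); rewrite ler_nat ltnS.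
  by near: n; exists (Num.trunc (K / e)).
exact: (cvg_unique (@Rhausdorff R) c2 c1).
Unshelve. all: by end_near.
Qed.

Lemma functional_ellipsoid_support f : dual B f ->
  exists2 h, functional_ellipsoid P Y h & f h = Num.sqrt (var P (fun w => f (Y w))).
Proof.
move=> df; set s := Num.sqrt _.
have s0 : 0 <= s by exact: sqrtr_ge0.
(* The extremal point is the Pettis integral of f(Y) Y divided by s, where f takes the value s^2 /
   s. For s = 0 the zero functional is used. *)
pose c := if s == 0 then 0 else s^-1.
have dcf : dual B (fun x => c * f x) by exact: dual_scale.
have [h hh] := pettis dcf.
have i2 := cg_L2 (gY df).
have vE : var P (fun w => f (Y w)) = s ^+ 2 by rewrite sqr_sqrtr// var_ge0.
exists h.
  exists (fun x => c * f x) => //; split => //.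
  rewrite /var; under eq_Rintegral do rewrite exprMn.
  rewrite RintegralZl// -/(var P (fun w => f (Y w))) vE -exprMn sqrtr_sqr.
  rewrite /c; case: eqVneq => [->|sn]; first by rewrite mul0r normr0.
  by rewrite mulVf// normr1.
rewrite -hh//; under eq_Rintegral do rewrite -mulrA -expr2.
rewrite RintegralZl// -/(var P (fun w => f (Y w))) vE /c.
by case: eqVneq => [->|sn]; [rewrite mul0r|rewrite expr2 mulrA mulVf// mul1r].
Qed.

End Pettis.

(** * Hausdorff convergence *)

Section HausdorffDistance.
Context (R : realType) (B : normedModType R).
Implicit Types (A C : set B) (x y z : B) (f : B -> R).

(** Only the values on [F] matter. They lie in [-S, S], which is cut into cells of length e; one
    unit functional is kept for each inhabited combination of cells, and 0 for the others. *)
Lemma finitely_many_functionals (F : seq B) (e : R) : 0 < e ->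
  exists (J : finType) (G : J -> B -> R), (forall j, unit_dual (G j)) /\
    forall f, unit_dual f -> exists j, forall y, y \in F -> `|f y - G j y| <= e.
Proof.
move=> e0; pose S := \sum_(i < size F) `|F`_i|.
pose K := Num.trunc (2 * S / e).
pose J := {ffun 'I_(size F) -> 'I_K.+1}.
pose rho f : J := [ffun i : 'I_(size F) => inord (Num.trunc ((f F`_i + S) / e))].
have FS (i : 'I_(size F)) : `|F`_i| <= S by rewrite /S (bigD1 i)//= lerDl sumr_ge0.
have bnd f (i : 'I_(size F)) : unit_dual f -> 0 <= f F`_i + S /\ f F`_i + S <= 2 * S.
  move=> [_ /(_ F`_i)]; rewrite ler_norml => /andP[h1 h2]; have := FS i.
  by move=> h; split; lra.
have rhoE f (i : 'I_(size F)) : unit_dual f ->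
    (rho f i)%:R <= (f F`_i + S) / e < (rho f i).+1%:R.
  move=> uf; have [h1 h2] := bnd f i uf; rewrite ffunE inordK.
    by apply: truncn_itv; rewrite divr_ge0// ltW.
  by rewrite ltnS; apply: le_truncn; rewrite ler_pM2r ?invr_gt0.
have u0 : unit_dual (fun=> 0 : R).
  split; last by move=> z; rewrite normr0.
  by split; [move=> *; rewrite mulr0 addr0|move=> ?; exact: cvg_cst].
have /choice[G hG] (j : J) : exists g, unit_dual g /\
    forall f, unit_dual f -> rho f = j -> rho g = j.
  have [[f [uf fj]]|nf] := pselect (exists f, unit_dual f /\ rho f = j).
    by exists f; split.
  by exists (fun=> 0); split => // f uf fj; exfalso; apply: nf; exists f.
exists J, G; split; first by move=> j; have [] := hG j.
move=> f uf; exists (rho f) => y yF.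
have [ug /(_ f uf erefl) rg] := hG (rho f).
have yi : (index y F < size F)%N by rewrite index_mem.
have := rhoE f (Ordinal yi) uf; have := rhoE _ (Ordinal yi) ug.
rewrite rg /= nth_index//; set k := nat_of_ord _; rewrite -[k.+1]addn1 natrD.
rewrite !ler_pdivlMr// !ltr_pdivrMr// ler_norml.
by move: k%:R => u /andP[? ?] /andP[? ?]; apply/andP; split; lra.
Qed.

(** Otherwise some unit f satisfies f x - f y >= 9 e for all y in [C]. Replacing f by a [G j] costs
    3 e at each of the two points (2 e to move to [F] and back, e on [F]), and the two bounds
    through [s j] cost e each: 8 e in total. *)
Lemma eps_nbhd_of_functionals A C (F : seq B) (e : R) (J : finType)
    (G : J -> B -> R) (s : J -> R) :
  C !=set0 -> segment_closed C -> 0 < e ->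
  (forall y, A y \/ C y -> exists2 z, z \in F & `|y - z| < e) ->
  (forall j, unit_dual (G j)) ->
  (forall f, unit_dual f -> exists j, forall y, y \in F -> `|f y - G j y| <= e) ->
  (forall j y, A y -> G j y <= s j + e) ->
  (forall j, exists2 y, C y & s j - e <= G j y) ->
  A `<=` eps_nbhd B C (9 * e).
Proof.
move=> C0 cC e0 cover uG approx up low x Ax; apply: contrapT => nx.
have e9 : 0 <= 9 * e by lra.
have far y : C y -> 9 * e <= `|x - y|.
  by move=> Cy; rewrite leNgt; apply/negP => xy; apply: nx; exists y.
have [f uf hf] := separation C0 cC e9 far.
have [j hj] := approx f uf.
have close y : A y \/ C y -> `|f y - G j y| <= 3 * e.
  move=> /cover[z zF yz]; have := hj z zF.
  have h1 := uf.2 (y - z); have h2 := (uG j).2 (y - z).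
  rewrite (dualB uf.1) in h1; rewrite (dualB (uG j).1) in h2.
  have := le_trans h1 (ltW yz); have := le_trans h2 (ltW yz).
  by rewrite !ler_norml => /andP[? ?] /andP[? ?] /andP[? ?]; apply/andP; split; lra.
have [y Cy hy] := low j; have := hf y Cy; have := up j x Ax.
have := close x (or_introl Ax); have := close y (or_intror Cy).
rewrite !ler_norml => /andP[? ?] /andP[? ?] ? ?; lra.
Qed.

Lemma inf_eps_nbhd_le A C (e : R) : A !=set0 -> A `<=` eps_nbhd B C e ->
  0 <= inf [set e' | A `<=` eps_nbhd B C e'] <= e.
Proof.
move=> [y Ay] h.
have lb c : [set e' | A `<=` eps_nbhd B C e'] c -> 0 <= c.
  by move=> /(_ y Ay)[z _ /ltW]; exact: le_trans.
by rewrite (inf_le lb h) andbT; apply: le_inf_set => //; exists e.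
Qed.

Lemma hausdorff_dist_le A C (e : R) : A !=set0 -> C !=set0 ->
  A `<=` eps_nbhd B C e -> C `<=` eps_nbhd B A e -> `|hausdorff_dist B A C| <= e.
Proof.
move=> A0 C0 AC CA; have /andP[h1 h2] := inf_eps_nbhd_le A0 AC.
have /andP[h3 h4] := inf_eps_nbhd_le C0 CA.
rewrite /hausdorff_dist ger0_norm; first by rewrite ge_max h2 h4.
by rewrite le_max h1.
Qed.

End HausdorffDistance.

(** * Convex hulls and covers of the rescaled sets *)

Section ConvexHull.
Context (R : realType) (B : normedModType R).
Implicit Types (A C : set B) (x y z : B) (f : B -> R).

(** Weights of positive total rather than total 1 let the induction apply to an initial segment; if
    that segment has total 0, only the last point remains. *)
Lemma convex_weighted C n (w : 'I_n -> R) (p : 'I_n -> B) : segment_closed C ->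
  (forall i, 0 <= w i) -> (forall i, C (p i)) -> 0 < \sum_i w i ->
  C ((\sum_i w i)^-1 *: \sum_i w i *: p i).
Proof.
move=> cC; elim: n w p => [|n IH] w p w0 Cp; first by rewrite big_ord0 ltxx.
rewrite !big_ord_recr/=; set W := \sum_(i < n) _; set V := \sum_(i < n) _ *: _.
have W0 : 0 <= W by exact: sumr_ge0.
move: (w0 ord_max) (Cp ord_max); set u := w ord_max; set q := p ord_max.
move=> u0 Cq Wu; have [WE|Wn] := eqVneq W 0.
  have -> : V = 0.
    rewrite /V big1// => i _.
    have := psumr_eq0P (fun i _ => w0 (widen_ord (leqnSn n) i)) WE (i := i) isT.
    by move=> ->; rewrite scale0r.
  rewrite WE !add0r scalerA mulVf ?scale1r//; move: Wu; rewrite WE add0r => Wu.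
  by rewrite gt_eqF.
have Wp : 0 < W by rewrite lt_def Wn.
have CV := IH (fun i => w (widen_ord (leqnSn n) i))
  (fun i => p (widen_ord (leqnSn n) i)) (fun i => w0 _) (fun i => Cp _) Wp.
have := cC _ _ (W / (W + u)) CV Cq.
rewrite scalerA scalerDr scalerA -/W -/V.
have -> : W / (W + u) / W = (W + u)^-1 by field; rewrite !gt_eqF.
have -> : 1 - W / (W + u) = (W + u)^-1 * u by field; rewrite gt_eqF.
apply; first by rewrite divr_ge0// ltW.
by rewrite ler_pdivrMr// mul1r lerDl.
Qed.

Lemma conv_hull_min A C : segment_closed C -> A `<=` C -> conv_hull B A `<=` C.
Proof.
move=> cC AC y [n [w [p [w0 [w1 [Ap ->]]]]]].
have := convex_weighted cC w0 (fun i => AC _ (Ap i)).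
by rewrite w1 invr1 scale1r; apply.
Qed.

Lemma sub_conv_hull A : A `<=` conv_hull B A.
Proof.
move=> y Ay; exists 1, (fun=> 1), (fun=> y); split => //.
by rewrite !big_ord1 scale1r.
Qed.

Lemma conv_hull_convex A : segment_closed (conv_hull B A).
Proof.
move=> x y t [n [w [p [w0 [w1 [Ap ->]]]]]] [n' [w' [p' [w0' [w1' [Ap' ->]]]]]] t0 t1.
exists (n + n')%N.
exists (fun i => match fintype.split i with inl j => t * w j | inr j => (1 - t) * w' j end).
exists (fun i => match fintype.split i with inl j => p j | inr j => p' j end).
have t1' : 0 <= 1 - t by lra.
have sl (j : 'I_n) : fintype.split (lshift n' j) = inl j := unsplitK (inl j).
have sr (j : 'I_n') : fintype.split (rshift n j) = inr j := unsplitK (inr j).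
split; first by move=> i; case: fintype.split => j; rewrite mulr_ge0.
split.
  rewrite big_split_ord/=; under eq_bigr do rewrite sl.
  under [X in _ + X]eq_bigr do rewrite sr.
  by rewrite -!mulr_sumr w1 w1'; ring.
split; first by move=> i; case: fintype.split.
rewrite big_split_ord/=; under [in RHS]eq_bigr do rewrite sl -scalerA.
under [X in _ = _ + X]eq_bigr do rewrite sr -scalerA.
by rewrite -!scaler_sumr.
Qed.

Lemma scale_convex C (c : R) : segment_closed C -> segment_closed [set c *: y | y in C].
Proof.
move=> cC _ _ t [x Cx <-] [y Cy <-] t0 t1; exists (t *: x + (1 - t) *: y).
  exact: cC.
by rewrite scalerDr !scalerA ![c * _]mulrC.
Qed.

Lemma halfspace_convex f (c : R) : dual B f -> segment_closed [set y | f y <= c].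
Proof.
move=> df x y t /= fx fy t0 t1; rewrite (dualD df) !(dualZ df).
have t1' : 0 <= 1 - t by lra.
have := ler_wpM2l t0 fx; have := ler_wpM2l t1' fy; lra.
Qed.

Lemma closed_conv_hull_approx A x (e : R) : 0 < e -> closed_conv_hull B A x ->
  exists2 y, conv_hull B A y & `|x - y| < e.
Proof.
move=> e0 /(_ (ball x e) (nbhsx_ballx _ _ e0))[y [Ay]].
by rewrite -ball_normE => xy; exists y.
Qed.

(** 64 is the almost sure bound on the gauges; two errors of e/128 add up to e after rescaling. *)
Lemma cube_scaled_cover (a : nat -> B) n (e : R) : 0 < e -> exists F : seq B,
  forall y, eps_nbhd B (cube a n) (e / 128) (64^-1 *: y) ->
    exists2 z, z \in F & `|y - z| < e.
Proof.
move=> e0; have e1 : 0 < e / 128 by rewrite divr_gt0.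
have [F hF] := cube_totally_bounded a n e1.
exists [seq 64 *: z | z <- F] => y [z cz yz]; have [z' zF zz] := hF z cz.
exists (64 *: z'); first exact: map_f.
have -> : y - 64 *: z' = 64 *: ((64^-1 *: y - z) + (z - z')).
  by rewrite addrA subrK scalerBr scalerA mulfV// scale1r.
rewrite normrZ ger0_norm//; have := ler_normD (64^-1 *: y - z) (z - z'); lra.
Qed.

End ConvexHull.

(** * Almost sure Hausdorff estimate at a fixed precision *)

Section Main.
Context (R : realType) (B : completeNormedModType R) (d : measure_display)
  (Om : measurableType d) (P : probability Om R) (m : nat) (X : Zm m -> Om -> B)
  (T : nat -> {fset Zm m}) (a : nat -> B) (t0 : Zm m).
Hypothesis dense_a : forall x e, 0 < e -> exists n, `|x - a n| < e.
Hypothesis mX : forall t C, cylinder_sigma B C -> measurable (X t @^-1` C).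
Hypothesis gX : forall s : seq (Zm m * (B -> R)), (forall p, p \in s -> dual B p.2) ->
  centered_gaussian P (fun w => \sum_(p <- s) p.2 (X p.1 w)).
Hypothesis lawX : forall t t' C, cylinder_sigma B C ->
  P (X t @^-1` C) = P (X t' @^-1` C).
Hypothesis Tinc : forall n, (T n `<=` T n.+1)%fset.
Hypothesis Tcard :
  forall M : nat, exists N, forall n, (N <= n)%N -> (M <= #|` T n|)%N.
Hypothesis covX : forall f, dual B f -> forall e : R, 0 < e -> exists N : nat,
  forall t s, (N <= dist_inf t s)%N ->
    (`| 'E_P[fun w => (f (X t w) * f (X s w))%R] | <= e%:E)%E.

Let bT n : R := bfun (#|` T n|)%:R.
Let S n w : set B := [set X t w | t in [set t | t \in T n]].
Let E : set B := concentration_ellipsoid B P (X t0).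
Let hull n w : set B := (fun y => (bT n)^-1 *: y) @` conv_hull B (S n w).

Lemma ae_eventually_finite (J : finType) (A : J -> nat -> Om -> Prop) :
  (forall j, {ae P, forall w, exists n0, forall n, (n0 <= n)%N -> A j n w}) ->
  {ae P, forall w, exists n0, forall j n, (n0 <= n)%N -> A j n w}.
Proof.
move=> h; have : {ae P, forall w, forall j, exists n0, forall n, (n0 <= n)%N -> A j n w}.
  exact: filter_forall.
apply: filterS => w /choice[N hN].
exists (\max_j N j) => j n /(leq_trans (leq_bigmax j)); exact: hN.
Qed.

(** The rescaled hull [H] is compared with [Q], a convex part of the ellipsoid attaining all support
    values; for [E] itself the upper bound by [sd] is enough. Both inclusions cost 9 e, and passing
    to the closure of the hull adds one more e. *)
Lemma hausdorff_dist_eventually (e : R) : 0 < e ->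
  {ae P, forall w, exists n0, forall n, (n0 <= n)%N ->
    `|hausdorff_dist B ((fun y => (bT n)^-1 *: y) @` closed_conv_hull B (S n w)) E|
      <= 10 * e}.
Proof.
(* Four times this is e/128, the radius in [cube_scaled_cover]. *)
move=> e0; have e1 : 0 < e / 512 by rewrite divr_gt0.
have [n [g hg]] := gauges_exist t0 dense_a mX gX lawX e1.
have [dg _ gK] := hg.
have [F hF] := cube_scaled_cover a n e0.
have [J [G [uG approx]]] := finitely_many_functionals F e0.
have gY f : dual B f -> centered_gaussian P (fun w => f (X t0 w)).
  by move=> df; exact: (functional_gaussian gX).
pose Q := functional_ellipsoid P (X t0).
have QE : Q `<=` E by exact: functional_ellipsoid_sub.
have supp := functional_ellipsoid_support dense_a (mX t0) gY.
have dual0_ : dual B (fun=> 0 : R).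
  by split; [move=> *; rewrite mulr0 addr0|move=> ?; exact: cvg_cst].
have Q0 : Q !=set0 by have [h Qh _] := supp _ dual0_; exists h.
have cQ : segment_closed Q by exact: functional_ellipsoid_convex.
(* On the ellipsoid a gauge is at most its standard deviation, hence at most 2, well below 64. *)
have coverE y : E y -> exists2 z, z \in F & `|y - z| < e.
  move=> Ey; apply: hF; rewrite (_ : e / 128 = 4 * (e / 512)); last by field.
  apply: gK => i; rewrite (dualZ (dg i)).
  have := ellipsoid_le_sd gY Ey (dg i); have := gauge_sd gX hg i t0; lra.
have := gauge_eventually gX Tinc Tcard hg.
have := ae_eventually_finite (fun j => functional_upper gX lawX Tinc Tcard t0 (uG j).1 e0).
have := ae_eventually_finite (fun j => functional_lower gX lawX Tinc Tcard t0 covX (uG j).1 e0).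
apply: filterS3 => w [n1 low] [n2 up] [n3 gau]; have [n4 hn4] := Tcard 1.
exists (maxn (maxn n1 n2) (maxn n3 n4)) => k; rewrite !geq_max.
move=> /andP[/andP[k1 k2] /andP[k3 k4]].
have b0 : 0 < bT k by exact: bfun_gt0.
have bi0 : 0 < (bT k)^-1 by rewrite invr_gt0.
have [t tT] : exists t, t \in T k.
  by have := hn4 k k4; rewrite cardfs_gt0 => /fset0Pn.
pose H := hull k w.
have cH : segment_closed H by apply: scale_convex; exact: conv_hull_convex.
have H0 : H !=set0.
  by exists ((bT k)^-1 *: X t w), (X t w) => //; apply: sub_conv_hull; exists t.
have coverH y : H y -> exists2 z, z \in F & `|y - z| < e.
  move=> Hy; apply: hF.
  suff : H `<=` [set y | eps_nbhd B (cube a n) (e / 128) (64^-1 *: y)] by exact.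
  have cK : segment_closed (eps_nbhd B (cube a n) (e / 128)).
    by apply: eps_nbhd_convex; exact: cube_convex.
  move=> _ [x Sx <-] /=.
  have {}cK : segment_closed
      [set x | eps_nbhd B (cube a n) (e / 128) (64^-1 *: ((bT k)^-1 *: x))].
    move=> u v s /= Ku Kv s0 s1; have := cK _ _ s Ku Kv s0 s1.
    congr eps_nbhd; rewrite !scalerDr !scalerA.
    by congr (_ *: _ + _ *: _); exact: mulrC.
  apply: (conv_hull_min cK _ Sx) => _ [t' t'T <-] /=.
  rewrite (_ : e / 128 = 4 * (e / 512)); last by field.
  apply: gK => i; rewrite !(dualZ (dg i)).
  have := gau k k3 t' t'T i; rewrite -/(bT k) => h.
  by rewrite mulrA -invfM mulrC ler_pdivrMr ?mul1r// mulr_gt0.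
have upH j y : H y -> G j y <= sd P X t0 (G j) + e.
  move=> [x Sx <-]; rewrite (dualZ (uG j).1) ler_pdivrMl// mulrC.
  apply: (conv_hull_min (halfspace_convex (uG j).1) _ Sx) => _ [t' t'T <-] /=.
  exact: up.
have lowH j : exists2 y, H y & sd P X t0 (G j) - e <= G j y.
  have [t' t'T h] := low j k k1.
  exists ((bT k)^-1 *: X t' w).
    by exists (X t' w) => //; apply: sub_conv_hull; exists t'.
  by rewrite (dualZ (uG j).1) ler_pdivlMl// mulrC.
have upE j y : E y -> G j y <= sd P X t0 (G j) + e.
  by move=> Ey; have := ellipsoid_le_sd gY Ey (uG j).1; rewrite /sd; lra.
have lowQ j : exists2 y, Q y & sd P X t0 (G j) - e <= G j y.
  by have [y Qy yE] := supp _ (uG j).1; exists y => //; rewrite yE /sd; lra.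
have HQ : H `<=` eps_nbhd B Q (9 * e).
  apply: (eps_nbhd_of_functionals Q0 cQ e0 _ uG approx upH lowQ) => y.
  by move=> [/coverH|/QE/coverE].
have EH : E `<=` eps_nbhd B H (9 * e).
  apply: (eps_nbhd_of_functionals H0 cH e0 _ uG approx upE lowH) => y.
  by move=> [/coverE|/coverH].
apply: hausdorff_dist_le.
- have [_ [x Sx _]] := H0; exists ((bT k)^-1 *: x); exists x => //.
  exact: subset_closure.
- by have [y Qy] := Q0; exists y; exact: QE.
- move=> _ [x Sx <-].
  have [x' Sx' xx] := closed_conv_hull_approx (mulr_gt0 b0 e0) Sx.
  have [z Qz xz] : eps_nbhd B Q (9 * e) ((bT k)^-1 *: x') by apply: HQ; exists x'.
  exists z; first exact: QE.
  have : `|(bT k)^-1 *: x - (bT k)^-1 *: x'| < e.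
    by rewrite -scalerBr normrZ gtr0_norm// ltr_pdivrMl.
  have := ler_normD ((bT k)^-1 *: x - (bT k)^-1 *: x') ((bT k)^-1 *: x' - z).
  by rewrite addrA subrK; lra.
- move=> y /EH[z [x Sx <-] yz]; exists ((bT k)^-1 *: x); last by lra.
  by exists x => //; exact: subset_closure.
Qed.

End Main.

Theorem theorem1 (R : realType) (B : completeNormedModType R)
  (d : measure_display) (Om : measurableType d) (P : probability Om R)
  (m : nat) (X : Zm m -> Om -> B) (T : nat -> {fset Zm m}) :
  separable B ->
  (* each X_t is a random element of B (cylinder = Borel sigma-algebra) *)
  (forall t C, cylinder_sigma B C -> measurable (X t @^-1` C)) ->
  (* X is a centered Gaussian process *)
  (forall s : seq (Zm m * (B -> R)), (forall p, p \in s -> dual B p.2) ->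
     centered_gaussian P (fun w => \sum_(p <- s) p.2 (X p.1 w))) ->
  (* all X_t have the same distribution *)
  (forall t t' C, cylinder_sigma B C ->
     P (X t @^-1` C) = P (X t' @^-1` C)) ->
  (* (T_n) increasing, card T_n -> oo *)
  (forall n, (T n `<=` T n.+1)%fset) ->
  (forall M : nat, exists N, forall n, (N <= n)%N -> (M <= #|` T n|)%N) ->
  (* covariance decay *)
  (forall f, dual B f -> forall e : R, 0 < e -> exists N : nat,
     forall t s, (N <= dist_inf t s)%N ->
       (`| 'E_P[fun w => (f (X t w) * f (X s w))%R] | <= e%:E)%E) ->
  forall t0 : Zm m,
  {ae P, forall w,
     hausdorff_dist B
       ((fun y => (bfun (#|` T n|)%:R)^-1 *: y) @`
          closed_conv_hull B [set X t w | t in [set t | t \in T n]])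
       (concentration_ellipsoid B P (X t0))
     @[n --> \oo] --> 0}.
Proof.
move=> sepB mX gX lawX Tinc Tcard covX t0.
have [a dense_a] := separable_dense_seq sepB.
have pos k : 0 < k.+1%:R^-1 :> R by rewrite invr_gt0.
have ev := ae_foralln (fun k =>
  hausdorff_dist_eventually t0 dense_a mX gX lawX Tinc Tcard covX (pos k)).
apply: filterS ev => w ev; apply/cvgrPdist_le => e e0.
(* For this index k, 10 / (k + 1) <= e. *)
have [n0 hn0] := ev (Num.trunc (10 / e)).
exists n0 => // n /= /hn0; rewrite sub0r normrN => /le_trans; apply.
rewrite ler_pdivrMr// mulrC -ler_pdivrMr// ltW//; exact: truncnS_gt.
Qed.
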